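(* Let $q$ be an odd prime power. (i) The measures $P\in\mathcal P_0^{U(2\infty,q^2)}$ (resp. $P\in\mathcal P_0^{U(2\infty+1,q^2)}$) are in one-to-one correspondence with the nonnegative harmonic functions $\varphi$ on the branching graph $\mathbb Y^{\mathrm{HL}}_{\mathscr E}(-q^{-1})$ (resp. $\mathbb Y^{\mathrm{HL}}_{\mathscr O}(-q^{-1})$). This correspondence $P\leftrightarrow\varphi$ is uniquely determined by the following property: for every $n\ge0$, with $N=2n$ (resp. $N=2n+1$), every partition $\lambda$ of size $N$, and every nilpotent matrix $X\in\mathfrak u(N,q^2)$ of Jordan type $\lambda$, $$P(\mathrm{Cyl}(X))=q^{\,n(\lambda)-N(N-1)/2}\,\varphi(\lambda),$$ where $\mathrm{Cyl}(X)$ stands for $\mathrm{Cyl}^{\mathscr E}_n(X)$ (resp. $\mathrm{Cyl}^{\mathscr O}_n(X)$). (ii) The correspondence $P\leftrightarrow\varphi$ establishes affine isomorphisms of convex cones $$\mathcal P_0^{U(2\infty,q^2)}\leftrightarrow\mathcal H_+(\mathbb Y^{\mathrm{HL}}_{\mathscr E}(-q^{-1})),\qquad \mathcal P_0^{U(2\infty+1,q^2)}\leftrightarrow\mathcal H_+(\mathbb Y^{\mathrm{HL}}_{\mathscr O}(-q^{-1})).$$ In particular, ergodic measures $P$ correspond precisely to extreme harmonic functions $\varphi$.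
   Context: **Finite unitary groups.** $q$ is an odd prime power, $\bar x=x^q$ for $x\in\mathbb F_{q^2}$, $\varepsilon\in\mathbb F_{q^2}\setminus\mathbb F_q$ is a fixed element with $\bar\varepsilon=-\varepsilon$; $A^*$ is the conjugate transpose. $W_N$ is the $N\times N$ matrix with $1$'s on the secondary diagonal and $0$'s elsewhere, and $\tau(x,y)=y^*W_Nx$ on $\mathbb F_{q^2}^N$. $U(N,q^2)\subset GL(N,\mathbb F_{q^2})$ is the group preserving $\tau$; $\mathfrak u(N,q^2)$ is the set of $A\in\mathrm{Mat}_N(\mathbb F_{q^2})$ with $\tau(Au,v)+\tau(u,Av)=0$ for all $u,v$. The Jordan type of a nilpotent matrix is the partition formed by the sizes of its Jordan blocks. **Infinite groups and spaces.** Index rows and columns of matrices in $U(2n,q^2),\mathfrak u(2n,q^2)$ by $I_n^{\mathscr E}=\{-n,\dots,-1,1,\dots,n\}$, and of matrices in $U(2n+1,q^2),\mathfrak u(2n+1,q^2)$ by $I^{\mathscr O}_n=\{-n,\dots,n\}$. Extending by the identity gives the inductive limit groups $U(2\infty,q^2)=\varinjlim U(2n,q^2)$ and $U(2\infty+1,q^2)=\varinjlim U(2n+1,q^2)$, of matrices indexed by $I^{\mathscr E}=\mathbb Z\setminus\{0\}$ and $I^{\mathscr O}=\mathbb Z$, respectively. Let $\star\in\{\mathscr E,\mathscr O\}$. For $n\ge0$, $\mathbb L_n^\star(q^2)$ is the set of matrices $M=[m_{i,j}]_{i,j\in I^\star}$ over $\mathbb F_{q^2}$ such that $m_{i,j}=0$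 whenever $i\ge j$ and $\max\{|i|,|j|\}>n$, and $m_{-b,-a}=-\overline{m_{a,b}}$ for all $a,b$. Set $\mathbb L^\star(q^2)=\bigcup_{n\ge0}\mathbb L^\star_n(q^2)$, an additive group with the group topology in which the subgroups $\mathbb L^\star_{-n}(q^2)=\{M\in\mathbb L^\star_0(q^2): m_{i,j}=0\text{ for }|i|,|j|\le n\}$, $n\ge1$, form a fundamental system of neighborhoods of $0$; it is locally compact. $U(2\infty,q^2)$ acts on $\mathbb L^{\mathscr E}(q^2)$, and $U(2\infty+1,q^2)$ on $\mathbb L^{\mathscr O}(q^2)$, by conjugation. Let $M^{[n]}=[m_{i,j}]_{i,j\in I_n^\star}$. For $X\in\mathfrak u(2n,q^2)$ (if $\star=\mathscr E$) or $X\in\mathfrak u(2n+1,q^2)$ (if $\star=\mathscr O$), $$\mathrm{Cyl}^\star_n(X)=\{M\in\mathbb L^\star_n(q^2): M^{[n]}=X\}$$ (for $\star=\mathscr E$, $n=0$ this is $\mathbb L_0^{\mathscr E}(q^2)$). $\mathrm{Nil}(\mathbb L^\star(q^2))$ is the union over $n\ge0$ of the sets $\{M\in\mathbb L^\star_n(q^2): M^{[n]}\text{ nilpotent}\}$. **Measures.** A Radon measure is a nonnegative Borel measure that is finite on compact sets. $\mathcal P_0^{U(2\infty,q^2)}$ (resp. $\mathcal P_0^{U(2\infty+1,q^2)}$) is the convex cone of $U(2\infty,q^2)$-invariant Radon measures on $\mathbb L^{\mathscr E}(q^2)$ (resp. $U(2\infty+1,q^2)$-invariant Radon measures on $\mathbb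 L^{\mathscr O}(q^2)$) supported on (i.e. vanishing outside) $\mathrm{Nil}(\mathbb L^{\mathscr E}(q^2))$ (resp. $\mathrm{Nil}(\mathbb L^{\mathscr O}(q^2))$). A nonzero invariant measure is ergodic if for every invariant Borel set $A$, either $A$ or its complement is null. An affine isomorphism of convex cones is a bijection preserving sums and multiplication by nonnegative reals. **Graphs.** For a partition $\lambda$: $|\lambda|=\sum\lambda_i$, $n(\lambda)=\sum(i-1)\lambda_i$, $m_i(\lambda)=\#\{j:\lambda_j=i\}$ ($i\ge1$). For $|\lambda|=|\mu|+2$, write $\mu\nearrow\!\nearrow\lambda$ if $\mu\subset\lambda$ and the two boxes of $\lambda\setminus\mu$ lie in a single column or in two consecutive columns. For $t\in(-1,0)$ and $\mu\nearrow\!\nearrow\lambda$, set $\xi_{\lambda/\mu}(t)=(1-t^{m_{k-1}(\mu)})(1-t^{m_{k-1}(\mu)-1})$ if $\lambda\setminus\mu$ lies in the single column $k$, and $\xi_{\lambda/\mu}(t)=(-t)^{m_k(\mu)}(1+t)(1-t^{m_{k-1}(\mu)})$ if it lies in columns $k,k+1$, with $t^{m_0(\mu)}=t^{m_0(\mu)-1}=0$. (These are the coefficients of multiplication by $(1-t^2)p_2$ in the basis $(-1)^{n(\lambda)}Q_\lambda(\,;t)$ of Hall–Littlewood functions.) The graph $\mathbb Y^{\mathrm{HL}}_{\mathscr E}(t)$ (resp. $\mathbb Y^{\mathrm{HL}}_{\mathscr O}(t)$) has as vertices all partitions of even (resp. odd) size, an edge for each pair $\mu\nearrow\!\nearrow\lambda$,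 and edge weights $\xi_{\lambda/\mu}(t)>0$. A harmonic function on it is a real function $\varphi$ on vertices with $\varphi(\mu)=\sum_{\lambda:\mu\nearrow\!\nearrow\lambda}\xi_{\lambda/\mu}(t)\varphi(\lambda)$ for all $\mu$. $\mathcal H_+$ denotes the convex cone of nonnegative harmonic functions; a nonzero element of it is extreme if it spans an extreme ray of the cone. *)

(* Defs.v *)
From HB Require Import structures.
From mathcomp Require Import all_boot all_order all_algebra all_field.
From mathcomp Require Import mathcomp_extra boolp classical_sets functions.
From mathcomp Require Import cardinality fsbigop reals ereal topology.
From mathcomp Require Import normedtype tvs interval_inference measure.
From mathcomp Require Import zify ring lra.

Set Implicit Arguments.
Unset Strict Implicit.
Unset Printing Implicit Defensive.

Import Order.TTheory GRing.Theory Num.Theory.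

Local Open Scope classical_set_scope.
Local Open Scope ring_scope.

(* The field with q^2 elements, q an odd prime power. *)
Record quadField := QuadField {
  qF :> finFieldType ;
  qq : nat ;
  qq_odd_primepower :
    exists p k : nat, [/\ prime p, odd p, (0 < k)%N & qq = (p ^ k)%N] ;
  card_qF : #|qF| = (qq ^ 2)%N }.

Section FiniteUnitary.
Variable K : quadField.

Definition bar (x : K) : K := x ^+ qq K.

Lemma qq_gt0 : (0 < qq K)%N.
Proof.
by have [p [k [pp _ _ ->]]] := qq_odd_primepower K; rewrite expn_gt0 prime_gt0.
Qed.

Lemma qq_pnat : [pchar K].-nat (qq K).
Proof.
have [p [k [pp _ k0 qE]]] := qq_odd_primepower K.
have cK : p \in [pchar K].
  by apply: (@card_finPcharP _ _ (k * 2)) => //; rewrite card_qF qE expnM.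
by rewrite qE pnatX pnatE ?cK.
Qed.

Lemma bar0 : bar 0 = 0.
Proof. by rewrite /bar expr0n -leqn0 leqNgt qq_gt0. Qed.

Lemma barD x y : bar (x + y) = bar x + bar y.
Proof. exact: (exprDn_pchar _ _ qq_pnat). Qed.

Lemma barN x : bar (- x) = - bar x.
Proof. by apply/eqP; rewrite -addr_eq0 -barD addNr bar0. Qed.

Definition ctrmx m n (A : 'M[K]_(m, n)) : 'M[K]_(n, m) := map_mx bar A^T.

Definition Wmx N : 'M[K]_N := \matrix_(i, j) (j == rev_ord i)%:R.

Definition tau N (x y : 'cV[K]_N) : K := (ctrmx y *m Wmx N *m x) 0 0.

Definition unitary N : set 'M[K]_N :=
  [set A | A \in unitmx /\ forall x y, tau (A *m x) (A *m y) = tau x y].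

Definition unitary_lie N : set 'M[K]_N :=
  [set A | forall x y, tau (A *m x) y + tau x (A *m y) = 0].

Definition nilpotent_mx N (A : 'M[K]_N) := exists k : nat, A ^+ k = 0.

End FiniteUnitary.

Section Partitions.

Definition is_partition (la : seq nat) : bool := sorted geq la && (0 \notin la).

(* The part la_(i+1) is [nth 0 la i]; it is 0 beyond the length of la. *)
Definition npart (la : seq nat) : nat :=
  (\sum_(i < size la) i * nth 0 la i)%N.

Definition mult (i : nat) (la : seq nat) : nat := count_mem i la.

Definition subpartition (mu la : seq nat) : bool :=
  all (fun i => nth 0 mu i <= nth 0 la i)%N (iota 0 (size mu)).

(* The columns (numbered from 1) of the boxes of la \ mu, in nondecreasing
   order, each repeated as many times as it contains boxes. *)
Definition skew_columns (la mu : seq nat) : seq nat :=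
  sort leq (flatten
    [seq iota (nth 0 mu i).+1 (nth 0 la i - nth 0 mu i) | i <- iota 0 (size la)]).

Definition edge (mu la : seq nat) : bool :=
  [&& sumn la == (sumn mu).+2, subpartition mu la &
      if skew_columns la mu is [:: k; l] then (l == k) || (l == k.+1)
      else false].

Variable R : realType.

(* t ^ e, with the convention that both t^(m_0) and t^(m_0 - 1) are 0. *)
Definition tpow (t : R) (i e : nat) : R := if i is 0 then 0 else t ^+ e.

(* On an edge of the single-column kind with k > 1 one has m_(k-1)(mu) >= 2,
   so that truncation in the predecessor is harmless. *)
Definition xi (t : R) (mu la : seq nat) : R :=
  if skew_columns la mu is [:: k; l] then
    if l == k then
      (1 - tpow t k.-1 (mult k.-1 mu)) * (1 - tpow t k.-1 (mult k.-1 mu).-1)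
    else if l == k.+1 then
      (- t) ^+ mult k mu * (1 + t) * (1 - tpow t k.-1 (mult k.-1 mu))
    else 0
  else 0.

(* [o = false]: partitions of even size; [o = true]: of odd size. *)
Definition vertex (o : bool) : Type :=
  {la : seq nat | is_partition la && (odd (sumn la) == o)}.
HB.instance Definition _ o := Choice.on (vertex o).

Definition harmonic (o : bool) (t : R) (phi : vertex o -> R) : Prop :=
  forall mu : vertex o,
    phi mu = \sum_(la \in [set la : vertex o | edge (val mu) (val la)])
               xi t (val mu) (val la) * phi la.

Definition Hplus (o : bool) (t : R) : set (vertex o -> R) :=
  [set phi | harmonic t phi /\ forall la, 0 <= phi la].

Definition ray (o : bool) (phi : vertex o -> R) : set (vertex o -> R) :=
  [set psi | exists2 c : R, 0 <= c & forall la, psi la = c * phi la].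

Definition extreme (o : bool) (t : R) (phi : vertex o -> R) : Prop :=
  [/\ Hplus t phi, (exists la, phi la != 0) &
    forall phi1 phi2, Hplus t phi1 -> Hplus t phi2 ->
      ray phi (fun la => phi1 la + phi2 la) -> ray phi phi1 /\ ray phi phi2].

End Partitions.

Section JordanType.
Variable K : fieldType.

Definition nil_block m : 'M[K]_m := \matrix_(i, j) (j == i.+1 :> nat)%:R.

Definition jordan_mx (la : seq nat) : 'M[K]_(\sum_(i < size la) nth 0 la i) :=
  \mxdiag_(i < size la) nil_block (nth 0 la i).

(* A rectangular P that is both row free and row full is an invertible matrix,
   and then N is the sum of la. *)
Definition jordan_type N (A : 'M[K]_N) (la : seq nat) : Prop :=
  is_partition la /\
  exists P : 'M[K]_(\sum_(i < size la) nth 0 la i, N),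
    [/\ row_free P, row_full P & P *m A = jordan_mx la *m P].

End JordanType.

Section InfiniteMatrices.
Variables (K : quadField) (o : bool).

(* [o = false]: the even case, rows and columns indexed by Z \ {0};
   [o = true]: the odd case, rows and columns indexed by Z. *)
Definition idx : Type := {i : int | o || (i != 0)}.
HB.instance Definition _ := Choice.on idx.

Lemma idx_opp_subproof (i : idx) : o || (- val i != 0).
Proof. by rewrite oppr_eq0; exact: (valP i). Qed.
Definition idx_opp (i : idx) : idx :=
  exist _ (- val i) (idx_opp_subproof i).

Definition dimN (n : nat) : nat := (2 * n + o)%N.

(* The increasing bijection from 'I_(dimN n) to the indices i with |i| <= n. *)
Definition idx_val (n k : nat) : int :=
  if o || (k < n)%N then k%:Z - n%:Z else k.+1%:Z - n%:Z.

Lemma idx_of_subproof n k : o || (idx_val n k != 0).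
Proof. by rewrite /idx_val; case: o => //=; case: ltnP => h; lia. Qed.
Definition idx_of n (k : 'I_(dimN n)) : idx :=
  exist _ (idx_val n k) (idx_of_subproof n k).

Definition imx : Type := idx -> idx -> K.
HB.instance Definition _ := GRing.Zmodule.on imx.

Definition block n (M : imx) : 'M[K]_(dimN n) :=
  \matrix_(i, j) M (idx_of i) (idx_of j).

Definition outside n (i j : idx) : bool :=
  (n < maxn `|val i|%N `|val j|%N)%N.

Definition iid : imx := fun i j => (i == j)%:R.

(* In every product used below the sum over k has finite support. *)
Definition imul (A B : imx) : imx :=
  fun i j => \sum_(k \in [set: idx]) A i k * B k j.

(* The image of the n-th finite unitary group in the inductive limit. *)
Definition Ulevel n : set imx :=
  [set g | unitary (block n g) /\
           forall i j, outside n i j -> g i j = iid i j].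

Definition Uinf : set imx := \bigcup_n Ulevel n.

Definition Llevel n : set imx :=
  [set M | (forall i j, val j <= val i -> outside n i j -> M i j = 0) /\
           (forall a b, M (idx_opp b) (idx_opp a) = - bar (M a b))].

Definition Lset : set imx := \bigcup_n Llevel n.

Definition Lneg n : set imx :=
  [set M | Llevel 0 M /\ forall i j, ~~ outside n i j -> M i j = 0].

Definition Lpred : {pred imx} := mem Lset.

Lemma Llevel_le m n : (m <= n)%N -> Llevel m `<=` Llevel n.
Proof.
move=> mn M [h1 h2]; split=> // i j ji ij; apply: h1 => //.
exact: leq_ltn_trans ij.
Qed.

Lemma Lneg_ge m n : (m <= n)%N -> Lneg n `<=` Lneg m.
Proof.
move=> mn M [h1 h2]; split=> // i j ij; apply: h2.
by move: ij; rewrite /outside -!leqNgt => /leq_trans; apply.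
Qed.

Lemma Llevel0 n : Llevel n 0.
Proof. by split=> // a b; rewrite bar0 oppr0. Qed.

Lemma LlevelB n M M' : Llevel n M -> Llevel n M' -> Llevel n (M - M').
Proof.
move=> [h1 h2] [h1' h2']; split=> [i j ji ij|a b].
  by rewrite !fctE h1// h1'// subr0.
by rewrite !fctE h2 h2' barD barN !opprD.
Qed.

Lemma Lpred_zmod : zmod_closed Lpred.
Proof.
split; first by rewrite inE; exists 0%N => //; exact: Llevel0.
move=> M M'; rewrite !inE => -[m _ hm] [m' _ hm'].
exists (maxn m m') => //.
by apply: LlevelB; [apply: Llevel_le hm | apply: Llevel_le hm'];
  rewrite ?leq_maxl ?leq_maxr.
Qed.

HB.instance Definition _ := GRing.isZmodClosed.Build imx Lpred Lpred_zmod.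

Record Lspace := MkLspace { Lmx :> imx ; LmxP : Lmx \in Lpred }.
HB.instance Definition _ := [isSub for Lmx].
HB.instance Definition _ := gen_eqMixin Lspace.
HB.instance Definition _ := gen_choiceMixin Lspace.
HB.instance Definition _ := [SubChoice_isSubZmodule of Lspace by <:].
HB.instance Definition _ := isPointed.Build Lspace 0.

Definition Lopen : set (set Lspace) :=
  [set A | forall M, A M ->
     exists2 n, (1 <= n)%N & forall Z : Lspace, Lneg n Z -> A (M + Z)].

Lemma LopenT : Lopen setT.
Proof. by move=> M _; exists 1%N. Qed.

Lemma LopenI : setI_closed Lopen.
Proof.
move=> A B oA oB M [/oA[m m1 hA] /oB[n n1 hB]].
exists (maxn m n); first by rewrite leq_max m1.
by move=> Z hZ; split; [apply: hA|apply: hB]; apply: Lneg_ge hZ;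
  rewrite ?leq_maxl ?leq_maxr.
Qed.

Lemma Lopen_bigU (I : Type) (f : I -> set Lspace) :
  (forall i, Lopen (f i)) -> Lopen (\bigcup_i f i).
Proof.
move=> of_ M [i _ /of_[n n1 h]]; exists n => // Z /h fZ.
by exists i.
Qed.

HB.instance Definition _ :=
  isOpenTopological.Build Lspace LopenT LopenI Lopen_bigU.

Lemma LnegB n (M M' : Lspace) : Lneg n M -> Lneg n M' -> Lneg n (M - M').
Proof.
move=> [h1 h2] [h1' h2']; split; first exact: LlevelB.
move=> i j ij.
by rewrite [LHS](_ : _ = (M : imx) i j - (M' : imx) i j)// h2// h2'// subr0.
Qed.

Lemma Lneg0 n : Lneg n (0 : Lspace).
Proof. by split => //; exact: Llevel0. Qed.

Lemma Lnbhs (M : Lspace) (A : set Lspace) :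
  nbhs M A <->
  exists2 n, (1 <= n)%N & forall Z : Lspace, Lneg n Z -> A (M + Z).
Proof.
rewrite nbhsE; split=> [[B [oB BM] BA]|[n n1 h]].
  by have [n n1 h] := oB _ BM; exists n => // Z /h /BA.
exists [set M' : Lspace | Lneg n (M' - M : Lspace)]; last first.
  by move=> M' /h; rewrite addrC subrK.
split; last by rewrite /= subrr; exact: Lneg0.
move=> M' hM'; exists n => // Z hZ.
change (Lneg n (M' + Z - M : Lspace)).
have -> : M' + Z - M = (M' - M) - (0 - Z) by rewrite sub0r opprK addrAC.
apply: LnegB => //; apply: LnegB => //; exact: Lneg0.
Qed.

Lemma Lsub_continuous : continuous (fun x : Lspace * Lspace => x.1 - x.2).
Proof.
move=> [M N] A /Lnbhs[n n1 hA].
exists ([set M + Z | Z in [set Z : Lspace | Lneg n Z]],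
        [set N + Z | Z in [set Z : Lspace | Lneg n Z]]).
  by split; apply/Lnbhs; exists n => // Z hZ; exists Z.
move=> [_ _] [/= [Z hZ <-] [Z' hZ' <-]].
by rewrite opprD addrACA; apply: hA; exact: LnegB.
Qed.

HB.instance Definition _ :=
  PreTopologicalNmodule_isTopologicalZmodule.Build Lspace Lsub_continuous.

Definition Lborel := g_sigma_algebraType (@open Lspace).

Definition Cyl n (X : 'M[K]_(dimN n)) : set Lspace :=
  [set M : Lspace | Llevel n M /\ block n M = X].

Definition NilL : set Lspace :=
  [set M : Lspace | exists2 n, Llevel n M & nilpotent_mx (block n M)].

Definition is_inverse (g h : imx) : Prop := imul g h = iid /\ imul h g = iid.

(* The image of A under M |-> g M h, used with h the inverse of g. *)
Definition translate (g h : imx) (A : set Lspace) : set Lspace :=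
  [set M : Lspace | exists2 M' : Lspace, A M' & imul (imul g M') h = M].

Definition invariant_set (A : set Lspace) : Prop :=
  forall g h, Uinf g -> Uinf h -> is_inverse g h -> translate g h A = A.

Section Measures.
Variable R : realType.
Implicit Types P : {measure set Lborel -> \bar R}.

(* Values on non-Borel sets are irrelevant, so two Borel measures are
   identified when they agree on the Borel sets. *)
Definition same_measure P1 P2 : Prop :=
  forall A : set Lborel, measurable A -> P1 A = P2 A.

Definition radon P : Prop :=
  forall A : set Lspace, compact A -> (P A < +oo)%E.

Definition invariant_measure P : Prop :=
  forall g h, Uinf g -> Uinf h -> is_inverse g h ->
  forall A : set Lborel, measurable A -> P (translate g h A) = P A.

Definition P0 : set {measure set Lborel -> \bar R} :=
  [set P | [/\ radon P, invariant_measure P & P (~` NilL) = 0%E]].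

Lemma P0_measure_add P P' : P0 P -> P0 P' -> P0 (measure_add P P').
Proof.
move=> [r i z] [r' i' z']; split=> [A cA|g h Ug Uh gh A mA|].
- rewrite [ltLHS](measure_addE P P' A).
  by apply: lte_add_pinfty; [exact: r|exact: r'].
- rewrite [LHS](measure_addE P P') [RHS](measure_addE P P').
  by congr (_ + _)%E; [exact: i|exact: i'].
- rewrite [LHS](measure_addE P P' (~` NilL)) -[RHS]adde0.
  by congr (_ + _)%E.
Qed.

Lemma P0_mscale (c : {nonneg R}) P : P0 P -> P0 (mscale c P).
Proof.
move=> [r i z]; split=> [A cA|g h Ug Uh gh A mA|].
- by rewrite /mscale/= lte_mul_pinfty//; exact: r.
- by rewrite /mscale/=; congr (_ * _)%E; exact: i.
- by rewrite /mscale/= -[RHS](mule0 c%:num%:E); congr (_ * _)%E.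
Qed.

Definition ergodic P : Prop :=
  [/\ P setT != 0%E, invariant_measure P &
    forall A : set Lborel, measurable A -> invariant_set A ->
      P A = 0%E \/ P (~` A) = 0%E].

(* The exponent is an integer, in general negative. *)
Definition compatible P (phi : vertex o -> R) : Prop :=
  forall (n : nat) (la : vertex o) (X : 'M[K]_(dimN n)),
    sumn (val la) = dimN n ->
    unitary_lie X -> nilpotent_mx X -> jordan_type X (val la) ->
    P (Cyl X) =
      (((qq K)%:R : R) ^ ((npart (val la))%:Z
                          - ((dimN n * (dimN n).-1)./2)%:Z) * phi la)%:E.

End Measures.

End InfiniteMatrices.

(* Main.v *)
(* A nilpotent X in u(N) has a basis of Jordan chains x, xX, ..., xX^(d-1) that is
   orthogonal for tau, with prescribed values of tau(xX^(d-1), x): a vector x with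
   tau(xX^(d-1), x) != 0 for the largest d is corrected by lower terms of its chain
   and rescaled (norms are surjective onto F_q), and its chain is split off.  Hence
   the nilpotent U(N)-orbits in u(N) are indexed by the partitions of N.

   Let Y in u(N+2) border X of type mu, by a vector w and a skew scalar c.  The
   ranks of the powers of Y show that the type of Y is mu with one box added in
   column k+1, for the first k such that w X^k is in the image of X^(k+1), and
   another one in column k+1 or k+2.  Column k+1 occurs when a hermitian form in the
   m_k(mu) coordinates of w on the tops of the chains of length k vanishes (when
   k = 0, when c takes one particular value).  Counting isotropic vectors turns the
   numbers of such Y, suitably weighted, into the coefficients xi at t = -1/q, so
   the values of an invariant measure on cylinders are exactly a harmonic function;
   Caratheodory extension from the ring of compact open sets gives back the measure.

   Restricting a measure to an invariant set splits it, so extreme functions come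
   from ergodic measures.  Conversely, if P is ergodic and P1 << P is invariant, the
   Hahn decomposition of P1 - a P is invariant up to null sets, so P1 <= a P or
   P1 >= a P for each a >= 0, and P1 is proportional to P. *)

Require Import Defs.
From HB Require Import structures.
From mathcomp Require Import all_boot all_order all_algebra all_field.
From mathcomp Require Import all_fingroup all_solvable mxabelem.
From mathcomp Require Import boolp reals.
From mathcomp Require Import zify ring lra.

Set Implicit Arguments.
Unset Strict Implicit.
Unset Printing Implicit Defensive.

Import Order.TTheory GRing.Theory Num.Theory.
Local Open Scope ring_scope.

(** The value t = -1/q comes from isotropic vectors: their numbers satisfy A(m+1) + q A(m) = (q+1)
    q^(2m), whose homogeneous solution is (-q)^m. The exponent N(N-1)/2 grows by 2N+1 from N to N+2,
    and q^(2N+1) is the number of all borders (w, c) of a matrix of size N; the growth of n(lambda)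
    absorbs the powers of q by which the number of borders of a given type falls short of this.
    Oddness of q gives an invertible 2, needed to correct chains, and a nonzero skew scalar e, which
    normalizes the chains of even length. A compact open set is determined, at a large enough level
    n, by the finite set of n-th blocks of its elements. A measure therefore amounts to a compatible
    family of functions on finite matrices, and identities between infinite matrices are checked on
    blocks. The measures may be infinite, so Hahn decompositions exist only on the compact open
    pieces of level n. What saves the ergodicity argument is that the group is countable: the union
    of all translates of the positive pieces is still Borel, and it is exactly invariant. *)

(** * The quadratic extension and isotropic vectors *)

Section Bar.
Variable K : quadField.
Notation q := (qq K).
Notation bar := (@bar K).

Lemma barB : {morph bar : x y / x - y}.
Proof. by move=> x y; rewrite barD barN. Qed.

Lemma bar_monoid_morphism : monoid_morphism bar.
Proof. by split=> [|x y]; rewrite /Defs.bar ?expr1n ?exprMn. Qed.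

HB.instance Definition _ := GRing.isZmodMorphism.Build K K bar barB.
HB.instance Definition _ := GRing.isMonoidMorphism.Build K K bar bar_monoid_morphism.

Lemma barK : involutive bar.
Proof. by move=> x; rewrite /Defs.bar -exprM -{2}[x]expf_card card_qF. Qed.

Lemma qq_odd : odd q.
Proof.
have [p [k [pp op k0 ->]]] := qq_odd_primepower K.
by rewrite oddX op orbT.
Qed.

Lemma qq_gt2 : (2 < q)%N.
Proof.
have [p [k [pp op k0 ->]]] := qq_odd_primepower K.
have p2 : (2 < p)%N by case: p pp op {k k0} => [|[|[]]].
by apply: leq_trans p2 _; rewrite -{1}(expn1 p) leq_exp2l ?prime_gt1.
Qed.

Lemma two_neq0 : (2 : K) != 0.
Proof.
have [p [k [pp op k0 qE]]] := qq_odd_primepower K.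
have cK : p \in [pchar K].
  by apply: (@card_finPcharP _ _ (k * 2)) => //; rewrite card_qF qE expnM.
rewrite -(dvdn_pcharf cK) dvdn_prime2 //.
by apply/eqP => p2; rewrite p2 in op.
Qed.

Lemma exists_generator : exists z : K, (q ^ 2).-1.-primitive_root z.
Proof.
set n := (q ^ 2).-1; have q2 := qq_gt2.
have n0 : (0 < n)%N by rewrite /n; nia.
have rs1 : all n.-unity_root (enum [pred x : K | x != 0]).
  apply/allP => x; rewrite mem_enum inE => x0; rewrite unity_rootE.
  apply/eqP/(mulfI x0); rewrite -exprS mulr1 prednK; last by nia.
  by rewrite -card_qF expf_card.
have rs2 : (n <= size (enum [pred x : K | x != 0%R]))%N.
  by rewrite -cardE -[X in (_ <= X)%N]/#|predC1 (0 : K)| cardC1 card_qF.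
have /hasP[z _ zP] := has_prim_root n0 rs1 (enum_uniq _) rs2.
by exists z.
Qed.

(** Write y = z^i for a generator z. Being fixed by [bar] means y^(q-1) = 1, which forces q + 1 to
    divide i, and the norm is the (q+1)-st power. *)
Lemma norm_surj (y : K) : y != 0 -> bar y = y -> exists2 x, x != 0 & x * bar x = y.
Proof.
move=> y0 hy; have [z zP] := exists_generator; have q2 := qq_gt2.
have n0 : (0 < (q ^ 2).-1)%N by nia.
have y1 : y ^+ (q ^ 2).-1 = 1.
  apply: (mulfI y0); rewrite -exprS mulr1 prednK; last by nia.
  by rewrite -card_qF expf_card.
have [[i /= _] yE] := prim_rootP zP y1.
have : z ^+ (i * q.-1) = 1.
  rewrite exprM -yE; apply: (mulfI y0).
  by rewrite -exprS mulr1 prednK // qq_gt0.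
move/eqP; rewrite -(prim_order_dvd zP).
have -> : (q ^ 2).-1 = (q.+1 * q.-1)%N by nia.
rewrite dvdn_pmul2r; last by nia.
case/dvdnP=> j ij.
have xE : (z ^+ j) * bar (z ^+ j) = y by rewrite /Defs.bar -exprS -exprM -ij.
by exists (z ^+ j) => //; apply: contra_neq y0 => x0; rewrite -xE x0 mul0r.
Qed.

(** The witness is z^((q+1)/2) for a generator z, the exponent being an integer because q is odd:
    its (q-1)-st power is z^((q^2-1)/2) = -1. *)
Lemma exists_skew : exists2 e : K, e != 0 & bar e = - e.
Proof.
have [z zP] := exists_generator; have q2 := qq_gt2; have qo := qq_odd.
have qE : q = (q./2.*2).+1 by rewrite -[LHS]odd_double_half qo.
set m := q./2.+1; pose n2 := (q.-1 * m)%N.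
have nE : (q ^ 2).-1 = (n2 * 2)%N by rewrite /n2 /m; nia.
have z2 : z ^+ n2 = -1.
  have : (z ^+ n2) ^+ 2 == 1 by rewrite -exprM -nE (prim_expr_order zP).
  rewrite sqrf_eq1 => /orP[|/eqP//].
  rewrite -(prim_order_dvd zP) nE => /dvdn_leq; rewrite /n2 /m; nia.
have n2m : (m * q = n2 + m)%N by rewrite /n2; nia.
have z0 : z != 0.
  apply/eqP => z0; move: (prim_expr_order zP); rewrite z0 expr0n gtn_eqF; last first.
    by rewrite nE /n2 /m; lia.
  by move/esym/eqP; rewrite oner_eq0.
exists (z ^+ m); first exact: expf_neq0.
by rewrite /Defs.bar -exprM n2m exprD z2 mulN1r.
Qed.

(** Every x is uniquely a + e b with a and b fixed by [bar], so the square of the cardinal is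
    q^2. *)
Lemma card_bar_fixed : #|[set x : K | bar x == x]| = q.
Proof.
have [e e0 be] := exists_skew.
apply/eqP; rewrite -(@eqn_exp2r _ _ 2) // -card_qF -cardsT -mulnn -cardsX.
set F := [set x | _].
pose f (p : K * K) := p.1 + e * p.2.
have injf : {in setX F F &, injective f}.
  move=> [a b] [c d]; rewrite !inE /f /= => /andP[/eqP ha /eqP hb] /andP[/eqP hc /eqP hd] E.
  have : bar (a + e * b) = bar (c + e * d) by rewrite E.
  rewrite !rmorphD !rmorphM /= ha hb hc hd be !mulNr => E'.
  have ac : a = c.
    apply: (mulfI two_neq0).
    have h2 (u v : K) : 2 * u = (u + v) + (u - v) by ring.
    by rewrite (h2 a (e * b)) (h2 c (e * d)) E E'.
  by move: E; rewrite ac => /addrI /(mulfI e0) ->.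
rewrite -(card_in_imset injf); apply/eqP/eq_card => x; rewrite !inE.
apply/imsetP; exists ((x + bar x) / 2, (x - bar x) / (2 * e)).
  rewrite !inE /=; apply/andP; split; apply/eqP.
    by rewrite fmorph_div rmorphD rmorph_nat /= barK addrC.
  by rewrite fmorph_div rmorphB rmorphM rmorph_nat /= barK be mulrN invrN mulrN -mulNr opprB.
by rewrite /f /=; field; rewrite e0 two_neq0.
Qed.

Lemma card_bar_skew : #|[set x : K | bar x == - x]| = q.
Proof.
have [e e0 be] := exists_skew.
rewrite -[RHS]card_bar_fixed -[RHS](card_imset _ (mulfI e0)); apply: eq_card => x.
apply/idP/imsetP => [|[y]]; rewrite !inE => /eqP hx.
  exists (e^-1 * x); last by rewrite mulVKf.
  by rewrite inE rmorphM fmorphV /= be hx invrN mulrNN.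
by move=> ->; rewrite rmorphM /= hx be mulNr.
Qed.

Definition herm m (a : 'rV[K]_m) : K := \sum_i a 0 i * bar (a 0 i).

Definition isotropic_count m := #|[set a : 'rV[K]_m | herm a == 0]|.

Lemma bar_herm m (a : 'rV[K]_m) : bar (herm a) = herm a.
Proof.
by rewrite /herm rmorph_sum; apply: eq_bigr => i _; rewrite rmorphM /= barK mulrC.
Qed.

Lemma hermZ m x (a : 'rV[K]_m) : herm (x *: a) = x * bar x * herm a.
Proof.
rewrite /herm mulr_sumr; apply: eq_bigr => i _.
by rewrite !mxE rmorphM /= mulrACA.
Qed.

Lemma card_herm_scale m (x y : K) : x != 0 ->
  #|[set a : 'rV[K]_m | herm a == x * bar x * y]| = #|[set a : 'rV[K]_m | herm a == y]|.
Proof.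
move=> x0; have xb : x * bar x != 0 by rewrite mulf_neq0 // fmorph_eq0.
rewrite -[RHS](card_imset _ (can_inj (scalerK x0))); apply: eq_card => a.
apply/idP/imsetP => [|[b]]; rewrite !inE => /eqP ha.
  exists (x^-1 *: a); last by rewrite scalerA divff // scale1r.
  by rewrite inE hermZ ha fmorphV /= mulrA -invfM mulVf ?mul1r.
by move=> ->; rewrite hermZ ha.
Qed.

(** The form takes only fixed values, and scaling vectors by elements of suitable norm makes the q -
    1 nonzero fixed values equally frequent. *)
Lemma card_anisotropic m (y : K) : y != 0 -> bar y = y ->
  (isotropic_count m + q.-1 * #|[set a : 'rV[K]_m | herm a == y]| = q ^ (2 * m))%N.
Proof.
move=> y0 hy.
have -> : (q ^ (2 * m) = #|{: 'rV[K]_m}|)%N by rewrite card_mx mul1n card_qF expnM.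
rewrite -[RHS]sum1_card (partition_big (@herm m) predT) //= (bigD1 0) //=.
congr addn; first by rewrite sum1dep_card.
rewrite (bigID (fun z => bar z == z)) /= [X in (_ + X)%N]big1 ?addn0 => [|z /andP[_ hz]].
  rewrite (eq_bigr (fun=> #|[set a : 'rV[K]_m | herm a == y]|)) => [|z /andP[z0 /eqP hz]].
    rewrite sum_nat_cond_const; congr muln.
    rewrite -{1}card_bar_fixed (cardsD1 0) inE rmorph0 eqxx /=.
    by apply: eq_card => z; rewrite !inE.
  have hyz : bar (z / y) = z / y by rewrite fmorph_div /= hz hy.
  have [x x0 xE] := norm_surj (mulf_neq0 z0 (invr_neq0 y0)) hyz.
  by rewrite sum1dep_card -(card_herm_scale _ y x0) xE divfK.
apply: big1 => a /eqP ha; move: hz; rewrite -ha.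
by rewrite bar_herm eqxx.
Qed.

(** Split off the first coordinate x. For x = 0 an isotropic vector of length m remains; each of the
    q^2 - 1 other x leaves [D] vectors after rescaling, and [card_anisotropic] eliminates [D]. *)
Lemma isotropic_countS m :
  (isotropic_count m.+1 + q * isotropic_count m = q.+1 * q ^ (2 * m))%N.
Proof.
pose D := #|[set a : 'rV[K]_m | herm a == -1]|.
have hD : (isotropic_count m + q.-1 * D = q ^ (2 * m))%N.
  by apply: card_anisotropic; rewrite ?oppr_eq0 ?oner_eq0 // rmorphN rmorph1.
suff E : (isotropic_count m.+1 = isotropic_count m + (q ^ 2).-1 * D)%N.
  by have q2 := qq_gt2; rewrite E -hD; nia.
rewrite /isotropic_count -sum1dep_card.
pose f (p : K * 'rV[K]_m) : 'rV[K]_(1 + m) := row_mx (p.1%:M) p.2.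
pose g (a : 'rV[K]_(1 + m)) : K * 'rV[K]_m := (a 0 (lshift m 0), rsubmx a).
have fK : cancel f g.
  by case=> x b; rewrite /f /g /= row_mxEl mxE eqxx mulr1n row_mxKr.
have gK : cancel g f.
  move=> a; rewrite /f /g /= -[RHS]hsubmxK; congr row_mx.
  by apply/matrixP => i j; rewrite !ord1 !mxE eqxx mulr1n.
rewrite (reindex f) /=; last by exists g => ? _; [exact: fK|exact: gK].
have hf p : herm (f p) = p.1 * bar p.1 + herm p.2.
  rewrite /herm big_split_ord big_ord1 /f row_mxEl mxE eqxx mulr1n; congr +%R.
  by apply: eq_bigr => i _; rewrite row_mxEr.
rewrite (eq_bigl (fun p : K * 'rV[K]_m => true && (p.1 * bar p.1 + herm p.2 == 0))); last first.
  by move=> p; rewrite hf.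
rewrite -(pair_big_dep xpredT (fun x (b : 'rV[K]_m) => x * bar x + herm b == 0) (fun _ _ => 1%N)) /=.
rewrite (bigD1 0) //=; congr addn.
  by rewrite -sum1dep_card; apply: eq_bigl => b; rewrite mul0r add0r.
rewrite (eq_bigr (fun=> D)) => [|x x0].
  by rewrite sum_nat_cond_const -card_qF cardsE cardC1.
rewrite sum1dep_card /D -(card_herm_scale _ (-1) x0); apply: eq_card => b.
by rewrite !inE mulrN1 addrC addr_eq0.
Qed.

(** The homogeneous part (-q)^m of the recursion is what becomes a power of t later. The factor q on
    the left avoids a negative exponent at m = 0. *)
Lemma isotropic_countE (R : comNzRingType) m :
  (q * isotropic_count m)%:R =
    q%:R ^+ (2 * m) + (-1) ^+ m * q%:R ^+ m * (q%:R - 1) :> R.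
Proof.
elim: m => [|m IH].
  rewrite /isotropic_count (_ : [set a | _] = [set: 'rV[K]_0]).
    by rewrite cardsT card_mx mul1n expn0 muln1; ring.
  by apply/setP => a; rewrite !inE /herm big_ord0 eqxx.
have /(congr1 (fun n => (q * n)%:R : R)) := isotropic_countS m.
rewrite !(natrM, natrD, natrX) -natr1 in IH *.
set A := (isotropic_count m)%:R in IH *; set A' := (isotropic_count m.+1)%:R.
move=> H; have {H} -> : q%:R * A' = q%:R * ((q%:R + 1) * q%:R ^+ (2 * m)) - q%:R * (q%:R * A) :> R.
  by rewrite -H; ring.
by rewrite IH mulnS !exprD !exprS; ring.
Qed.

End Bar.

(** * Canonical Jordan chains *)

Section CanonicalForm.
Variable K : quadField.
Notation q := (qq K).
Notation bar := (@bar K).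

Lemma ctrmxK m n (A : 'M[K]_(m, n)) : ctrmx (ctrmx A) = A.
Proof. by apply/matrixP => i j; rewrite !mxE barK. Qed.

Lemma ctrmxM m n p (A : 'M[K]_(m, n)) (B : 'M[K]_(n, p)) :
  ctrmx (A *m B) = ctrmx B *m ctrmx A.
Proof. by rewrite /ctrmx trmx_mul map_mxM. Qed.

Lemma ctrmxD m n (A B : 'M[K]_(m, n)) : ctrmx (A + B) = ctrmx A + ctrmx B.
Proof. by rewrite /ctrmx linearD map_mxD. Qed.

Lemma ctrmxN m n (A : 'M[K]_(m, n)) : ctrmx (- A) = - ctrmx A.
Proof. by rewrite /ctrmx linearN map_mxN. Qed.

Lemma ctrmxZ m n x (A : 'M[K]_(m, n)) : ctrmx (x *: A) = bar x *: ctrmx A.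
Proof. by rewrite /ctrmx linearZ /= map_mxZ. Qed.

Lemma ctrmx0 m n : ctrmx (0 : 'M[K]_(m, n)) = 0.
Proof. by rewrite /ctrmx trmx0 map_mx0. Qed.

Lemma ctrmx1 n : ctrmx (1%:M : 'M[K]_n) = 1%:M.
Proof. by rewrite /ctrmx trmx1 map_mx1. Qed.

Lemma mxrank_ctr m n (A : 'M[K]_(m, n)) : \rank (ctrmx A) = \rank A.
Proof. by rewrite /ctrmx mxrank_map mxrank_tr. Qed.

Lemma expmxS n (X : 'M[K]_n) k : X ^+ k.+1 = X *m X ^+ k.
Proof. by rewrite exprS. Qed.

Lemma expmxSr n (X : 'M[K]_n) k : X ^+ k.+1 = X ^+ k *m X.
Proof. by rewrite exprSr. Qed.

Lemma expmxD n (X : 'M[K]_n) j k : X ^+ (j + k) = X ^+ j *m X ^+ k.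
Proof. by rewrite exprD. Qed.

Lemma expmx_ge n (X : 'M[K]_n) j k : X ^+ j = 0 -> (j <= k)%N -> X ^+ k = 0.
Proof. by move=> Xj jk; rewrite -(subnKC jk) expmxD Xj mul0mx. Qed.

Lemma mulmx_expC m n (A : 'M[K]_(m, n)) (X : 'M_m) (Y : 'M_n) k :
  A *m Y = X *m A -> A *m (Y ^+ k) = (X ^+ k) *m A.
Proof.
move=> AY; elim: k => [|k IH]; first by rewrite !expr0 mulmx1 mul1mx.
by rewrite (expmxS Y) (expmxS X) mulmxA AY -!mulmxA IH.
Qed.

Definition ip n (G : 'M[K]_n) (u v : 'rV[K]_n) : K := (u *m G *m ctrmx v) 0 0.

Section Ip.
Variables (n : nat) (G X : 'M[K]_n).
Notation ip := (ip G).

Lemma ipDl u v w : ip (u + v) w = ip u w + ip v w.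
Proof. by rewrite /ip !mulmxDl mxE. Qed.

Lemma ipDr u v w : ip u (v + w) = ip u v + ip u w.
Proof. by rewrite /ip ctrmxD mulmxDr mxE. Qed.

Lemma ipNl u v : ip (- u) v = - ip u v.
Proof. by rewrite /ip !mulNmx mxE. Qed.

Lemma ipNr u v : ip u (- v) = - ip u v.
Proof. by rewrite /ip ctrmxN mulmxN mxE. Qed.

Lemma ipZl a u v : ip (a *: u) v = a * ip u v.
Proof. by rewrite /ip -!scalemxAl mxE. Qed.

Lemma ipZr a u v : ip u (a *: v) = bar a * ip u v.
Proof. by rewrite /ip ctrmxZ -scalemxAr mxE. Qed.

Lemma ip0l v : ip 0 v = 0.
Proof. by rewrite /ip !mul0mx mxE. Qed.

Lemma ip0r v : ip v 0 = 0.
Proof. by rewrite /ip ctrmx0 mulmx0 mxE. Qed.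

Lemma ip_suml m (u : 'rV_m) (A : 'M_(m, n)) v :
  ip (u *m A) v = \sum_i u 0 i * ip (row i A) v.
Proof.
rewrite mulmx_sum_row /ip !mulmx_suml summxE; apply: eq_bigr => i _.
by rewrite -!scalemxAl mxE.
Qed.

Lemma ip_sumr m u (v : 'rV_m) (A : 'M_(m, n)) :
  ip u (v *m A) = \sum_i bar (v 0 i) * ip u (row i A).
Proof.
rewrite mulmx_sum_row.
elim/big_rec2: _ => [|i a b _ IH]; first exact: ip0r.
by rewrite ipDr ipZr IH.
Qed.

Lemma ip_bar u v : ctrmx G = G -> bar (ip u v) = ip v u.
Proof.
move=> hG; rewrite /ip.
have <- : ctrmx (u *m G *m ctrmx v) = v *m G *m ctrmx u.
  by rewrite !ctrmxM ctrmxK hG mulmxA.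
by rewrite !mxE.
Qed.

Lemma ip_skewX k u v : X *m G = - (G *m ctrmx X) ->
  ip (u *m X ^+ k) v = (-1) ^+ k * ip u (v *m X ^+ k).
Proof.
move=> hX; elim: k u v => [|k IH] u v; first by rewrite expr0 !mulmx1 mul1r.
have ip1 u' v' : ip (u' *m X) v' = - ip u' (v' *m X).
  by rewrite /ip ctrmxM -(mulmxA u') hX mulmxN !mulNmx mxE !mulmxA.
rewrite expmxSr mulmxA ip1 IH exprS mulN1r mulNr; congr (- (_ * ip _ _)).
by rewrite -mulmxA -expmxS expmxSr.
Qed.

Lemma ip_eq0_row u : G \in unitmx -> (forall v, ip u v = 0) -> u = 0.
Proof.
move=> Gu h; suff E : u *m G = 0 by rewrite -[u](mulmxK Gu) E mul0mx.
apply/rowP => j; have := h (delta_mx 0 j).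
rewrite /ip mxE (bigD1 j) //= big1 ?addr0 => [|i ij].
  by rewrite !mxE !eqxx rmorph1 mulr1 => ->.
by rewrite !mxE (negbTE ij) andbF rmorph0 mulr0.
Qed.

(** Polarization: u + v gives B(u,v) = - B(v,u), while e u + v with e skew gives B(u,v) = B(v,u);
    then 2 B(u,v) = 0. *)
Lemma ip_eq0_mx : (forall u, ip u u = 0) -> G = 0.
Proof.
move=> h; have [e e0 be] := exists_skew K.
have ipz u v : ip u v = 0.
  have h1 u' v' : ip u' v' + ip v' u' = 0.
    by have := h (u' + v'); rewrite !ipDl !ipDr !h add0r addr0.
  have := h1 (e *: u) v; rewrite ipZl ipZr be mulNr -mulrBr => /eqP.
  rewrite mulf_eq0 (negbTE e0) subr_eq0 /= => /eqP E.
  have := h1 u v; rewrite -E -mulr2n -mulr_natl => /eqP.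
  by rewrite mulf_eq0 (negbTE (two_neq0 K)) => /eqP.
apply/matrixP => i j; have := ipz (delta_mx 0 i) (delta_mx 0 j).
rewrite /ip -rowE mxE (bigD1 j) //= big1 ?addr0 => [|k kj].
  by rewrite !mxE !eqxx rmorph1 mulr1 => ->.
by rewrite !mxE (negbTE kj) andbF rmorph0 mulr0.
Qed.

End Ip.

(* Form value on the top of a normalized chain of length [d]: the form
   <x X^(d-1), y> is hermitian for odd [d] and skew-hermitian for even [d]. *)
Definition chain_sign (e : K) d : K := if odd d then 1 else e.

(** Each pair is the length and the top of a chain. When X is skew for G, powers of X can be moved
    across the form, so the last condition fixes the whole Gram matrix of the chains. *)
Definition canonical_chains e n (G X : 'M[K]_n) (s : seq (nat * 'rV[K]_n)) : Prop :=
  [/\ sorted geq (map fst s), all (leq 1) (map fst s), sumn (map fst s) = n,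
    forall i, (i < size s)%N -> (nth (0%N, 0) s i).2 *m X ^+ (nth (0%N, 0) s i).1 = 0 &
    forall i j k, (i < size s)%N -> (j < size s)%N ->
      ip G ((nth (0%N, 0) s i).2 *m X ^+ k) (nth (0%N, 0) s j).2 =
      if (i == j) && (k.+1 == (nth (0%N, 0) s i).1)
      then chain_sign e (nth (0%N, 0) s i).1 else 0].

Section Step.
Variables (e : K) (n : nat) (G X : 'M[K]_n) (d : nat).
Hypotheses (e0 : e != 0) (be : bar e = - e).
Hypotheses (hG : ctrmx G = G) (Gu : G \in unitmx) (hX : X *m G = - (G *m ctrmx X)).
Hypotheses (Xd : X ^+ d.+1 = 0) (Xd' : X ^+ d != 0).

Let eta := chain_sign e d.+1.

Lemma chain_sign_neq0 k : chain_sign e k != 0.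
Proof. by rewrite /chain_sign; case: ifP; rewrite ?oner_eq0. Qed.

Lemma bar_chain_sign k : bar (chain_sign e k.+1) = (-1) ^+ k * chain_sign e k.+1.
Proof.
rewrite /chain_sign -signr_odd /=; case: odd; rewrite /= ?rmorph1 ?be ?mul1r //.
by rewrite mulN1r.
Qed.

Let f z j := ip G (z *m X ^+ j) z.

Let bar_f z j : bar (f z j) = (-1) ^+ j * f z j.
Proof. by rewrite /f ip_bar // ip_skewX // mulrA -exprD addnn -mul2n exprM sqrrN expr1n expr1n mul1r. Qed.

(** As X^d G is nonzero, [ip_eq0_mx] yields z with [f z d] nonzero. Both [f z d] and [eta] acquire
    the sign (-1)^d under [bar], so their quotient is fixed, hence a norm. *)
Lemma exists_chain_top : exists z, f z d = eta.
Proof.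
have [z hz] : exists z, f z d != 0.
  case: (pselect (exists z, f z d != 0)) => // nex.
  suff E : X ^+ d *m G = 0.
    by move: Xd'; rewrite -[X ^+ d](mulmxK Gu) E mul0mx eqxx.
  apply: ip_eq0_mx => u; apply/eqP/negPn/negP => hu; apply: nex; exists u.
  by rewrite /f /ip -(mulmxA u).
have ez := chain_sign_neq0 d.+1.
have [x x0 xE] : exists2 x, x != 0 & x * bar x = eta / f z d.
  apply: norm_surj; first by rewrite mulf_neq0 ?invr_eq0.
  rewrite fmorph_div /= bar_f /eta bar_chain_sign -mulf_div divff ?mul1r //.
  by rewrite signr_eq0.
exists (x *: z); rewrite /f -scalemxAl ipZl ipZr mulrA xE divfK //.
Qed.

(** The unwanted values are cleared downwards from j = d - 1. Adding a multiple of z X^m alters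
    [f z j] only by multiples of [f z (j + m)] and [f z (j + m + m)], which vanish for the j already
    cleared. *)
Lemma exists_chain : exists z,
  forall j, f z j = if j == d then eta else 0.
Proof.
suff H k : (k <= d)%N -> exists z, f z d = eta /\ forall j, (d - k <= j < d)%N -> f z j = 0.
  have [z hz] := H d (leqnn d); exists z => j; case: eqP => [->|/eqP jd]; first by case: hz.
  have [jd'|] := leqP j d; first by apply: (proj2 hz); lia.
  by move=> dj; rewrite /f (expmx_ge Xd dj) mulmx0 ip0l.
elim: k => [|k IH] kd.
  have [z hz] := exists_chain_top; exists z; split=> // j; lia.
have [z [h1 h2]] := IH (ltnW kd).
(* At j0 = d - m the value changes by (bar a (-1)^m + a) eta. Comparing the signs of [f z j0] and
   [eta] under [bar] turns this into 2 a eta ([ha]), hence the choice of [a]. *)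
set j0 := (d - k.+1)%N; pose m := k.+1; pose a := - f z j0 / (2 * eta).
have big j : (d < j)%N -> f z j = 0.
  by move=> dj; rewrite /f (expmx_ge Xd dj) mulmx0 ip0l.
exists (z + a *: (z *m X ^+ m)).
have fE j : f (z + a *: (z *m X ^+ m)) j =
    f z j + (bar a * (-1) ^+ m + a) * f z (j + m)
    + a * bar a * (-1) ^+ m * f z (j + m + m).
  have mm i : (-1) ^+ m * ip G (z *m X ^+ i) (z *m X ^+ m) = f z (i + m).
    by rewrite /f expmxD mulmxA [RHS]ip_skewX.
  rewrite /f mulmxDl -scalemxAl !ipDl !ipDr !ipZl !ipZr.
  rewrite -!(mulmxA z) -!expmxD.
  have mm' i : ip G (z *m X ^+ i) (z *m X ^+ m) = (-1) ^+ m * f z (i + m).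
    by rewrite -mm mulrA -exprD addnn -mul2n exprM sqrrN expr1n expr1n mul1r.
  by rewrite !mm' /f (addnC m j); ring.
have ha : bar a * (-1) ^+ m + a = 2 * a.
  have -> : bar a = (-1) ^+ m * a.
    rewrite /a /eta fmorph_div rmorphM rmorphN /= bar_f bar_chain_sign rmorph_nat.
    have -> : (-1) ^+ d = (-1) ^+ m * (-1) ^+ j0 :> K.
      by rewrite -exprD; congr (_ ^+ _); rewrite /m /j0; lia.
    have := signr_eq0 K j0; have := signr_eq0 K m; have sm : (-1) ^+ m ^+ 2 = 1 :> K by rewrite sqrr_sign.
    set sm' := (-1) ^+ m in sm *; set sj := (-1) ^+ j0 => sm0 sj0.
    have -> : sm' * (- f z j0 / (2 * chain_sign e d.+1)) =
      sm' * sm' * (- f z j0 / (2 * sm' * chain_sign e d.+1)).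
      by field; rewrite sm0 two_neq0 chain_sign_neq0.
    rewrite -expr2 sm mul1r; field.
    by rewrite (two_neq0 K) chain_sign_neq0 sm0 sj0.
  by rewrite mulrAC -exprD addnn -mul2n exprM sqrrN expr1n expr1n mul1r; ring.
split.
  by rewrite fE h1 !big ?mulr0 ?addr0 // /m; lia.
move=> j hj; rewrite fE ha.
have [jj|jj] := eqVneq j j0.
  rewrite jj (_ : j0 + m = d)%N ?h1; last by rewrite /j0 /m; lia.
  rewrite (big (d + m)%N) ?mulr0 ?addr0; last by rewrite /m; lia.
  by rewrite /a; field; rewrite (two_neq0 K) chain_sign_neq0.
rewrite h2; last by move: jj hj; rewrite /j0; lia.
by rewrite !big ?mulr0 ?addr0 //; move: jj hj; rewrite /j0 /m; lia.
Qed.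

Section Split.
Variable z : 'rV[K]_n.
Hypothesis hz : forall j, f z j = if j == d then eta else 0.

Let Z : 'M[K]_(d.+1, n) := \matrix_(i < d.+1) (z *m X ^+ i).
Let C : 'M[K]_(_, n) := row_base (kermx (G *m ctrmx Z)).

Let zz i j : ip G (z *m X ^+ i) (z *m X ^+ j) =
  if (i + j)%N == d then (-1) ^+ j * eta else 0.
Proof.
have := hz (i + j); rewrite /f expmxD mulmxA ip_skewX // => E.
have -> : ip G (z *m X ^+ i) (z *m X ^+ j) = (-1) ^+ j * ((-1) ^+ j * ip G (z *m X ^+ i) (z *m X ^+ j)).
  by rewrite mulrA -expr2 sqrr_sign mul1r.
by rewrite E; case: ifP; rewrite ?mulr0.
Qed.

Let ipZ u (j : 'I_d.+1) : ip G (u *m Z) (z *m X ^+ j) = u 0 (rev_ord j) * ((-1) ^+ j * eta).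
Proof.
rewrite ip_suml (bigD1 (rev_ord j)) //= big1 ?addr0 => [|i ij].
  by rewrite rowK zz /= subSS subnK ?eqxx // -ltnS.
rewrite rowK zz; case: eqP => [E|]; rewrite ?mulr0 //.
case/eqP: ij; apply: val_inj => /=; lia.
Qed.

Let memC m (A : 'M_(m, n)) : (A <= C)%MS = (A *m G *m ctrmx Z == 0).
Proof. by rewrite eq_row_base sub_kermx mulmxA. Qed.

Let memC1 (u : 'rV_n) : reflect (forall j : 'I_d.+1, ip G u (z *m X ^+ j) = 0) (u <= C)%MS.
Proof.
rewrite memC; have E j : (u *m G *m ctrmx Z) 0 j = ip G u (z *m X ^+ j).
  rewrite /ip !mxE; apply: eq_bigr => i _; rewrite !mxE; congr (_ * bar _).
apply: (iffP eqP) => [h j|h]; first by rewrite -E h mxE.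
by apply/rowP => j; rewrite E h mxE.
Qed.

Let coefX_neq0 j : (-1) ^+ j * eta != 0.
Proof. by rewrite mulf_neq0 ?signr_eq0 // chain_sign_neq0. Qed.

Let uZ0 (u : 'rV_d.+1) : (u *m Z <= C)%MS -> u = 0.
Proof.
move/memC1=> h; apply/rowP => i; rewrite mxE; apply/eqP.
have := h (rev_ord i); rewrite ipZ rev_ordK => /eqP.
by rewrite mulf_eq0 (negbTE (coefX_neq0 _)) orbF.
Qed.

Let rankZ : \rank Z = d.+1.
Proof.
by apply/eqP/inj_row_free => u hu; apply: uZ0; rewrite hu sub0mx.
Qed.

Let dC : (\rank (kermx (G *m ctrmx Z)) = n - d.+1)%N.
Proof.
rewrite mxrank_ker; congr (_ - _)%N; rewrite -[RHS]rankZ -(mxrank_ctr Z).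
by rewrite eqmxMfull ?row_full_unit.
Qed.

Let dn : (d.+1 <= n)%N.
Proof. by rewrite -rankZ rank_leq_col. Qed.

Let CX : exists X', C *m X = X' *m C.
Proof.
apply/submxP; rewrite memC -(mulmxA C) hX mulmxN mulNmx oppr_eq0.
have h : C *m (G *m ctrmx Z) = 0 by apply/eqP; rewrite mulmxA -memC.
pose J : 'M[K]_d.+1 := \matrix_(i < d.+1, j < d.+1) (j == i.+1 :> nat)%:R.
have ZX : Z *m X = J *m Z.
  apply/row_matrixP => i; rewrite !row_mul rowK -mulmxA -expmxSr.
  rewrite [RHS]mulmx_sum_row; have [id|di] := ltnP i.+1 d.+1.
    rewrite (bigD1 (Ordinal id)) //= big1 => [|j ji].
      by rewrite !mxE eqxx scale1r addr0 rowK.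
    by rewrite !mxE (_ : (j == i.+1 :> nat) = false) ?scale0r //; apply/negbTE.
  rewrite big1 ?(expmx_ge Xd di) ?mulmx0 // => j _; rewrite !mxE.
  by rewrite (_ : (j == i.+1 :> nat) = false) ?scale0r //; have := ltn_ord j; lia.
have E : ctrmx X *m ctrmx Z = ctrmx Z *m ctrmx J by rewrite -!ctrmxM ZX.
by rewrite -(mulmxA C) -(mulmxA G) E (mulmxA G) (mulmxA C) h mul0mx.
Qed.

Let projC (w : 'rV_n) : exists c : 'rV_d.+1, (w - c *m Z <= C)%MS.
Proof.
exists (\row_i (ip G w (z *m X ^+ (rev_ord i)) / ((-1) ^+ (rev_ord i) * eta))).
apply/memC1 => j; rewrite ipDl ipNl ipZ mxE rev_ordK divfK ?subrr //.
Qed.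

(** [C] spans the orthogonal complement of the chain of z. The Gram matrix of the chain is
    antidiagonal with entries eta up to sign, so chain and complement together span and the form
    stays nondegenerate on [C]; X preserves [C] because it is skew and preserves the chain. *)
Lemma chain_split : exists r (C : 'M[K]_(r, n)) (X' : 'M_r),
  [/\ (r + d.+1 = n)%N, C *m X = X' *m C, row_free C,
     forall k (u : 'rV_r), ip G (z *m X ^+ k) (u *m C) = 0 &
     forall u : 'rV_r, (forall v : 'rV_r, ip G (u *m C) (v *m C) = 0) -> u = 0].
Proof.
have [X' hX'] := CX; exists _, C, X'.
have orth k (u : 'rV_(\rank (kermx (G *m ctrmx Z)))) : ip G (u *m C) (z *m X ^+ k) = 0.
  have [kd|dk] := ltnP k d.+1; last by rewrite (expmx_ge Xd dk) mulmx0 ip0r.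
  by have /memC1/(_ (Ordinal kd)) := submxMl u C.
split=> //.
- by rewrite dC subnK.
- exact: row_base_free.
- by move=> k u; rewrite -(ip_bar _ _ hG) orth rmorph0.
move=> u hu; apply: (row_free_inj (row_base_free _)); rewrite mul0mx.
apply: (ip_eq0_row Gu) => w; have [c /submxP[v hv]] := projC w.
have -> : w = v *m C + c *m Z by rewrite -hv subrK.
rewrite ipDr hu add0r -(ip_bar _ _ hG) ip_suml big1 ?rmorph0 // => i _.
by rewrite rowK -(ip_bar _ _ hG) orth rmorph0 mulr0.
Qed.

End Split.
End Step.
End CanonicalForm.

Section CanonicalExists.
Variable K : quadField.
Notation bar := (@bar K).
Variable e : K.
Hypotheses (e0 : e != 0) (be : bar e = - e).

Lemma unitmx_ip n (G : 'M[K]_n) :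
  (forall u, (forall v, ip G u v = 0) -> u = 0) -> G \in unitmx.
Proof.
move=> h; rewrite -row_free_unit; apply: inj_row_free => u hu; apply: h => v.
by rewrite /ip hu mul0mx mxE.
Qed.

Lemma ip_mul n r (G : 'M[K]_n) (C : 'M_(r, n)) u v :
  ip (C *m G *m ctrmx C) u v = ip G (u *m C) (v *m C).
Proof. by rewrite /ip ctrmxM !mulmxA. Qed.

Lemma canonical_chains_exist n (G X : 'M[K]_n) :
  ctrmx G = G -> G \in unitmx -> X *m G = - (G *m ctrmx X) -> nilpotent_mx X ->
  exists s, canonical_chains e G X s.
Proof.
have [m] := ubnP n; elim: m n G X => // m IH n G X nm hG Gu hX [k Xk].
have [n0|n0] := posnP n.
  by exists [::]; split=> //=; rewrite n0.
have exd : exists d, X ^+ d == 0 by exists k; apply/eqP.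
case: (ex_minnP exd) => -[|d] /eqP Xd dmin.
  move: Xd; rewrite expr0 => /matrixP/(_ (Ordinal n0) (Ordinal n0))/eqP.
  by rewrite !mxE eqxx oner_eq0.
have Xd' : X ^+ d != 0 by apply/negP => /dmin; rewrite ltnn.
have [z hz] := exists_chain e0 be hG Gu hX Xd Xd'.
have [r [C [X' [rn CX freeC zC G'u]]]] := chain_split e0 hG Gu hX Xd Xd' hz.
pose G' := C *m G *m ctrmx C.
have hG' : ctrmx G' = G' by rewrite /G' !ctrmxM ctrmxK hG mulmxA.
have G'u' : G' \in unitmx.
  by apply: unitmx_ip => u hu; apply: G'u => v; rewrite -ip_mul hu.
have hX' : X' *m G' = - (G' *m ctrmx X').
  by rewrite /G' !mulmxA -CX -(mulmxA C X) hX mulmxN mulNmx -!mulmxA -!ctrmxM CX.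
have X'd : X' ^+ d.+1 = 0.
  by apply: (row_free_inj freeC); rewrite -(mulmx_expC _ CX) Xd mulmx0 mul0mx.
have [|s [s1 s2 s3 s4 s5]] := IH r G' X' _ hG' G'u' hX' (ex_intro _ _ X'd); first by lia.
have nthC i : (i < size s)%N -> nth (0%N, 0) [seq (p.1, p.2 *m C) | p <- s] i =
    ((nth (0%N, 0) s i).1, (nth (0%N, 0) s i).2 *m C).
  by move=> hi; rewrite (nth_map (0%N, 0)).
have map1 : map fst [seq (p.1, p.2 *m C) | p <- s] = map fst s.
  by rewrite -map_comp.
have CXk j (u : 'rV_r) : u *m C *m X ^+ j = u *m X' ^+ j *m C.
  by rewrite -mulmxA (mulmx_expC _ CX) mulmxA.
exists ((d.+1, z) :: [seq (p.1, p.2 *m C) | p <- s]); split => /=.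
- rewrite map1; case: s s1 s2 s3 s4 s5 {nthC map1} => [|[d' v] s] //= -> /andP[d'0 _] _ _ s5.
  rewrite andbT leqNgt; apply/negP => dd'.
  (* The nonzero value of the next chain is attained at the power d' - 1, which is zero if d'
     exceeds d + 1. *)
  have := s5 0%N 0%N d'.-1 isT isT; rewrite /= prednK // eqxx (expmx_ge X'd); last by lia.
  by rewrite mulmx0 ip0l => /esym/eqP; rewrite (negbTE (chain_sign_neq0 e0 _)).
- by rewrite map1.
- by rewrite map1 s3; lia.
- move=> [_|i] /=; last first.
    by rewrite size_map => hi; rewrite nthC //= CXk s4 // mul0mx.
  apply: (ip_eq0_row Gu) => v; rewrite Xd mulmx0 ip0l //.
rewrite size_map => -[|i] [|j] l; rewrite !ltnS => hi hj /=.
- by rewrite hz.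
- by rewrite nthC //= zC.
- have := zC 0%N ((nth (0%N, 0) s i).2 *m X' ^+ l); rewrite expr0 mulmx1 => E.
  by rewrite nthC //= CXk -(ip_bar _ _ hG) E rmorph0.
- by rewrite !nthC //= CXk -ip_mul s5.
Qed.

End CanonicalExists.

(** * Jordan matrices, ranks of powers and partitions *)

Section BlockDiagonal.
Variables (p : nat) (p_ : 'I_p -> nat).

Lemma map_mxdiag (R S : nmodType) (f : {additive R -> S}) (B : forall i, 'M[R]_(p_ i)) :
  map_mx f (\mxdiag_i B i) = \mxdiag_i map_mx f (B i).
Proof.
have -> : map_mx f (\mxdiag_i B i) =
    \mxblock_(i, j) map_mx f (if i == j then conform_mx 0 (B i) else 0).
  by apply/matrixP => i j; rewrite !mxE.
apply: eq_mxblock => i j; case: eqP => [<-|_]; last by rewrite map_mx0.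
by rewrite !conform_mx_id.
Qed.

Lemma mul_mxdiag (R : pzSemiRingType) (A B : forall i, 'M[R]_(p_ i)) :
  \mxdiag_i A i *m \mxdiag_i B i = \mxdiag_i (A i *m B i).
Proof.
rewrite [X in _ *m X]/mxdiag mul_mxdiag_mxblock; apply: eq_mxblock => i j.
by case: eqP => [<-|_]; rewrite ?mulmx0 // !conform_mx_id.
Qed.

End BlockDiagonal.

Section Jordan.
Variable F : quadField.

Lemma nil_block_exp m k :
  (nil_block F m) ^+ k = \matrix_(i, j) (j == i + k :> nat)%N%:R.
Proof.
elim: k => [|k IH]; first by apply/matrixP => i j; rewrite expr0 !mxE addn0 eq_sym.
apply/matrixP => i j; rewrite expmxS IH !mxE.
have [im|mi] := ltnP i.+1 m.
  rewrite (bigD1 (Ordinal im)) //= big1 ?addr0 => [|l li].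
    by rewrite !mxE eqxx mul1r addSnnS.
  by rewrite !mxE (_ : (l == i.+1 :> nat) = false) ?mul0r //; apply/negbTE.
rewrite big1 => [|l _].
  by rewrite (_ : (_ == _ :> nat) = false) //; have := ltn_ord j; lia.
by rewrite !mxE (_ : (l == i.+1 :> nat) = false) ?mul0r //; have := ltn_ord l; lia.
Qed.

Lemma rank_nil_block_exp m k : \rank (nil_block F m ^+ k) = (m - k)%N.
Proof.
rewrite nil_block_exp.
pose B : 'M[F]_(m - k, m) := \matrix_(i, j) (j == i + k :> nat)%N%:R.
have -> : \matrix_(i < m, j < m) (j == i + k :> nat)%N%:R =
    (pid_mx (m - k) : 'M_(m, m - k)) *m B.
  apply/matrixP => i j; rewrite !mxE.
  have [im|mi] := ltnP i (m - k).
    rewrite (bigD1 (Ordinal im)) //= big1 ?addr0 => [|l li].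
      by rewrite !mxE eqxx im mul1r.
    rewrite !mxE (_ : (i == l :> nat) = false) ?mul0r //.
    by apply/negbTE; rewrite eq_sym.
  rewrite big1 => [|l _].
    by rewrite (_ : (_ == _ :> nat) = false) //; have := ltn_ord j; lia.
  by rewrite !mxE (_ : (i == l :> nat) = false) ?mul0r //; have := ltn_ord l; lia.
rewrite mxrankMfree ?rank_pid_mx ?leq_subr //.
apply/row_freeP; exists B^T; apply/matrixP => i j; rewrite !mxE.
have im : (i + k < m)%N by have := ltn_ord i; lia.
rewrite (bigD1 (Ordinal im)) //= big1 ?addr0 => [|l li].
  by rewrite !mxE eqxx mul1r /= eqn_add2r.
by rewrite !mxE (_ : (l == i + k :> nat)%N = false) ?mul0r //; apply/negbTE.
Qed.

Definition rank_sum (la : seq nat) k := sumn [seq (d - k)%N | d <- la].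

Lemma rank_sumE la k : rank_sum la k = (\sum_(i < size la) (nth 0 la i - k))%N.
Proof.
by rewrite /rank_sum sumnE big_map (big_nth 0%N) big_mkord.
Qed.

Lemma jordan_mx_exp la k :
  jordan_mx F la ^+ k = \mxdiag_(i < size la) (nil_block F (nth 0%N la i) ^+ k).
Proof.
elim: k => [|k IH].
  by rewrite expr0 -[1]/(1%:M) -mxdiagZ; apply: eq_mxdiag => i; rewrite expr0.
by rewrite expmxS IH mul_mxdiag; apply: eq_mxdiag => i; rewrite expmxS.
Qed.

Lemma rank_jordan_type n (A : 'M[F]_n) la k :
  jordan_type A la -> \rank (A ^+ k) = rank_sum la k.
Proof.
move=> [_ [P [fP uP PA]]].
rewrite -(eqmxMfull _ uP) (mulmx_expC _ PA) mxrankMfree // jordan_mx_exp.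
rewrite rank_mxdiag rank_sumE; apply: eq_bigr => i _.
exact: rank_nil_block_exp.
Qed.

Lemma rank_sum0 la : rank_sum la 0 = sumn la.
Proof. by rewrite /rank_sum (eq_map subn0) map_id. Qed.

Lemma sumn_jordan_type n (A : 'M[F]_n) la : jordan_type A la -> sumn la = n.
Proof. by move=> /(rank_jordan_type 0); rewrite expr0 mxrank1 rank_sum0. Qed.

(** For k >= 1 this is the k-th part of the conjugate partition. *)
Definition column (la : seq nat) k := count (leq k) la.

Lemma rank_sumS la k : rank_sum la k = (rank_sum la k.+1 + column la k.+1)%N.
Proof. by rewrite /rank_sum /column; elim: la => //= d la ->; lia. Qed.

Lemma rank_sum_large la k : (sumn la <= k)%N -> rank_sum la k = 0%N.
Proof. by rewrite /rank_sum; elim: la => //= d la IH h; rewrite IH; lia. Qed.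

Lemma column_mult la k : column la k = (mult k la + column la k.+1)%N.
Proof. by rewrite /column /mult; elim: la => //= d la ->; lia. Qed.

Lemma partition_eq_column la mu : is_partition la -> is_partition mu ->
  (forall k, (0 < k)%N -> column la k = column mu k) -> la = mu.
Proof.
move=> /andP[sla zla] /andP[smu zmu] h.
apply: (sorted_eq _ _ sla smu) => [x y z|x y|]; rewrite /geq /=; [lia|lia|].
apply/allP => x _ /=; apply/eqP.
have [->|x0] := posnP x.
  by rewrite !(count_memPn _).
by have := h x x0; rewrite (column_mult la) (column_mult mu) (h x.+1) // => /addIn.
Qed.

Lemma partition_eq_rank la mu : is_partition la -> is_partition mu ->
  (forall k, rank_sum la k = rank_sum mu k) -> la = mu.
Proof.
move=> pla pmu h; apply: partition_eq_column => // -[//|k] _.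
by apply: (@addnI (rank_sum la k.+1)); rewrite -rank_sumS !h rank_sumS.
Qed.

Lemma nilpotent_jordan_type n (A : 'M[F]_n) la :
  jordan_type A la -> A ^+ n = 0.
Proof.
move=> h; apply/eqP; rewrite -mxrank_eq0 (rank_jordan_type _ h).
by rewrite rank_sum_large // (sumn_jordan_type h).
Qed.

Lemma invertible_rect m n (P : 'M[F]_(m, n)) : row_free P -> row_full P ->
  exists Q : 'M_(n, m), Q *m P = 1%:M /\ P *m Q = 1%:M.
Proof.
move=> /row_freeP[Q PQ] /row_fullP[Q' QP]; exists Q; split=> //.
by rewrite -QP -[Q]mul1mx -QP -(mulmxA Q') PQ mulmx1.
Qed.

End Jordan.

(** * Normal form of a skew nilpotent matrix *)

Section ChainGram.
Variable K : quadField.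
Notation bar := (@bar K).
Variable e : K.
Hypotheses (e0 : e != 0) (be : bar e = - e).

(** The Gram matrix of a normalized chain x, xX, ..., xX^(d-1): moving X^b across the form costs
    (-1)^b and leaves the value at X^(a+b). *)
Definition block_gram d : 'M[K]_d :=
  \matrix_(a, b) if (a + b).+1 == d then (-1) ^+ b * chain_sign e d else 0.

Definition chain_gram la : 'M[K]_(\sum_(i < size la) nth 0 la i) :=
  \mxdiag_(i < size la) block_gram (nth 0 la i).

Lemma block_gram_herm d : ctrmx (block_gram d) = block_gram d.
Proof.
apply/matrixP => a b; rewrite !mxE addnC; case: eqP => [E|]; last by rewrite rmorph0.
have := bar_chain_sign be (a + b); rewrite E => eE.
rewrite rmorphM /= eE rmorph_sign mulrA -exprD; congr (_ * _).
by rewrite addnA addnn exprD -mul2n exprM sqrrN !expr1n mul1r.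
Qed.

Lemma block_gram_skew d : nil_block K d *m block_gram d =
  - (block_gram d *m ctrmx (nil_block K d)).
Proof.
apply/matrixP => a b; rewrite !mxE.
have L : \sum_j nil_block K d a j * block_gram d j b =
    if (a + b).+2 == d then (-1) ^+ b * chain_sign e d else 0.
  have [ad|da] := ltnP a.+1 d.
    rewrite (bigD1 (Ordinal ad)) //= big1 ?addr0 => [|l la].
      by rewrite !mxE eqxx mul1r /=.
    by rewrite !mxE (_ : (l == a.+1 :> nat) = false) ?mul0r //; apply/negbTE.
  rewrite big1 => [|l _]; first by rewrite (_ : (_ == d) = false) //; lia.
  by rewrite !mxE (_ : (l == a.+1 :> nat) = false) ?mul0r //; have := ltn_ord l; lia.
rewrite L; have [bd|db] := ltnP b.+1 d.
  rewrite (bigD1 (Ordinal bd)) //= big1 ?addr0 => [|l la].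
    rewrite !mxE eqxx rmorph1 mulr1 addnS /=; case: eqP => // _; rewrite ?oppr0 //.
    by rewrite exprS mulN1r mulNr opprK.
  by rewrite !mxE (_ : (l == b.+1 :> nat) = false) ?rmorph0 ?mulr0 //; apply/negbTE.
rewrite big1 => [|l _]; first by rewrite (_ : (_ == d) = false) ?oppr0 //; lia.
by rewrite !mxE (_ : (l == b.+1 :> nat) = false) ?rmorph0 ?mulr0 //; have := ltn_ord l; lia.
Qed.

Lemma block_gram_free d : row_free (block_gram d).
Proof.
apply: inj_row_free => u hu; apply/rowP => i; rewrite mxE; apply/eqP.
have := congr1 (fun v : 'rV_d => v 0 (rev_ord i)) hu; rewrite !mxE.
rewrite (bigD1 i) //= big1 ?addr0 => [|l li].
  rewrite !mxE (_ : (_ == d) = true); last by have /= := ltn_ord i; lia.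
  move/eqP; rewrite !mulf_eq0 (negbTE (chain_sign_neq0 e0 _)) orbF.
  by rewrite signr_eq0 orbF.
rewrite !mxE (_ : (_ == d) = false) ?mulr0 //; apply: contra_neqF li => /eqP E.
by apply: val_inj => /=; have := ltn_ord i; move: E => /=; lia.
Qed.

Lemma chain_gram_herm la : ctrmx (chain_gram la) = chain_gram la.
Proof.
rewrite /ctrmx /chain_gram tr_mxdiag map_mxdiag; apply: eq_mxdiag => i.
exact: block_gram_herm.
Qed.

Lemma chain_gram_skew la : jordan_mx K la *m chain_gram la =
  - (chain_gram la *m ctrmx (jordan_mx K la)).
Proof.
rewrite /ctrmx /jordan_mx tr_mxdiag map_mxdiag !mul_mxdiag -mxdiagN.
by apply: eq_mxdiag => i; rewrite block_gram_skew.
Qed.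

Lemma chain_gram_unit la : chain_gram la \in unitmx.
Proof.
rewrite -row_free_unit /row_free rank_mxdiag; apply/eqP/eq_bigr => i _.
exact/eqP/block_gram_free.
Qed.

(** The rows of [P] are the chain vectors. They are independent because their Gram matrix is
    invertible, and they span because the lengths add up to n. *)
Lemma chain_matrix n (G X : 'M[K]_n) s :
  X *m G = - (G *m ctrmx X) -> canonical_chains e G X s ->
  let la := map fst s in
  exists P : 'M[K]_(\sum_(i < size la) nth 0 la i, n),
  [/\ row_free P, row_full P, P *m X = jordan_mx K la *m P &
      P *m G *m ctrmx P = chain_gram la].
Proof.
move=> hX [s1 s2 s3 s4 s5] la; pose v i := (nth (0%N, 0 : 'rV[K]_n) s i).2.
have laE i : (nth (0%N, 0 : 'rV[K]_n) s i).1 = nth 0%N la i.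
  have [h|h] := ltnP i (size s); first by rewrite /la (nth_map (0%N, 0)).
  by rewrite /la !nth_default ?size_map.
have sz : size la = size s by rewrite size_map.
pose Pi i d : 'M[K]_(d, n) := \matrix_(a < d) (v i *m X ^+ a).
pose P := \mxcol_(i < size la) Pi i (nth 0%N la i).
have PG : P *m G *m ctrmx P = chain_gram la.
  have -> : ctrmx P = \mxrow_(i < size la) ctrmx (Pi i (nth 0%N la i)).
    by apply/matrixP => i j; rewrite !mxE.
  rewrite mxcol_mul mul_mxcol_mxrow; apply: eq_mxblock => i j.
  have E a b : (Pi i (nth 0%N la i) *m G *m ctrmx (Pi j (nth 0%N la j))) a b =
      (-1) ^+ b * (if (i == j) && ((a + b).+1 == nth 0%N la i)
      then chain_sign e (nth 0%N la i) else 0).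
    have -> : (Pi i (nth 0%N la i) *m G *m ctrmx (Pi j (nth 0%N la j))) a b =
        ip G (v i *m X ^+ a) (v j *m X ^+ b).
      rewrite /ip !mxE; apply: eq_bigr => l _; rewrite !mxE; congr (_ * bar _).
      by apply: eq_bigr => l' _; rewrite !mxE.
    have -> : ip G (v i *m X ^+ a) (v j *m X ^+ b) =
        (-1) ^+ b * ((-1) ^+ b * ip G (v i *m X ^+ a) (v j *m X ^+ b)).
      by rewrite mulrA -expr2 sqrr_sign mul1r.
    rewrite -ip_skewX //.
    rewrite -mulmxA -expmxD; congr (_ * _).
    by rewrite s5 -?sz // laE.
  case: eqP E => [<-|ij] E; apply/matrixP => a b; rewrite E /=.
    by rewrite conform_mx_id !mxE; case: ifP; rewrite ?mulr0.
  by rewrite mulr0 mxE.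
have fP : row_free P.
  apply/row_freeP; exists (G *m ctrmx P *m invmx (chain_gram la)).
  by rewrite !mulmxA PG mulmxV // chain_gram_unit.
exists P; split=> //.
  rewrite /row_full -[X in _ == X]s3 -/la (eqP fP).
  by rewrite sumnE (big_nth 0%N) big_mkord.
rewrite mxcol_mul mul_mxdiag_mxcol; apply: eq_mxcol => i.
have Xi : v i *m X ^+ (nth 0%N la i) = 0 by rewrite -laE s4 -?sz.
move: (nth 0%N la i) Xi => d vd; apply/row_matrixP => a.
rewrite !row_mul rowK -mulmxA -expmxSr [RHS]mulmx_sum_row.
have [ad|da] := ltnP a.+1 d.
  rewrite (bigD1 (Ordinal ad)) //= big1 ?addr0 => [|l la'].
    by rewrite !mxE eqxx scale1r rowK.
  by rewrite !mxE (_ : (l == a.+1 :> nat) = false) ?scale0r //; apply/negbTE.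
have -> : a.+1 = d by have := ltn_ord a; lia.
rewrite vd big1 => [|l _] //.
by rewrite !mxE (_ : (l == a.+1 :> nat) = false) ?scale0r //; have := ltn_ord l; lia.
Qed.

(** Strengthens [jordan_type] by a normal form for G in the same basis, so that the partition alone
    determines the pair (G, X) up to isometry. *)
Definition chain_type n (G X : 'M[K]_n) la : Prop :=
  is_partition la /\
  exists P : 'M[K]_(\sum_(i < size la) nth 0%N la i, n),
  [/\ row_free P, row_full P, P *m X = jordan_mx K la *m P &
      P *m G *m ctrmx P = chain_gram la].

Lemma chain_type_exists n (G X : 'M[K]_n) :
  ctrmx G = G -> G \in unitmx -> X *m G = - (G *m ctrmx X) -> nilpotent_mx X ->
  exists la, chain_type G X la.
Proof.
move=> hG Gu hX nX; have [s sP] := canonical_chains_exist e0 be hG Gu hX nX.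
exists (map fst s); split; last exact: chain_matrix.
case: sP => s1 s2 _ _ _; rewrite /is_partition s1 /=.
by apply/negP => /(allP s2).
Qed.

Lemma chain_type_jordan n (G X : 'M[K]_n) la :
  chain_type G X la -> jordan_type X la.
Proof. by move=> [pla [P [? ? ? _]]]; split=> //; exists P. Qed.

Lemma chain_type_isometry m n (G X : 'M[K]_m) (G' X' : 'M[K]_n) la :
  chain_type G X la -> chain_type G' X' la ->
  exists (A : 'M_(n, m)) (B : 'M_(m, n)),
    [/\ A *m B = 1%:M, B *m A = 1%:M, A *m X = X' *m A & A *m G *m ctrmx A = G'].
Proof.
move=> [_ [P [fP uP PX PG]]] [_ [P' [fP' uP' PX' PG']]].
have [Q [QP PQ]] := invertible_rect fP uP.
have [Q' [QP' PQ']] := invertible_rect fP' uP'.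
exists (Q' *m P), (Q *m P'); split.
- by rewrite mulmxA -(mulmxA Q') PQ mulmx1.
- by rewrite mulmxA -(mulmxA Q) PQ' mulmx1.
- rewrite -mulmxA PX -[P in LHS]mul1mx -PQ' !mulmxA.
  by rewrite -(mulmxA Q' (jordan_mx K la)) -PX' mulmxA QP' mul1mx.
- rewrite ctrmxM !mulmxA -(mulmxA _ P G) -(mulmxA _ (P *m G)) PG -PG' !mulmxA.
  by rewrite QP' mul1mx -(mulmxA G') -ctrmxM QP' ctrmx1 mulmx1.
Qed.

Lemma jordan_type_uniq n (X : 'M[K]_n) la mu :
  jordan_type X la -> jordan_type X mu -> la = mu.
Proof.
move=> h h'; apply: partition_eq_rank; [by case: h|by case: h'|] => k.
by rewrite -(rank_jordan_type _ h) (rank_jordan_type _ h').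
Qed.

Lemma jordan_type_isometry n (G X X' : 'M[K]_n) la :
  ctrmx G = G -> G \in unitmx -> X *m G = - (G *m ctrmx X) ->
  X' *m G = - (G *m ctrmx X') -> jordan_type X la -> jordan_type X' la ->
  exists A : 'M_n, [/\ A \in unitmx, A *m X = X' *m A & A *m G *m ctrmx A = G].
Proof.
move=> hG Gu hX hX' tX tX'.
have nX := ex_intro (fun k => X ^+ k = 0) _ (nilpotent_jordan_type tX).
have nX' := ex_intro (fun k => X' ^+ k = 0) _ (nilpotent_jordan_type tX').
have [mu cX] := chain_type_exists hG Gu hX nX.
have [mu' cX'] := chain_type_exists hG Gu hX' nX'.
have E := jordan_type_uniq tX (chain_type_jordan cX).
have E' := jordan_type_uniq tX' (chain_type_jordan cX').
rewrite -{}E in cX; rewrite -{}E' in cX'.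
have [A [B [AB BA AX AG]]] := chain_type_isometry cX cX'.
by exists A; split=> //; have [] := mulmx1_unit AB.
Qed.

(** The normal form is applied to the zero matrix, which is skew and nilpotent; its type depends on
    the dimension only. *)
Lemma hermitian_isometry m n (G : 'M[K]_m) (G' : 'M[K]_n) : m = n ->
  ctrmx G = G -> G \in unitmx -> ctrmx G' = G' -> G' \in unitmx ->
  exists (A : 'M_(n, m)) (B : 'M_(m, n)),
    [/\ A *m B = 1%:M, B *m A = 1%:M & A *m G *m ctrmx A = G'].
Proof.
move=> mn hG Gu hG' Gu'.
have h0 p (H : 'M[K]_p) : 0 *m H = - (H *m ctrmx 0) by rewrite mul0mx ctrmx0 mulmx0 oppr0.
have n0 p : nilpotent_mx (0 : 'M[K]_p) by exists 1%N.
have [la cG] := chain_type_exists hG Gu (h0 _ G) (n0 m).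
have [mu cG'] := chain_type_exists hG' Gu' (h0 _ G') (n0 n).
have E : la = mu.
  apply: partition_eq_rank; [by case: cG|by case: cG'|] => k.
  rewrite -(rank_jordan_type _ (chain_type_jordan cG)).
  rewrite -(rank_jordan_type _ (chain_type_jordan cG')).
  by case: k => [|k]; rewrite ?expr0 ?mxrank1 // !expmxS !mul0mx !mxrank0.
rewrite -{}E in cG'; have [A [B [AB BA _ AG]]] := chain_type_isometry cG cG'.
by exists A, B.
Qed.

(** The Jordan matrix is skew for [chain_gram la], and an isometry from that form to G carries it
    over. *)
Lemma jordan_type_exists n (G : 'M[K]_n) la :
  ctrmx G = G -> G \in unitmx -> is_partition la -> sumn la = n ->
  exists2 X, X *m G = - (G *m ctrmx X) & jordan_type X la.
Proof.
move=> hG Gu pla sla.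
have dim : (\sum_(i < size la) nth 0 la i = n)%N.
  by rewrite -sla sumnE (big_nth 0%N) big_mkord.
have [A [B [AB BA AG]]] :=
  hermitian_isometry dim (chain_gram_herm la) (chain_gram_unit la) hG Gu.
exists (A *m jordan_mx K la *m B).
  rewrite -AG !ctrmxM !mulmxA -(mulmxA _ B A) BA mulmx1.
  rewrite -(mulmxA _ (ctrmx A)) -ctrmxM BA ctrmx1 mulmx1.
  by rewrite -(mulmxA A) chain_gram_skew mulmxN mulNmx !mulmxA.
split=> //; exists B; split.
- by apply/row_freeP; exists A.
- by apply/row_fullP; exists A.
- by rewrite !mulmxA BA mul1mx.
Qed.

End ChainGram.

(** * Bordering a nilpotent matrix *)

Section Edges.

Lemma nth_column la i j : sorted geq la -> (0 < j)%N ->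
  (j <= nth 0%N la i)%N = (i < column la j)%N.
Proof.
rewrite /column => + j0; elim: la i => [|d la IH] i sla /=; first by rewrite nth_nil; lia.
have sla' : sorted geq la by apply: path_sorted sla.
have [jd|dj] := leqP j d; first by case: i => [|i] /=; rewrite ?jd // IH //; lia.
have la0 : count (leq j) la = 0%N.
  apply/eqP; rewrite -leqn0 leqNgt -has_count; apply/hasPn => x xla.
  have /allP/(_ x xla) : all (geq d) la by apply: order_path_min sla => x' y z /=; lia.
  by rewrite /=; lia.
by rewrite la0; case: i => [|i] /=; rewrite ?IH // ?la0; lia.
Qed.

Lemma count_skew la mu j : sorted geq la -> sorted geq mu -> (0 < j)%N ->
  count_mem j (skew_columns la mu) = (column la j - column mu j)%N.
Proof.
move=> sla smu j0; rewrite /skew_columns count_sort.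
rewrite count_flatten -map_comp.
rewrite (@eq_map _ _ _ (fun i => (column mu j <= i < column la j)%N : nat)) => [|i]; last first.
  rewrite /= count_uniq_mem ?iota_uniq // mem_iota; congr nat_of_bool.
  rewrite -[nth 0%R mu i]/(nth 0%N mu i) -[nth 0%R la i]/(nth 0%N la i).
  by have := nth_column i sla j0; have := nth_column i smu j0; lia.
suff E M : sumn [seq (column mu j <= i < column la j)%N : nat | i <- iota 0 M] =
    (minn (column la j) M - minn (column mu j) M)%N.
  by rewrite E (minn_idPl (count_size _ _)); have := count_size (leq j) la; rewrite -/(column la j); lia.
elim: M => [|M IH]; first by rewrite /=; lia.
by rewrite -addn1 iotaD map_cat sumn_cat IH /=; lia.
Qed.

Lemma skew_columns_pos la mu : 0%N \notin skew_columns la mu.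
Proof.
rewrite /skew_columns mem_sort; apply/flattenP => -[s /mapP[i _ ->]].
by rewrite mem_iota.
Qed.

(** Ranks of powers give column lengths, so edges are restated on conjugate partitions. *)
Definition edge_step mu la k l :=
  forall j, (0 < j)%N -> column la j = (column mu j + (j == k) + (j == l))%N.

Lemma subpartition_column mu la j : sorted geq la -> sorted geq mu -> (0 < j)%N ->
  subpartition mu la -> (column mu j <= column la j)%N.
Proof.
move=> sla smu j0 /allP sub; rewrite leqNgt; apply/negP => lt.
have cs := count_size (leq j) mu; have := sub (column la j).
rewrite mem_iota (leq_trans lt) //= => /(_ isT); apply/negP; rewrite -ltnNge.
have := nth_column (column la j) sla j0; rewrite ltnn => /negbT; rewrite -ltnNge => /leq_trans; apply.
by rewrite nth_column.
Qed.

Lemma edge_stepP mu la : is_partition mu -> is_partition la ->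
  edge mu la -> exists k l, [/\ skew_columns la mu = [:: k; l], (0 < k)%N,
    (l == k) || (l == k.+1) & edge_step mu la k l].
Proof.
move=> /andP[smu _] /andP[sla _] /and3P[_ sub].
case E : skew_columns => [|k [|l []]] // kl; exists k, l; split=> //.
  have := skew_columns_pos la mu; rewrite E !inE; lia.
move=> j j0; have := count_skew sla smu j0; have := subpartition_column sla smu j0 sub.
by rewrite E /= (eq_sym k) (eq_sym l); lia.
Qed.

Lemma edge_of_step mu la k l : is_partition mu -> is_partition la ->
  sumn la = (sumn mu).+2 -> (0 < k)%N -> (l == k) || (l == k.+1) ->
  edge_step mu la k l -> edge mu la /\ skew_columns la mu = [:: k; l].
Proof.
move=> /andP[smu zmu] /andP[sla _] sE k0 kl st.
have skE : skew_columns la mu = [:: k; l].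
  apply: (@sorted_eq _ leq) => //; [exact: leq_trans|exact: anti_leq| | |].
  - exact: sort_sorted leq_total _.
  - by rewrite /= andbT; lia.
  apply/allP => j _; apply/eqP; have [->|j0] := posnP j.
    by rewrite !(count_memPn _) ?skew_columns_pos // !inE; lia.
  by rewrite count_skew // st //= (eq_sym k) (eq_sym l); lia.
split=> //; rewrite /edge sE eqxx skE kl andbT /=.
apply/allP => i; rewrite mem_iota => /andP[_ /= isz].
have mi : (0 < nth 0%N mu i)%N.
  rewrite lt0n; apply: contra zmu => /eqP E.
  by rewrite -[0%R]/0%N -[X in X \in _]E; apply: mem_nth.
change (nth 0%N mu i <= nth 0%N la i)%N.
have := nth_column i smu mi; have := nth_column i sla mi; have := st _ mi.
by rewrite leqnn => -> ->; lia.
Qed.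

(** Both sides sum the row index, counted from 0, over all boxes: row by row and column by column.
    [M] only has to bound the number of columns. *)
Lemma npart_column la M : sorted geq la -> (sumn la <= M)%N ->
  npart la = (\sum_(j < M) 'C(column la j.+1, 2))%N.
Proof.
move=> sla hM; rewrite /npart.
have le_la i : (nth 0%N la i <= M)%N.
  apply: leq_trans hM; elim: la i {sla} => [|d la IH] [|i] //=; first lia.
  by have := IH i; lia.
rewrite (eq_bigr (fun i : 'I_(size la) => \sum_(j < M) i * (j.+1 <= nth 0%N la i)%N)%N) => [|i _]; last first.
  rewrite -big_distrr /=; congr muln.
  have := le_la i; move: (nth 0%N la i) => x; elim: M {hM le_la} => [|m IH] hx; first by rewrite big_ord0; lia.
  rewrite big_ord_recr /=; have [xm|mx] := leqP x m; first by rewrite -IH //; lia.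
  rewrite (eq_bigr (fun=> 1%N)) => [|j _]; last by have := ltn_ord j; lia.
  by rewrite sum1_card card_ord; lia.
rewrite exchange_big /=; apply: eq_bigr => j _.
rewrite (eq_bigr (fun i : 'I_(size la) => i * (i < column la j.+1)%N)%N) => [|i _]; last first.
  by rewrite nth_column.
have := count_size (leq j.+1) la; rewrite -/(column la j.+1); move: (column _ _) (size la) => c m cm.
rewrite -bin2_sum big_mkord -(subnKC cm) big_split_ord /= [X in (_ + X)%N]big1 ?addn0 => [|i _].
  by apply: eq_bigr => i _; rewrite ltn_ord muln1.
by rewrite (_ : (_ < c)%N = false) ?muln0 //; lia.
Qed.

(** A box added below a column of height c contributes c, and a second one in the same column c +
    1. *)
Lemma npart_edge mu la k l : is_partition mu -> is_partition la ->
  (0 < k)%N -> (0 < l)%N -> edge_step mu la k l ->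
  (npart la = npart mu + column mu k + column mu l + (l == k))%N.
Proof.
move=> /andP[smu _] /andP[sla _] k0 l0 st.
set M := (sumn la + sumn mu + k + l)%N.
rewrite (@npart_column la M) 1?(@npart_column mu M) ?/M //; try lia.
rewrite -/M (eq_bigr (fun j : 'I_M => 'C(column mu j.+1, 2) +
  (j == k.-1 :> nat) * (column mu k) + (j == l.-1 :> nat) * (column mu l + (l == k)))%N) => [|j _].
  have dl (i x : nat) : (i < M)%N -> (\sum_(j < M) (j == i :> nat) * x = x)%N.
    move=> iM; rewrite (bigD1 (Ordinal iM)) //= eqxx mul1n big1 ?addn0 // => j ji.
    by rewrite (_ : (j == i :> nat) = false) //; apply/negbTE.
  by rewrite !big_split /= !dl /M; lia.
have C1 c : ('C(c.+1, 2) = 'C(c, 2) + c)%N by rewrite binS bin1.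
rewrite st //; have -> : (j == k.-1 :> nat) = (j.+1 == k) by lia.
have -> : (j == l.-1 :> nat) = (j.+1 == l) by lia.
case: (j.+1 =P k) => [<-|jk]; case: (j.+1 =P l) => [<-|jl] //=; rewrite ?addn0 ?addn1 ?C1 ?eqxx.
- by lia.
- by lia.
- by case: eqP => [E|_]; lia.
- by lia.
Qed.

End Edges.

(** * Ranks of powers of a bordered matrix *)

Section BorderRank.
Variable F : fieldType.

Lemma mxrank_col_rV m n (p : 'rV[F]_n) (A : 'M_(m, n)) :
  \rank (col_mx p A) = (\rank A + ~~ (p <= A)%MS)%N.
Proof.
rewrite -addsmxE; have [pA|npA] := boolP (p <= A)%MS.
  by rewrite (addsmx_idPr pA) addn0.
rewrite addnC; apply/eqP; rewrite -(eqn_add2r (\rank (p :&: A)%MS)) mxrank_sum_cap.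
have r1 : \rank p = 1%N.
  by rewrite rank_rV; case: eqP => // p0; rewrite p0 sub0mx in npA.
have lec : (\rank (p :&: A)%MS <= \rank p)%N by rewrite mxrankS ?capmxSl.
have nec : \rank (p :&: A)%MS != \rank p.
  rewrite (mxrank_leqif_eq (capmxSl p A)); apply: contra npA => /andP[_ pcap].
  exact: submx_trans pcap (capmxSr _ _).
by rewrite /=; lia.
Qed.

(** A row outside the row space and a column outside the column space each raise the rank by one,
    whatever the corner [s] is. *)
Lemma rank_border2 n (A : 'M[F]_n) (p : 'rV_n) (s : 'M_1) (b : 'cV_n) :
  ~~ (p <= A)%MS -> (forall v, b <> A *m v) ->
  \rank (block_mx p s A b) = (\rank A).+2.
Proof.
move=> npA nbA; rewrite block_mxEh -mxrank_tr tr_row_mx -addsmxE addsmxC addsmxE mxrank_col_rV.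
rewrite mxrank_tr mxrank_col_rV npA addn1.
suff /negbTE-> : ~~ ((col_mx s b)^T <= (col_mx p A)^T)%MS by rewrite addn1.
apply/negP => /submxP[t]; rewrite !tr_col_mx mul_mx_row => /eq_row_mx[_ E].
by apply: (nbA t^T); rewrite -[b]trmxK E trmx_mul trmxK.
Qed.

(** Unipotent row and column operations clear the border and leave the Schur complement s - u A v in
    the corner. *)
Lemma rank_border0 n (A : 'M[F]_n) (u : 'rV_n) (s : 'M_1) (v : 'cV_n) :
  \rank (block_mx (u *m A) s A (A *m v)) = (\rank A + (s != u *m A *m v))%N.
Proof.
set s' := s - u *m A *m v.
have -> : block_mx (u *m A) s A (A *m v) =
    block_mx 1%:M u 0 1%:M *m (block_mx 0 s' A 0 *m block_mx 1%:M v 0 1%:M).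
  rewrite !mulmx_block !(mul1mx, mulmx1, mul0mx, mulmx0, add0r, addr0).
  by rewrite /s' mulmxA subrK.
have uu : block_mx 1%:M u 0 1%:M \in unitmx.
  by rewrite unitmxE det_ublock !det1 mulr1 unitr1.
have uv : block_mx 1%:M v 0 1%:M \in unitmx.
  by rewrite unitmxE det_ublock !det1 mulr1 unitr1.
rewrite eqmxMfull ?row_full_unit // mxrankMfree ?row_free_unit //.
rewrite block_mxEv -addsmxE addsmxC addsmxE -block_mxEv rank_diag_block_mx.
by rewrite rank_rV subr_eq0.
Qed.

End BorderRank.

Section Extension.
Variable K : quadField.
Notation bar := (@bar K).
Variables (n : nat) (G X : 'M[K]_n).
Hypotheses (hG : ctrmx G = G) (Gu : G \in unitmx) (hX : X *m G = - (G *m ctrmx X)).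

(** The form G is enlarged by a hyperbolic plane spanned by the first and last coordinates; skewness
    for it forces the last column once [w] is given, and asks that [c] be skew. *)
Definition ext_mx (w : 'rV[K]_n) (c : K) : 'M[K]_(1 + (n + 1)) :=
  block_mx 0 (row_mx w c%:M) 0 (block_mx X (- (G *m ctrmx w)) 0 0).

Lemma ext_mx_exp w c k : ext_mx w c ^+ k.+1 =
  block_mx 0 (row_mx (w *m X ^+ k)
                (if k is k'.+1 then - (w *m X ^+ k' *m G *m ctrmx w) else c%:M))
           0 (block_mx (X ^+ k.+1) (- (X ^+ k *m G *m ctrmx w)) 0 0).
Proof.
elim: k => [|k IH]; first by rewrite !expr1 expr0 mulmx1 mul1mx.
rewrite expmxS IH /ext_mx mulmx_block !(mul0mx, mulmx0, add0r, addr0).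
rewrite mul_row_block mulmx_block !(mul0mx, mulmx0, add0r, addr0).
by rewrite !mulmxN !mulmxA -!expmxS.
Qed.

Lemma rank_ext_block (w : 'rV[K]_n) (A : 'M[K]_n) (b : 'cV[K]_n) (s : 'M[K]_1) :
  \rank (block_mx 0 (row_mx w s) 0 (block_mx A b 0 0) : 'M[K]_(1 + (n + 1), 1 + (n + 1))) =
  \rank (block_mx w s A b).
Proof.
rewrite block_mxEh col_mx0 rank_row_0mx (block_mxEv A) row_mx0 block_mxEv.
rewrite -(addsmxE _ (col_mx _ _)) -(addsmxE _ (row_mx A b)).
have E : (col_mx (row_mx A b) (0 : 'M_(1, n + 1)) :=: row_mx A b)%MS.
  exact: eqmx_trans (eqmx_sym (addsmxE _ _)) (addsmx0 _ _).
by rewrite (adds_eqmx (eqmx_refl _) E).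
Qed.

Definition reaches k (w : 'rV[K]_n) := (w *m X ^+ k <= X ^+ k.+1)%MS.

Lemma reachesS k w : reaches k w -> reaches k.+1 w.
Proof.
by rewrite /reaches !(expmxSr X k) (expmxSr X k.+1) !mulmxA -expmxSr; apply: submxMr.
Qed.

Lemma skew_expl k (w : 'rV[K]_n) : X ^+ k *m G *m ctrmx w = (-1) ^+ k *: (G *m ctrmx (w *m X ^+ k)).
Proof.
elim: k w => [|k IH] w; first by rewrite !expr0 !(mul1mx, mulmx1) scale1r.
rewrite {1}expmxSr -!mulmxA (mulmxA X) hX mulNmx mulmxN -(mulmxA G) -ctrmxM (mulmxA _ G).
by rewrite IH -mulmxA -expmxS [(-1) ^+ _.+1]exprS mulN1r scaleNr.
Qed.

Let bk (w : 'rV[K]_n) k := - (X ^+ k *m G *m ctrmx w).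

Let bk_reach k w u : w *m X ^+ k = u *m X ^+ k.+1 -> bk w k = X ^+ k.+1 *m (G *m ctrmx u).
Proof.
move=> E; rewrite /bk skew_expl E mulmxA skew_expl.
by rewrite [(-1) ^+ _.+1]exprS mulN1r scaleNr.
Qed.

Let bk_nreach k w : ~~ reaches k w -> forall v, bk w k <> X ^+ k.+1 *m v.
Proof.
move=> nr v /(congr1 (fun x => ctrmx x)) E; case/negP: nr.
apply/submxP; exists (ctrmx v *m invmx G).
have hE : v = G *m ctrmx (ctrmx v *m invmx G).
  have Gi : ctrmx (invmx G) = invmx G.
    by rewrite -[RHS]mulmx1 -[in RHS](ctrmx1 K) -(mulVmx Gu) ctrmxM hG mulKmx.
  by rewrite ctrmxM ctrmxK Gi mulKVmx.
move: E; rewrite {1}hE mulmxA skew_expl /bk skew_expl.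
move/(congr1 (fun x => ctrmx x)); rewrite !ctrmxK [(-1) ^+ _.+1]exprS mulN1r scaleNr => /oppr_inj.
move/(scalerI (negbT (signr_eq0 _ _))) => /(congr1 (mulmx (invmx G))).
by rewrite !mulKmx // => /(congr1 (fun x => ctrmx x)); rewrite !ctrmxK.
Qed.

(** Up to sign the new column is G times the conjugate transpose of the new row, so the column
    leaves the column space of X^(k+1) as soon as the row leaves its row space. *)
Lemma rank_ext_nreach k w c : ~~ reaches k w ->
  \rank (ext_mx w c ^+ k.+1) = (\rank (X ^+ k.+1)).+2.
Proof.
move=> nr; rewrite ext_mx_exp rank_ext_block //; apply: rank_border2 => //.
exact: bk_nreach.
Qed.

(** In the first power the corner is the free scalar [c], and the Schur complement is c + <u, w>: it
    vanishes for one value of [c]. *)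
Lemma rank_ext_reach0 w c u : w = u *m X ->
  \rank (ext_mx w c) = (\rank X + ((c + ip G u w)%R != 0%R))%N.
Proof.
move=> wE; rewrite /ext_mx rank_ext_block //.
have := @bk_reach 0 w u; rewrite expr0 expr1 mulmx1 => /(_ wE); rewrite /bk expr0 mul1mx => ->.
rewrite {1}wE rank_border0; congr (_ + nat_of_bool _)%N; congr negb.
have -> : u *m X *m (G *m ctrmx u) = (- ip G u w)%:M.
  rewrite [LHS]mx11_scalar wE /ip ctrmxM; congr (_%:M).
  rewrite !mulmxA -(mulmxA u G) -(mulmxA u X) hX mulmxN mulNmx mxE.
  by rewrite !mulmxA.
rewrite -subr_eq0 -raddfB /= opprK; apply/eqP/eqP => [/matrixP/(_ 0 0)|->].
  by rewrite !mxE eqxx.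
by rewrite raddf0.
Qed.

(** The vector z = w - u X is killed by X^(k+1), and the Schur complement is minus the value at z of
    the form <x X^k, y>, which is the form carried by the tops of chains of length k + 1. *)
Lemma rank_ext_reach k w c u : w *m X ^+ k.+1 = u *m X ^+ k.+2 ->
  \rank (ext_mx w c ^+ k.+2) =
  (\rank (X ^+ k.+2) + (ip G ((w - u *m X) *m X ^+ k) (w - u *m X) != 0)%R)%N.
Proof.
move=> wE; rewrite ext_mx_exp rank_ext_block // -/(bk w k.+1) (bk_reach wE).
rewrite {1}wE rank_border0; congr (_ + nat_of_bool _)%N; congr negb.
set z := w - u *m X.
have zX : z *m X ^+ k.+1 = 0.
  by rewrite /z mulmxBl wE -mulmxA -expmxS subrr.
have zE : ip G (z *m X ^+ k) z = ip G (w *m X ^+ k) w + ip G (u *m X ^+ k.+2) u.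
  rewrite {2}/z ipDr ipNr.
  have -> : ip G (z *m X ^+ k) (u *m X) = 0.
    have := ip_skewX 1 (z *m X ^+ k) u hX; rewrite expr1 -mulmxA -expmxSr zX ip0l.
    by rewrite expr1 mulN1r => /esym/eqP; rewrite oppr_eq0 => /eqP.
  rewrite subr0 mulmxBl ipDl ipNl -mulmxA -expmxS; congr (_ + _).
  by rewrite !ip_skewX // wE [in RHS]exprS mulN1r mulNr.
have key (a : 'M[K]_1) : (a == 0) = (a 0 0 == 0).
  by rewrite {1}(mx11_scalar a); apply/eqP/eqP => [/matrixP/(_ 0 0)|->]; rewrite ?raddf0 // !mxE eqxx.
rewrite -[RHS]oppr_eq0 zE opprD -[LHS]subr_eq0 key; congr (_ == 0).
rewrite mxE [X in X + _]mxE [X in _ + X]mxE /ip !mulmxA //.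
Qed.

End Extension.

Section ExtensionTypes.
Variable K : quadField.
Notation bar := (@bar K).
Notation q := (qq K).
Variables (n : nat) (G X : 'M[K]_n) (mu : seq nat).
Hypotheses (hG : ctrmx G = G) (Gu : G \in unitmx) (hX : X *m G = - (G *m ctrmx X)).
Hypothesis (tX : jordan_type X mu).

Lemma mulmx_expS k (w u : 'rV[K]_n) : w *m X ^+ k = u *m X ^+ k.+1 ->
  w *m X ^+ k.+1 = u *m X ^+ k.+2.
Proof. by move=> E; rewrite expmxSr mulmxA E -mulmxA -expmxSr. Qed.

(* A bordering vector first reaching at [k] adds its first box in column [k + 1];
   the second box goes to the same column if the border is tight, else to the next. *)
Definition first_reach k (w : 'rV[K]_n) :=
  reaches X k w && (if k is k'.+1 then ~~ reaches X k' w else true).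

Definition tight k (p : 'rV[K]_n * K) :=
  \rank (ext_mx G X p.1 p.2 ^+ k.+1) == \rank (X ^+ k.+1).

Lemma reaches_le j k w : (j <= k)%N -> reaches X j w -> reaches X k w.
Proof.
move=> jk rj; rewrite -(subnKC jk); elim: (k - j)%N => [|i IH]; first by rewrite addn0.
by rewrite addnS reachesS.
Qed.

Lemma exists_first_reach w : exists k, first_reach k w.
Proof.
have ex : exists k, reaches X k w.
  exists n; rewrite /reaches (nilpotent_jordan_type tX) mulmx0; exact: sub0mx.
case: (ex_minnP ex) => k rk kmin; exists k; rewrite /first_reach rk.
by case: k rk kmin => // k _ kmin; apply/negP => /kmin; rewrite ltnn.
Qed.

Lemma rank_ext_profile k p j : first_reach k p.1 ->
  \rank (ext_mx G X p.1 p.2 ^+ j) = (\rank (X ^+ j) +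
    (if j <= k then 2 else if j == k.+1 then (~~ tight k p : nat) else 0))%N.
Proof.
case: p => w c /= /andP[rk nrk]; case: j => [|j]; first by rewrite !expr0 !mxrank1 leq0n; lia.
have [jk|kj] := ltnP j k.
  rewrite rank_ext_nreach ?addn2 //; case: k nrk jk {rk} => // k nrk jk.
  by apply: contra nrk; apply: reaches_le; rewrite -ltnS.
have [->|jk] := eqVneq j k; last first.
  rewrite (_ : j.+1 == k.+1 = false); last by lia.
  case: j kj jk => [|j] kj jk; first by lia.
  (* The power in question is j + 2 > k + 1, so w already reaches one step earlier than required.
     With this u the vector w - u X is killed by X^j and the form vanishes. *)
  have /submxP[u uE] : reaches X j w by apply: reaches_le rk; lia.
  rewrite (rank_ext_reach hX c (mulmx_expS uE)).
  by rewrite mulmxBl -mulmxA -expmxS uE subrr ip0l eqxx.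
rewrite eqxx /tight /=.
have [b ->] : exists b : bool, \rank (ext_mx G X w c ^+ k.+1) = (\rank (X ^+ k.+1) + b)%N.
  case: k rk {nrk kj} => [|k] /submxP[u uE]; last by rewrite (rank_ext_reach hX c uE); eexists.
  rewrite expr0 mulmx1 in uE; rewrite !expr1 in uE *.
  by rewrite (rank_ext_reach0 hX c uE); eexists.
by move: (\rank _) => r; case: b; case: eqP; lia.
Qed.

Definition ext_edge k p := if tight k p then k.+1 else k.+2.

Lemma ext_edge_step k p la : jordan_type (ext_mx G X p.1 p.2) la ->
  first_reach k p.1 -> edge_step mu la k.+1 (ext_edge k p).
Proof.
move=> tY fr [//|j] _; apply: (@addnI (rank_sum la j.+1)); rewrite -rank_sumS.
have := rank_sumS mu j; rewrite -!(rank_jordan_type _ tY) -!(rank_jordan_type _ tX).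
rewrite !(rank_ext_profile _ fr) /ext_edge !eqSS => ->.
by case: (tight k p) => /=; repeat case: ifP => ?; lia.
Qed.

(** The pair of new columns determines the border data: the smaller column is k + 1, and the two
    coincide exactly for a tight border. *)
Lemma jordan_type_ext k l p la la' : is_partition la ->
  jordan_type (ext_mx G X p.1 p.2) la' -> edge_step mu la k.+1 l ->
  (l == k.+1) || (l == k.+2) ->
  jordan_type (ext_mx G X p.1 p.2) la <->
  first_reach k p.1 && (tight k p == (l == k.+1)).
Proof.
move=> pla tY' st kl; split=> [tY|/andP[fr tl]].
  have [k' fr] := exists_first_reach p.1.
  have st' := ext_edge_step tY fr.
  have E j : (0 < j)%N -> ((j == k.+1) + (j == l) = (j == k'.+1) + (j == ext_edge k' p))%N.
    by move=> j0; have := st j j0; rewrite st' //; lia.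
  have kk : k = k'.
    have := E k.+1 isT; have := E k'.+1 isT; rewrite /ext_edge; case: tight; lia.
  rewrite -{}kk in fr E *; rewrite fr /=.
  have := E l; rewrite /ext_edge; case: tight; case: (l =P k.+1) => //= lk; lia.
have st' := ext_edge_step tY' fr.
rewrite (_ : la = la') //; apply: partition_eq_column => //; first by case: tY'.
move=> j j0; rewrite st // st' // /ext_edge (eqP tl).
by case: (l =P k.+1) kl => [->|_] //= /eqP ->.
Qed.

Lemma reaches_ker k w : reaches X k w = (w \in rowg (kermx (X ^+ k *m cokermx (X ^+ k.+1)))).
Proof. by rewrite mem_rowg sub_kermx /reaches submxE -mulmxA. Qed.

Lemma column_rank k : (column mu k.+1 = \rank (X ^+ k) - \rank (X ^+ k.+1))%N.
Proof. by rewrite !(rank_jordan_type _ tX) (rank_sumS mu k) addKn. Qed.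

(** These vectors form the kernel of X^k followed by reduction modulo the image of X^(k+1); the
    target has the length of column k + 1 as dimension. *)
Lemma card_reaches k : #|[set w | reaches X k w]| = (q ^ (2 * (n - column mu k.+1)))%N.
Proof.
rewrite expnM -card_qF -(_ : \rank (kermx (X ^+ k *m cokermx (X ^+ k.+1))) = (n - column mu k.+1)%N).
  by rewrite -card_rowg; apply: eq_card => w; rewrite inE reaches_ker.
rewrite mxrank_ker column_rank; congr (_ - _)%N.
rewrite -[in RHS](mxrank_mul_ker (X ^+ k) (cokermx (X ^+ k.+1))).
suff -> : \rank (X ^+ k :&: kermx (cokermx (X ^+ k.+1)))%MS = \rank (X ^+ k.+1) by rewrite addnK.
apply: eqmx_rank; apply/andP; split.
  by apply: submx_trans (capmxSr _ _) _; rewrite submxE mulmx_ker.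
by rewrite sub_capmx sub_kermx -submxE submx_refl andbT expmxS submxMl.
Qed.

Lemma column_le k : (column mu k.+1 <= n)%N.
Proof. by rewrite column_rank (leq_trans (leq_subr _ _)) ?rank_leq_row. Qed.

Variable e : K.
Hypotheses (e0 : e != 0) (be : bar e = - e).

Lemma chain_tops r : exists B : 'M[K]_(mult r.+1 mu, n),
  (forall i, row i B *m X ^+ r.+1 = 0) /\
  forall i j, ip G (row i B *m X ^+ r) (row j B) = if i == j then chain_sign e r.+1 else 0.
Proof.
have nX : nilpotent_mx X by exists n; apply: nilpotent_jordan_type tX.
have [s sP] := canonical_chains_exist e0 be hG Gu hX nX.
have muE : map fst s = mu.
  apply: (jordan_type_uniq _ tX); split.
    by case: sP => s1 s2 _ _ _; rewrite /is_partition s1; apply/negP => /(allP s2).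
  by have [P [? ? ? _]] := chain_matrix e0 hX sP; exists P.
case: sP => _ _ _ s4 s5.
pose idxs := [seq i <- iota 0 (size mu) | nth 0%N mu i == r.+1].
have sz : size idxs = mult r.+1 mu.
  rewrite size_filter /mult -[in RHS](mkseq_nth 0%N mu) /mkseq count_map.
  by apply: eq_count.
have szm : size mu = size s by rewrite -muE size_map.
have nthm j : (j < size s)%N -> (nth (0%N, 0 : 'rV[K]_n) s j).1 = nth 0%N mu j.
  by move=> js; rewrite -muE (nth_map (0%N, 0)).
have idxP (i : 'I_(mult r.+1 mu)) :
    (nth 0%N idxs i < size s)%N /\ (nth (0%N, 0 : 'rV[K]_n) s (nth 0%N idxs i)).1 = r.+1.
  have : nth 0%N idxs i \in idxs by rewrite mem_nth // sz.
  rewrite mem_filter mem_iota add0n szm => /andP[/eqP h /andP[_ h']].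
  by split; rewrite ?nthm.
exists (\matrix_(i < mult r.+1 mu) (nth (0%N, 0) s (nth 0%N idxs i)).2); split=> [i|i j].
  by have [h1 h2] := idxP i; have := s4 _ h1; rewrite h2 rowK.
have [h1 h2] := idxP i; have [h1' _] := idxP j.
rewrite !rowK s5 // h2 eqxx andbT nth_uniq ?sz //.
by rewrite filter_uniq ?iota_uniq.
Qed.

Section Tops.
Variables (r : nat) (B : 'M[K]_(mult r.+1 mu, n)).
Hypothesis BX : forall i, row i B *m X ^+ r.+1 = 0.
Hypothesis BB : forall i j,
  ip G (row i B *m X ^+ r) (row j B) = if i == j then chain_sign e r.+1 else 0.

Let BX0 : B *m X ^+ r.+1 = 0.
Proof. by apply/row_matrixP => i; rewrite row_mul BX row0. Qed.

Let ipB (a : 'rV_(mult r.+1 mu)) j :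
  ip G (a *m B *m X ^+ r) (row j B) = a 0 j * chain_sign e r.+1.
Proof.
rewrite -mulmxA ip_suml (bigD1 j) //= big1 ?addr0 => [|i ij]; rewrite row_mul BB ?eqxx //.
by rewrite (negbTE ij) mulr0.
Qed.

Let reaches_top (a : 'rV_(mult r.+1 mu)) s :
  reaches X r s -> reaches X r (a *m B + s) = (a == 0).
Proof.
move=> /submxP[u uE]; apply/idP/eqP => [|->]; last first.
  by rewrite mul0mx add0r /reaches uE submxMl.
rewrite /reaches mulmxDl uE => /submxP[v vE].
have E : a *m B *m X ^+ r = (v - u) *m X ^+ r.+1 by rewrite mulmxBl -vE addrK.
apply/rowP => j; rewrite mxE; apply/eqP; have := ipB a j.
rewrite E ip_skewX // BX ip0r mulr0 => /esym/eqP.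
by rewrite mulf_eq0 (negbTE (chain_sign_neq0 e0 _)) orbF.
Qed.

Let reachesS_top (a : 'rV_(mult r.+1 mu)) s :
  reaches X r s -> reaches X r.+1 (a *m B + s).
Proof.
by move=> /reachesS /submxP[u uE]; rewrite /reaches mulmxDl -mulmxA BX0 mulmx0 add0r uE submxMl.
Qed.

Let tight_top (a : 'rV_(mult r.+1 mu)) s c :
  reaches X r s -> tight r.+1 (a *m B + s, c) = (herm a == 0).
Proof.
move=> /submxP[u uE]; have wE : (a *m B + s) *m X ^+ r.+1 = u *m X ^+ r.+2.
  by rewrite mulmxDl -mulmxA BX0 mulmx0 add0r (mulmx_expS uE).
rewrite /tight /= (rank_ext_reach hX c wE).
set z := _ - _; have zE : z = a *m B + (s - u *m X) by rewrite /z addrA.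
have z0 : (s - u *m X) *m X ^+ r = 0 by rewrite mulmxBl uE -mulmxA -expmxS subrr.
have -> : ip G (z *m X ^+ r) z = herm a * chain_sign e r.+1.
  rewrite zE mulmxDl z0 addr0 ipDr [X in _ + X]ip_skewX // z0 ip0r mulr0 addr0.
  rewrite ip_sumr /herm mulr_suml; apply: eq_bigr => i _.
  by rewrite ipB; ring.
rewrite mulf_eq0 (negbTE (chain_sign_neq0 e0 _)) orbF.
by case: (herm a == 0); move: (\rank _) => x; case: eqP; lia.
Qed.

Let f (p : 'rV[K]_(mult r.+1 mu) * 'rV[K]_n) := p.1 *m B + p.2.
Let S k := [set w | reaches X k w].

Let reachesB k w w' : reaches X k w -> reaches X k w' -> reaches X k (w - w').
Proof.
by rewrite /reaches mulmxBl => h h'; rewrite addmx_sub // eqmx_opp.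
Qed.

Let f_inj : {in setX [set: 'rV_(mult r.+1 mu)] (S r) &, injective f}.
Proof.
move=> [a s] [a' s']; rewrite !inE /f /= => rs rs' E.
have E' : (a - a') *m B + (s - s') = 0.
  by rewrite mulmxBl addrACA -opprD E subrr.
have : reaches X r ((a - a') *m B + (s - s')).
  by rewrite E' /reaches mul0mx sub0mx.
rewrite reaches_top ?reachesB // subr_eq0 => /eqP aa.
by move: E; rewrite aa => /addrI ->.
Qed.

(** The sum of tops and of vectors reaching at r is everything that reaches at r + 1, by
    cardinality: column r + 1 exceeds column r + 2 by the multiplicity of r + 1. *)
Let f_im : f @: setX [set: 'rV_(mult r.+1 mu)] (S r) = S r.+1.
Proof.
apply/eqP; rewrite eqEcard; apply/andP; split.
  by apply/subsetP => w /imsetP[[a s]]; rewrite !inE /= => rs ->; apply: reachesS_top.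
rewrite (card_in_imset f_inj) cardsX cardsT card_mx mul1n card_qF !card_reaches.
rewrite -expnM -expnD leq_exp2l ?(ltnW (ltnW (qq_gt2 K))) //; last exact: ltnW (qq_gt2 K).
by have := column_le r; have := column_mult mu r.+1; lia.
Qed.

(** Write w = a B + s with s reaching at r. Then w first reaches at r + 1 iff a is nonzero, and the
    border is tight iff a is isotropic; s and the skew scalar are free. *)
Lemma card_first_reach_tight z :
  #|[set p : 'rV_n * K | [&& bar p.2 == - p.2, first_reach r.+1 p.1 & tight r.+1 p == z]]| =
  (#|[set a : 'rV[K]_(mult r.+1 mu) | (a != 0)%R && ((herm a == 0)%R == z)]| *
   q ^ (2 * (n - column mu r.+1)) * q)%N.
Proof.
rewrite -card_reaches -(card_bar_skew K) -!cardsX.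
pose g (p : 'rV[K]_(mult r.+1 mu) * 'rV[K]_n * K) := (f p.1, p.2).
rewrite -(@card_in_imset _ _ g) => [|[[a s] c] [[a' s'] c']]; last first.
  rewrite !inE /= => /andP[/andP[_ h1] _] /andP[/andP[_ h2] _] [E ->].
  by have [-> ->] : (a, s) = (a', s') by apply: f_inj => //; rewrite !inE.
apply: eq_card => -[w c]; rewrite inE /=; apply/and3P/imsetP.
  move=> [bc /andP[r1 r2] tz].
  have : w \in S r.+1 by rewrite inE.
  rewrite -f_im => /imsetP[[a s]]; rewrite !inE /= => rs wE.
  exists (a, s, c); last by rewrite /g wE.
  rewrite !inE /= rs bc !andbT.
  by rewrite wE /f /= reaches_top // in r2; rewrite r2 -(tight_top _ c rs) -/(f (a, s)) -wE.
move=> [[[a s] c']]; rewrite !inE /= => /andP[/andP[/andP[a0 az] rs] bc] [-> ->].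
by rewrite bc /first_reach reachesS_top // reaches_top // a0 tight_top.
Qed.

End Tops.

Lemma card_tightS r :
  #|[set p : 'rV_n * K | [&& bar p.2 == - p.2, first_reach r.+1 p.1 & tight r.+1 p == true]]| =
  ((isotropic_count K (mult r.+1 mu)).-1 * q ^ (2 * (n - column mu r.+1)) * q)%N.
Proof.
have [B [BX BB]] := chain_tops r; rewrite (card_first_reach_tight BX BB); congr (_ * _ * _)%N.
rewrite /isotropic_count [in RHS](cardsD1 0) inE /herm big1 ?eqxx => [|i _]; last by rewrite mxE mul0r.
by apply: eq_card => a; rewrite !inE; case: (_ == 0 :> K).
Qed.

Lemma card_ntightS r :
  #|[set p : 'rV_n * K | [&& bar p.2 == - p.2, first_reach r.+1 p.1 & tight r.+1 p == false]]| =
  ((q ^ (2 * mult r.+1 mu) - isotropic_count K (mult r.+1 mu)) * q ^ (2 * (n - column mu r.+1)) * q)%N.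
Proof.
have [B [BX BB]] := chain_tops r; rewrite (card_first_reach_tight BX BB); congr (_ * _ * _)%N.
have -> : (q ^ (2 * mult r.+1 mu) = #|{: 'rV[K]_(mult r.+1 mu)}|)%N.
  by rewrite card_mx mul1n card_qF expnM.
rewrite -(cardsC [set a | herm a == 0]) /isotropic_count addKn.
apply: eq_card => a; rewrite !inE; case: (herm a =P 0) => h; rewrite /= ?andbF // andbT.
apply/eqP => a0; case: h; rewrite a0 /herm big1 // => i _.
by rewrite mxE mul0r.
Qed.

(** For w in the image of X the scalar d(w) = <w X^-1, w>, with a pseudo-inverse, is skew. The shear
    c - d(w) makes tightness the vanishing of c, independently of w. *)
Lemma card_tight0 (z : bool) :
  #|[set p : 'rV_n * K | [&& bar p.2 == - p.2, first_reach 0 p.1 & tight 0 p == z]]| =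
  (q ^ (2 * (n - column mu 1)) * (if z then 1 else q.-1))%N.
Proof.
pose d (w : 'rV_n) := ip G (w *m pinvmx X) w.
have uE w : first_reach 0 w -> w = w *m pinvmx X *m X.
  by rewrite /first_reach /reaches expr0 mulmx1 expr1 andbT => /mulmxKpV.
have dskew w : first_reach 0 w -> bar (d w) = - d w.
  move=> /uE wE; rewrite ip_bar // /d {1}wE.
  by have := ip_skewX 1 (w *m pinvmx X) (w *m pinvmx X) hX; rewrite !expr1 mulN1r -wE.
have tightE w c : first_reach 0 w -> tight 0 (w, c) = (c + d w == 0).
  move=> fw; rewrite /tight !expr1 (rank_ext_reach0 hX c (uE w fw)) -/(d w).
  by case: (c + d w == 0); move: (\rank _) => x; case: eqP; lia.
pose g (p : 'rV[K]_n * K) := (p.1, p.2 - d p.1).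
have g_inj : injective g by move=> [w c] [w' c'] [<-] /addIr ->.
pose Z := [set c : K | (bar c == - c) && ((c == 0) == z)].
have cZ : #|Z| = (if z then 1 else q.-1)%N.
  rewrite {}/Z; case: z => /=.
    rewrite -(cards1 (0 : K)); apply: eq_card => c; rewrite !inE eqb_id.
    by case: (c =P 0) => [->|]; rewrite ?andbF // rmorph0 oppr0 eqxx.
  rewrite -(card_bar_skew K) [in RHS](cardsD1 0) inE rmorph0 oppr0 eqxx /=.
  by apply: eq_card => c; rewrite !inE eqbF_neg andbC.
rewrite -cZ -card_reaches -cardsX -[RHS](card_imset _ g_inj).
apply: eq_card => -[w c]; rewrite inE /=; apply/and3P/imsetP.
  move=> [bc fw tz]; exists (w, c + d w); last by rewrite /g /= addrK.
  rewrite !inE /= -(tightE w c fw) tz andbT rmorphD /= (eqP bc) dskew // opprD eqxx.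
  by move: fw; rewrite /first_reach => ->.
move=> [[w' c']]; rewrite !inE /= => /and3P[rw /eqP bc cz] [-> ->].
have fw : first_reach 0 w' by rewrite /first_reach rw.
by rewrite tightE // subrK cz fw rmorphB /= bc dskew // opprB opprK addrC eqxx.
Qed.

End ExtensionTypes.

(** * Numbers of borders as edge weights *)

Section ExtensionCount.
Variables (R : realType) (K : quadField).
Notation bar := (@bar K).
Notation q := (qq K).
Variables (n : nat) (G X : 'M[K]_n) (mu : seq nat).
Hypotheses (hG : ctrmx G = G) (Gu : G \in unitmx) (hX : X *m G = - (G *m ctrmx X)).
Hypothesis (tX : jordan_type X mu).

Let t : R := - (q%:R)^-1.

Let q0 : (q%:R : R) != 0.
Proof. by rewrite pnatr_eq0 -lt0n qq_gt0. Qed.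

Let texp m : t ^+ m = (-1) ^+ m / q%:R ^+ m.
Proof. by rewrite /t [LHS]exprNn exprVn. Qed.

(** The factorization of the number of nonzero isotropic vectors that produces the one-column
    coefficient. At m = 0 both sides vanish, so [m.-1] does no harm there. *)
Let tight_weight m : q%:R * ((isotropic_count K m)%:R - 1) =
  q%:R ^+ (2 * m) * ((1 - t ^+ m) * (1 - t ^+ m.-1)).
Proof.
have := isotropic_countE K R m; rewrite natrM => AE.
rewrite mulrBr AE !texp mulnC exprM.
have Q0 : (q%:R : R) ^+ m != 0 by rewrite expf_neq0.
have ss : (-1) ^+ m * (-1) ^+ m = 1 :> R by rewrite -expr2 sqrr_sign.
case: m {AE} Q0 ss => [|m] /= Q0 ss; first by rewrite !expr0; field.
rewrite ![(-1) ^+ _.+1]exprS ![q%:R ^+ m.+1]exprS in Q0 ss *.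
have Q1 : (q%:R : R) ^+ m != 0 by rewrite expf_neq0.
set s := (-1) ^+ m in ss *; set Q := q%:R ^+ m in Q0 Q1 *; set x := q%:R.
have s2 : s * s = 1 by rewrite -ss; ring.
apply/eqP; rewrite -subr_eq0; apply/eqP.
have -> : (x * Q) ^+ 2 + -1 * s * (x * Q) * (x - 1) - x * 1 -
    (x * Q) ^+ 2 * ((1 - -1 * s / (x * Q)) * (1 - s / Q)) = x * (s * s - 1).
  by field; rewrite Q1 q0.
by rewrite s2 subrr mulr0.
Qed.

Let ntight_weight m : q%:R * (q%:R ^+ (2 * m) - (isotropic_count K m)%:R) =
  q%:R ^+ (2 * m).+1 * ((1 + t) * (1 - t ^+ m)).
Proof.
have := isotropic_countE K R m; rewrite natrM => AE.
rewrite mulrBr AE !texp exprS mulnC exprM /t; field.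
by rewrite q0 expf_neq0.
Qed.

(** There are q^(2n+1) borders in all; relative to this, each count loses n(la) - n(mu) in the
    exponent, which [npart_edge] reads off the column heights, and the rest is [xi]. *)
Lemma card_ext_edge la k l : is_partition la -> edge mu la ->
  skew_columns la mu = [:: k.+1; l] ->
  (#|[set p : 'rV_n * K | [&& bar p.2 == - p.2, first_reach X k p.1 &
       tight G X k p == (l == k.+1)]]|)%:R =
  (q%:R : R) ^ ((2 * n).+1%:Z + (npart mu)%:Z - (npart la)%:Z) * xi t mu la.
Proof.
move=> pla ed sk; have pmu : is_partition mu by case: tX.
have [k' [l' [E _ kl st]]] := edge_stepP pmu pla ed.
move: E; rewrite sk => -[ek el]; subst k' l'.
have l0 : (0 < l)%N by lia.
have np := npart_edge pmu pla (ltn0Sn k) l0 st.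
have ck := column_le tX k; have cm := column_mult mu k.+1.
have [e e0 be] := exists_skew K.
have q1 : (1 <= q)%N := qq_gt0 K.
have eE (a : nat) : (2 * n).+1%:Z + (npart mu)%:Z - (npart la)%:Z = a%:Z ->
    (q%:R : R) ^ ((2 * n).+1%:Z + (npart mu)%:Z - (npart la)%:Z) = q%:R ^+ a.
  by move=> ->.
rewrite /xi sk -/t /=; have [lE|lk] := eqVneq l k.+1.
  subst l; case: k => [|r] in kl st np ck cm sk l0 *.
    rewrite (card_tight0 hG Gu hX tX e0 true) muln1 natrX (eE (2 * (n - column mu 1))%N).
      by rewrite /tpow !subr0 !mulr1.
    by rewrite eqxx in np; lia.
  rewrite (card_tightS hG Gu hX tX e0 be) /tpow.
  have cm' := column_mult mu r.+1; have ck' := column_le tX r.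
  set m := mult r.+1 mu in cm' *.
  rewrite (eE (2 * (n - column mu r.+1) + 2 * m)%N); last by rewrite eqxx in np; lia.
  have A1 : (0 < isotropic_count K m)%N.
    rewrite /isotropic_count; apply/card_gt0P; exists 0.
    by rewrite inE /herm big1 // => i _; rewrite mxE mul0r.
  rewrite exprD -mulrA -tight_weight !natrM !natrX -subn1 natrB //; ring.
have {kl} lE : l = k.+2 by move: kl; rewrite (negbTE lk) /= => /eqP.
subst l; rewrite eqxx (negbTE lk) addn0 in np *.
have cm2 := column_mult mu k.+2.
case: k => [|r] in st np ck cm sk l0 cm2 lk *.
  rewrite (card_tight0 hG Gu hX tX e0 false).
  rewrite (eE (2 * (n - column mu 1) + mult 1 mu).+1%N); last by lia.
  rewrite /tpow subr0 mulr1 natrM natrX exprS exprD -subn1 natrB // /t opprK exprVn; field.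
  by rewrite q0 expf_neq0.
rewrite (card_ntightS hG Gu hX tX e0 be) /tpow.
have cm' := column_mult mu r.+1; have ck' := column_le tX r.
set m := mult r.+1 mu in cm' *; set m' := mult r.+2 mu in cm *.
have A1 : (isotropic_count K m <= q ^ (2 * m))%N.
  have -> : (q ^ (2 * m) = #|{: 'rV[K]_m}|)%N by rewrite card_mx mul1n card_qF expnM.
  exact: max_card.
have -> : ((q ^ (2 * m) - isotropic_count K m) * q ^ (2 * (n - column mu r.+1)) * q)%:R =
    q%:R ^+ (2 * (n - column mu r.+1)) * (q%:R ^+ (2 * m).+1 * ((1 + t) * (1 - t ^+ m))) :> R.
  by rewrite -ntight_weight !natrM !natrX natrB // natrX; ring.
rewrite (eE (2 * (n - column mu r.+1) + 2 * m + m').+1%N); last by lia.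
(* This factor of [xi] is a pure power of q; it accounts for the difference in height between the
   two columns receiving a box. *)
have -> : (- t) ^+ m' = (q%:R ^+ m')^-1 by rewrite /t opprK exprVn.
rewrite ![q%:R ^+ _.+1]exprS !exprD; move: t => t'; field.
by rewrite expf_neq0.
Qed.

End ExtensionCount.

From mathcomp Require Import classical_sets cardinality fsbigop ereal topology.
From mathcomp Require Import interval_inference measure sequences charge.

(** * Nilpotent orbits in the unitary Lie algebra *)

Section Secondary.
Variable K : quadField.
Notation bar := (@bar K).
Notation W := (@Wmx K _).

Lemma mulmxW m n (A : 'M[K]_(m, n)) i j : (A *m W) i j = A i (rev_ord j).
Proof.
rewrite mxE (bigD1 (rev_ord j)) //= big1 ?addr0 => [|k kj].
  by rewrite mxE rev_ordK eqxx mulr1.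
by rewrite mxE (_ : j == rev_ord k = false) ?mulr0 //; apply: contra_neqF kj => /eqP ->; rewrite rev_ordK.
Qed.

Lemma mulWmx m n (A : 'M[K]_(m, n)) i j : (W *m A) i j = A (rev_ord i) j.
Proof.
rewrite mxE (bigD1 (rev_ord i)) //= big1 ?addr0 => [|k kj].
  by rewrite mxE eqxx mul1r.
by rewrite mxE (negbTE kj) mul0r.
Qed.

Lemma ctrmxW n : ctrmx (W : 'M_n) = W.
Proof.
apply/matrixP => i j; rewrite !mxE rmorph_nat; congr (_%:R); congr nat_of_bool.
by apply/eqP/eqP => ->; rewrite rev_ordK.
Qed.

Lemma mulWW n : (W : 'M_n) *m W = 1%:M.
Proof. by apply/matrixP => i j; rewrite mulWmx !mxE rev_ordK eq_sym. Qed.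

Lemma unitW n : (W : 'M_n) \in unitmx.
Proof. by have [] := mulmx1_unit (mulWW n). Qed.

Lemma bilinear_eq0 n (A : 'M[K]_n) :
  (forall x y : 'cV_n, (ctrmx y *m A *m x) 0 0 = 0) -> A = 0.
Proof.
move=> h; apply/matrixP => i j; have := h (delta_mx j 0) (delta_mx i 0).
have -> : ctrmx (delta_mx i 0 : 'cV[K]_n) = delta_mx 0 i.
  by apply/matrixP => a b; rewrite !mxE rmorph_nat andbC.
by rewrite -rowE -colE !mxE.
Qed.

(** [tau] acts on column vectors and the chains are made of rows; multiplying by W on both sides
    passes from one condition to the other. *)
Lemma unitary_lieP n (X : 'M[K]_n) : unitary_lie X <-> X *m W = - (W *m ctrmx X).
Proof.
have E x y : tau (X *m x) y + tau x (X *m y) = (ctrmx y *m (W *m X + ctrmx X *m W) *m x) 0 0.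
  by rewrite /tau ctrmxM mulmxDr mulmxDl [RHS]mxE !mulmxA.
split=> [h|h].
  apply/eqP; rewrite -addr_eq0; apply/eqP.
  have -> : X *m W + W *m ctrmx X = W *m (W *m X + ctrmx X *m W) *m W.
    by rewrite mulmxDr mulmxDl !mulmxA mulWW mul1mx -(mulmxA (W *m _)) mulWW mulmx1.
  by rewrite [W *m X + _]bilinear_eq0 ?mulmx0 ?mul0mx // => x y; rewrite -E h.
move=> x y; rewrite E; suff -> : W *m X + ctrmx X *m W = 0 by rewrite mulmx0 mul0mx mxE.
have -> : W *m X = - (ctrmx X *m W).
  rewrite -[W *m X]mulmx1 -mulWW mulmxA -(mulmxA W X) h mulmxN mulNmx mulmxA mulWW mul1mx //.
by rewrite addNr.
Qed.

Lemma unitary_lie_entries n (X : 'M[K]_n) :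
  unitary_lie X <-> forall i j, X (rev_ord j) (rev_ord i) = - bar (X i j).
Proof.
rewrite unitary_lieP; split=> [/matrixP h i j|h].
  by have := h (rev_ord j) i; rewrite mulmxW mxE mulWmx rev_ordK !mxE.
apply/matrixP => i j; rewrite mulmxW mxE mulWmx !mxE -h rev_ordK //.
Qed.

Definition jtype n (A : 'M[K]_n) : seq nat := xget [::] [set la | jordan_type A la]%classic.

Lemma jtypeE n (A : 'M[K]_n) la : jordan_type A la -> jtype A = la.
Proof.
move=> h; rewrite /jtype; case: xgetP => [mu _ hmu|/(_ la)//].
exact: jordan_type_uniq hmu h.
Qed.

Lemma jtypeP n (A : 'M[K]_n) : unitary_lie A -> nilpotent_mx A -> jordan_type A (jtype A).
Proof.
move=> /unitary_lieP uA nA; have [e e0 be] := exists_skew K.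
have [la /chain_type_jordan h] := chain_type_exists e0 be (ctrmxW n) (unitW n) uA nA.
by rewrite (jtypeE h).
Qed.

Lemma jtype_conj m n (A : 'M[K]_m) (B : 'M[K]_n) (P : 'M_(n, m)) (Q : 'M_(m, n)) la :
  P *m Q = 1%:M -> Q *m P = 1%:M -> P *m A = B *m P ->
  jordan_type A la -> jordan_type B la.
Proof.
move=> PQ QP PA [pla [S [fS uS SA]]]; split=> //.
exists (S *m Q); split.
- by rewrite /row_free mxrankMfree ?(eqP fS) //; apply/row_freeP; exists P.
- have /row_fullP[D DS] := uS; apply/row_fullP; exists (P *m D).
  by rewrite -mulmxA (mulmxA D) DS mul1mx.
- rewrite -mulmxA; have -> : Q *m B = A *m Q.
    by rewrite -[LHS]mulmx1 -PQ -!mulmxA (mulmxA B) -PA -mulmxA mulmxA QP mul1mx.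
  by rewrite (mulmxA S) SA -mulmxA.
Qed.

End Secondary.

Section Borders.
Variable K : quadField.
Notation bar := (@bar K).
Notation W := (@Wmx K _).

(** Entries are compared through natural numbers, so that two consecutive sizes [dimN o n] and
    [dimN o n.+1] can be related without a cast. *)
Definition borders n n' (X : 'M[K]_n) (Y : 'M[K]_n') : Prop :=
  [/\ forall (i j : 'I_n') (i0 j0 : 'I_n), i = i0.+1 :> nat -> j = j0.+1 :> nat -> Y i j = X i0 j0,
      forall i j : 'I_n', (i == n.+1 :> nat) || (j == 0%N :> nat) -> Y i j = 0 &
      unitary_lie Y].

Definition first_ord n : 'I_(1 + (n + 1)) := lshift (n + 1) ord0.
Definition mid_ord n (i : 'I_n) : 'I_(1 + (n + 1)) := rshift 1 (lshift 1 i).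
Definition last_ord n : 'I_(1 + (n + 1)) := rshift 1 (rshift n ord0).

Variant ord_spec n : 'I_(1 + (n + 1)) -> Prop :=
| FirstOrd : ord_spec (first_ord n)
| MidOrd i : ord_spec (mid_ord i)
| LastOrd : ord_spec (last_ord n).

Lemma ordP n (i : 'I_(1 + (n + 1))) : ord_spec i.
Proof.
case: (split_ordP i) => [j|j] ->; first by rewrite ord1; exact: FirstOrd.
by case: (split_ordP j) => [k|k] ->; [exact: MidOrd|rewrite ord1; exact: LastOrd].
Qed.

Lemma rev_first n : rev_ord (first_ord n) = last_ord n.
Proof. by apply: val_inj => /=; lia. Qed.

Lemma rev_last n : rev_ord (last_ord n) = first_ord n.
Proof. by apply: val_inj => /=; lia. Qed.

Lemma rev_mid n (i : 'I_n) : rev_ord (mid_ord i) = mid_ord (rev_ord i).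
Proof. by apply: val_inj => /=; have := ltn_ord i; lia. Qed.

Lemma ext_mxE n (X : 'M[K]_n) w c :
  [/\ ext_mx W X w c (first_ord n) (last_ord n) = c,
      forall j, ext_mx W X w c (first_ord n) (mid_ord j) = w 0 j,
      forall i j, ext_mx W X w c (mid_ord i) (mid_ord j) = X i j,
      forall i, ext_mx W X w c (mid_ord i) (last_ord n) = - bar (w 0 (rev_ord i)) &
      (forall i, ext_mx W X w c i (first_ord n) = 0) /\
      (forall j, ext_mx W X w c (last_ord n) j = 0)].
Proof.
rewrite /ext_mx /first_ord /mid_ord /last_ord; split=> [|j|i j|i|].
- by rewrite block_mxEur row_mxEr mxE eqxx.
- by rewrite block_mxEur row_mxEl.
- by rewrite block_mxEdr block_mxEul.
- by rewrite block_mxEdr block_mxEur mxE mulWmx !mxE.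
split=> i; case: (split_ordP i) => j ->.
- by rewrite block_mxEul mxE.
- by rewrite block_mxEdl mxE.
- by rewrite block_mxEdl mxE.
- rewrite block_mxEdr; case: (split_ordP j) => k ->; first by rewrite block_mxEdl mxE.
  by rewrite block_mxEdr mxE.
Qed.

Lemma bordersP n (X : 'M[K]_n) (Y : 'M[K]_(1 + (n + 1))) : unitary_lie X ->
  borders X Y <-> exists2 p : 'rV_n * K, bar p.2 = - p.2 & Y = ext_mx W X p.1 p.2.
Proof.
move=> uX; split=> [[h1 h2 /unitary_lie_entries h3]|[[w c] /= bc ->]].
  pose w := \row_(j < n) Y (first_ord n) (mid_ord j).
  exists (w, Y (first_ord n) (last_ord n)) => /=.
    by have := h3 (first_ord n) (last_ord n); rewrite rev_first rev_last => E; rewrite {2}E opprK.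
  set c := Y _ _; have [e1 e2 e3 e4 [e5 e6]] := ext_mxE X w c.
  apply/matrixP => i j; case: (ordP i) => [|i0|]; last by rewrite e6 h2 //= addn0 eqxx.
    case: (ordP j) => [|j0|]; [by rewrite e5 h2 //= orbT|by rewrite e2 mxE|by rewrite e1].
  case: (ordP j) => [|j0|]; [by rewrite e5 h2 //= orbT|by rewrite e3; apply: h1|].
  rewrite e4 mxE; have := h3 (first_ord n) (mid_ord (rev_ord i0)).
  by rewrite rev_first rev_mid rev_ordK.
have [e1 e2 e3 e4 [e5 e6]] := ext_mxE X w c.
split=> [i j i0 j0 hi hj|i j|].
- have -> : i = mid_ord i0 by apply: val_inj.
  by have -> : j = mid_ord j0 by apply: val_inj.
- case/orP => /eqP h.
    by have -> : i = last_ord n by apply: val_inj; rewrite /= h /= addn0.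
  by have -> : j = first_ord n by apply: val_inj.
apply/unitary_lie_entries => i j; have /unitary_lie_entries uX' := uX.
case: (ordP i) => [|i0|]; case: (ordP j) => [|j0|];
  rewrite ?rev_first ?rev_last ?rev_mid ?(e5, e6) ?rmorph0 ?oppr0 //.
- by rewrite e4 e2 rev_ordK.
- by rewrite e1 bc opprK.
- by rewrite !e3 uX'.
- by rewrite e2 e4 rmorphN /= barK opprK.
Qed.

Lemma ext_mx_inj n (X : 'M[K]_n) : injective (fun p : 'rV_n * K => ext_mx W X p.1 p.2).
Proof.
move=> [w c] [w' c'] /= E.
have [e1 e2 _ _ _] := ext_mxE X w c; have [e1' e2' _ _ _] := ext_mxE X w' c'.
by rewrite -e1 E e1'; congr pair; apply/rowP => j; rewrite -e2 E e2'.
Qed.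

Lemma ext_mx_nilpotent n (X : 'M[K]_n) w c :
  nilpotent_mx (ext_mx W X w c) <-> nilpotent_mx X.
Proof.
split=> [[k kE]|[k kE]].
  have : ext_mx W X w c ^+ k.+1 = 0 by rewrite expmxS kE mulmx0.
  move/eqP; rewrite ext_mx_exp block_mx_eq0 => /and4P[_ _ _].
  by rewrite block_mx_eq0 => /and4P[/eqP h _ _ _]; exists k.+1.
exists k.+2; rewrite ext_mx_exp !expmxS kE !(mulmx0, mul0mx, oppr0) row_mx0.
by rewrite !block_mx0.
Qed.

End Borders.

Section Branching.
Variables (R : realType) (K : quadField).
Notation bar := (@bar K).
Notation q := (qq K).
Notation W := (@Wmx K _).
Let t : R := - (q%:R)^-1.

Definition weight (N : nat) (la : seq nat) : R :=
  (q%:R : R) ^ ((npart la)%:Z - ((N * N.-1)./2)%:Z).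

Lemma weight_gt0 N la : 0 < weight N la.
Proof. by rewrite exprz_gt0 // ltr0n qq_gt0. Qed.

Lemma borders_nilpotent n n' (X : 'M[K]_n) (Y : 'M[K]_n') : n' = (1 + (n + 1))%N ->
  unitary_lie X -> borders X Y -> nilpotent_mx Y <-> nilpotent_mx X.
Proof.
by move=> e uX; subst n' => /(bordersP Y uX)[[w c] /= _ ->]; exact: ext_mx_nilpotent.
Qed.

Lemma borders_edge n n' (X : 'M[K]_n) (Y : 'M[K]_n') : n' = (1 + (n + 1))%N ->
  unitary_lie X -> nilpotent_mx X -> borders X Y -> edge (jtype X) (jtype Y).
Proof.
move=> e uX nX; subst n' => bXY; have tX := jtypeP uX nX.
have uY : unitary_lie Y by case: bXY.
have nY : nilpotent_mx Y by apply/(borders_nilpotent _ uX bXY).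
have tY := jtypeP uY nY.
have /(bordersP Y uX)[p _ YE] := bXY; rewrite YE in tY *.
have [k fk] := exists_first_reach tX p.1.
have /unitary_lieP hX := uX.
have st := ext_edge_step (ctrmxW K n) (unitW K n) hX tX tY fk.
have [] := edge_of_step _ _ _ _ _ st => //.
- by case: tX.
- by case: tY.
- by rewrite (sumn_jordan_type tX) (sumn_jordan_type tY); lia.
- by rewrite /ext_edge; case: ifP => _; rewrite eqxx ?orbT.
Qed.

Lemma card_borders n n' (X : 'M[K]_n) la : n' = (1 + (n + 1))%N ->
  unitary_lie X -> nilpotent_mx X -> is_partition la -> edge (jtype X) la ->
  (#|[set Y : 'M[K]_n' | `[< borders X Y >] && (jtype Y == la)]|)%:R * weight n' la =
  weight n (jtype X) * xi t (jtype X) la.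
Proof.
move=> e uX nX pla ed; subst n'; have tX := jtypeP uX nX; set mu := jtype X in ed tX *.
have /unitary_lieP hX := uX; have pmu : is_partition mu by case: tX.
have [k [l [sk k0 kl st]]] := edge_stepP pmu pla ed.
case: k k0 sk kl st => // k _ sk kl st.
have -> : #|[set Y : 'M[K]_(1 + (n + 1)) | `[< borders X Y >] && (jtype Y == la)]| =
  #|[set p : 'rV_n * K | [&& bar p.2 == - p.2, first_reach X k p.1 &
       tight W X k p == (l == k.+1)]]|.
  rewrite -[RHS](card_imset _ (@ext_mx_inj _ _ X)); apply: eq_card => Y; rewrite inE.
  have P p : bar p.2 = - p.2 -> jtype (ext_mx W X p.1 p.2) == la <->
      first_reach X k p.1 && (tight W X k p == (l == k.+1)).
    move=> bp; have bX : borders X (ext_mx W X p.1 p.2) by apply/(bordersP _ uX); exists p.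
    have uY : unitary_lie (ext_mx W X p.1 p.2) by case: bX.
    have tY := jtypeP uY (proj2 (ext_mx_nilpotent X p.1 p.2) nX).
    rewrite -(jordan_type_ext (ctrmxW K n) (unitW K n) hX tX pla tY st kl).
    by split=> [/eqP <-//|/jtypeE ->].
  apply/andP/imsetP => [[/asboolP/(bordersP Y uX)[p bp ->] /(P p bp) h]|[p]].
    by exists p; rewrite ?inE ?bp ?eqxx.
  rewrite inE => /andP[/eqP bp /(P p bp) h] ->; split=> //.
  by apply/asboolP/(bordersP _ uX); exists p.
rewrite (card_ext_edge R (ctrmxW K n) (unitW K n) hX tX pla ed sk) -/t mulrAC.
congr (_ * _); rewrite /weight.
have q0 : (q%:R : R) != 0 by rewrite pnatr_eq0 -lt0n qq_gt0.
rewrite -expfzDr //; congr (_ ^ _).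
(* From N to N + 2 the number N(N-1)/2 grows by 2N + 1, the exponent in [card_ext_edge]. *)
have -> : ((1 + (n + 1)) * (1 + (n + 1)).-1 = n * n.-1 + (2 * n).+1.*2)%N by nia.
by rewrite halfD odd_double andbF doubleK; lia.
Qed.

End Branching.

Section UnitaryOrbits.
Variable K : quadField.
Notation bar := (@bar K).
Notation W := (@Wmx K _).

Lemma unitaryP n (A : 'M[K]_n) : unitary A <-> A *m (W *m ctrmx A *m W) = 1%:M.
Proof.
have E : (A *m (W *m ctrmx A *m W) = 1%:M) <-> (ctrmx A *m W *m A = W).
  split=> [/mulmx1C|] h.
    by rewrite -[LHS]mul1mx -mulWW -!mulmxA (mulmxA W (ctrmx A)) (mulmxA _ W A) h mulmx1.
  by apply: mulmx1C; rewrite -!mulmxA (mulmxA (ctrmx A)) h mulWW.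
rewrite E; split=> [[_ h]|h].
  apply/eqP; rewrite -subr_eq0; apply/eqP; apply: bilinear_eq0 => x y.
  rewrite mulmxBr mulmxBl mxE [X in _ + X]mxE.
  by have := h x y; rewrite /tau ctrmxM !mulmxA => ->; rewrite subrr.
split; first by have [] := mulmx1_unit (proj2 E h).
move=> x y; rewrite /tau ctrmxM.
have -> : ctrmx y *m ctrmx A *m W *m (A *m x) = ctrmx y *m (ctrmx A *m W *m A) *m x.
  by rewrite !mulmxA.
by rewrite h.
Qed.

Lemma unitary_conj n (X X' : 'M[K]_n) la : unitary_lie X -> unitary_lie X' ->
  jordan_type X la -> jordan_type X' la ->
  exists2 A : 'M_n, unitary A & A *m X = X' *m A.
Proof.
move=> /unitary_lieP uX /unitary_lieP uX' tX tX'; have [e e0 be] := exists_skew K.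
have [A [Au AX AW]] := jordan_type_isometry e0 be (ctrmxW K n) (unitW K n) uX uX' tX tX'.
exists A => //; apply/unitaryP.
by rewrite !mulmxA AW mulWW.
Qed.

Lemma unitary_lie_jordan n la : is_partition la -> sumn la = n ->
  exists X : 'M[K]_n, [/\ unitary_lie X, nilpotent_mx X & jordan_type X la].
Proof.
move=> pla sla; have [e e0 be] := exists_skew K.
have [X uX tX] := jordan_type_exists e0 be (ctrmxW K n) (unitW K n) pla sla.
exists X; split=> //; first exact/unitary_lieP.
by exists n; exact: nilpotent_jordan_type tX.
Qed.

End UnitaryOrbits.

Section HarmonicSum.
Variables (R : realType) (K : quadField) (o : bool).
Notation q := (qq K).
Let t : R := - (q%:R)^-1.

(** Extension by 0 to arbitrary sequences, so that it applies to [jtype Y] for every matrix Y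
    without a proof that this is a vertex. *)
Definition on_seq (phi : vertex o -> R) (la : seq nat) : R :=
  oapp phi 0 (insub la : option {la : seq nat | is_partition la && (odd (sumn la) == o)}).

Lemma on_seqE phi (la : vertex o) : on_seq phi (val la) = phi la.
Proof. by rewrite /on_seq valK. Qed.

Lemma sum_borders n n' (X : 'M[K]_n) (phi : vertex o -> R) : n' = (1 + (n + 1))%N ->
  odd n' = o -> unitary_lie X -> nilpotent_mx X ->
  \sum_(Y : 'M[K]_n' | `[< borders X Y >]) weight R K n' (jtype Y) * on_seq phi (jtype Y) =
  weight R K n (jtype X) *
    \sum_(la \in [set la : vertex o | edge (jtype X) (val la)]%classic)
      xi t (jtype X) (val la) * phi la.
Proof.
move=> e on uX nX.
have tY (Y : 'M[K]_n') : borders X Y -> jordan_type Y (jtype Y).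
  move=> bXY; apply: jtypeP; first by case: bXY.
  exact/(borders_nilpotent e uX bXY).
pose s := [seq jtype Y | Y <- enum [pred Y : 'M[K]_n' | `[< borders X Y >]]].
pose r : seq (vertex o) := undup (pmap insub s).
have rP (v : vertex o) : (v \in r) = (val v \in s).
  by rewrite mem_undup mem_pmap_sub.
have vP (Y : 'M[K]_n') : borders X Y -> exists2 v : vertex o, v \in r & val v = jtype Y.
  move=> bXY; have hv : is_partition (jtype Y) && (odd (sumn (jtype Y)) == o).
    by case: (tY _ bXY) => -> _; rewrite (sumn_jordan_type (tY _ bXY)) on eqxx.
  pose v : vertex o := exist (fun la => is_partition la && (odd (sumn la) == o) : Prop) _ hv.
  exists v => //; rewrite rP /=.
  by apply/mapP; exists Y => //; rewrite mem_enum inE.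
have LE (Y : 'M[K]_n') : borders X Y -> weight R K n' (jtype Y) * on_seq phi (jtype Y) =
    \sum_(v <- r) (if jtype Y == val v then weight R K n' (val v) * phi v else 0).
  move=> bXY; have [v vr vE] := vP Y bXY.
  rewrite -vE on_seqE (bigD1_seq v) ?undup_uniq //= eqxx big1 ?addr0 // => w wv.
  by rewrite (inj_eq val_inj) eq_sym (negbTE wv).
rewrite (eq_bigr (fun Y => \sum_(v <- r) (if jtype Y == val v then weight R K n' (val v) * phi v else 0)));
  last by move=> Y /asboolP; exact: LE.
rewrite exchange_big /= (fsbigE r) ?undup_uniq //; last 2 first.
- move=> v /=; rewrite rP => /mapP[Y]; rewrite mem_enum inE => bXY ->.
  exact: borders_edge bXY.
(* An edge whose end is the type of no border has coefficient 0, by the count itself; this reduces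
   the sum over edges to a finite list. *)
- move=> v /= ev nvr; have pv : is_partition (val v) by case/andP: (valP v).
  have := card_borders R e uX nX pv ev; rewrite (_ : #|_| = 0%N).
    rewrite mul0r => /esym/eqP; rewrite mulf_eq0 gt_eqF ?weight_gt0 //= => /eqP ->.
    by rewrite mul0r.
  apply: eq_card0 => Y; rewrite !inE; apply/negP => /andP[/asboolP bXY /eqP jY].
  case/negP: nvr; rewrite rP -jY; apply/mapP; exists Y => //.
  by rewrite mem_enum inE.
rewrite mulr_sumr big_seq [RHS]big_seq_cond.
apply: congr_big => // [v|v vr].
  by rewrite andb_idr // => vr; rewrite inE /=; move: vr; rewrite rP => /mapP[Y];
    rewrite mem_enum inE => bXY ->; exact: borders_edge bXY.
have pv : is_partition (val v) by case/andP: (valP v).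
have ev : edge (jtype X) (val v).
  by move: vr; rewrite rP => /mapP[Y]; rewrite mem_enum inE => bXY ->; exact: borders_edge bXY.
rewrite mulrA -(card_borders R e uX nX pv ev) -mulrA -big_mkcondr /=.
rewrite (eq_bigl (fun Y => Y \in [set Y : 'M[K]_n' | `[< borders X Y >] && (jtype Y == val v)])).
  by rewrite sumr_const mulr_natl.
by move=> Y; rewrite inE.
Qed.

End HarmonicSum.

Local Open Scope classical_set_scope.
Local Open Scope ring_scope.

(** * Infinite matrices and the unitary action *)

Section IndexValues.

Lemma idx_val_le (o : bool) n k l : (idx_val o n k <= idx_val o n l) = (k <= l)%N.
Proof. by rewrite /idx_val; case: o => /=; [lia|case: (ltnP k n); case: (ltnP l n); lia]. Qed.

Lemma idx_val_bound (o : bool) n k : (k < dimN o n)%N -> (`|idx_val o n k|%N <= n)%N.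
Proof. by rewrite /idx_val /dimN; case: o => /=; [lia|case: (ltnP k n); lia]. Qed.

Lemma idx_val_surj (o : bool) n (z : int) : o || (z != 0) -> (`|z|%N <= n)%N ->
  exists2 k, (k < dimN o n)%N & idx_val o n k = z.
Proof.
rewrite /idx_val /dimN; case: o => /= z0 zn.
  by exists (absz (z + n%:Z)); lia.
case: (ltrP z 0) => h.
  by exists (absz (z + n%:Z)); [lia|rewrite ifT; lia].
by exists (absz (z + n%:Z)).-1; [lia|rewrite ifF; lia].
Qed.

Lemma idx_val_rev (o : bool) n k : (k < dimN o n)%N ->
  - idx_val o n k = idx_val o n (dimN o n - k.+1).
Proof.
by rewrite /idx_val /dimN; case: o => /=; [lia|case: (ltnP k n); case: (ltnP (_ - _) n); lia].
Qed.

Lemma idx_valS (o : bool) n k : idx_val o n.+1 k.+1 = idx_val o n k.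
Proof. by rewrite /idx_val; case: o => /=; [lia|case: (ltnP k n); case: (ltnP k.+1 n.+1); lia]. Qed.

Lemma idx_val_edge (o : bool) n k : (k < dimN o n.+1)%N ->
  ((k == (dimN o n).+1) || (k == 0)) = ~~ (`|idx_val o n.+1 k|%N <= n)%N.
Proof. by rewrite /idx_val /dimN; case: o => /=; [lia|case: (ltnP k n.+1); lia]. Qed.

End IndexValues.

Section Index.
Variables (K : quadField) (o : bool).
Notation bar := (@bar K).
Notation W := (@Wmx K _).
Notation idx := (idx o).
Notation imx := (imx K o).
Notation dimN := (dimN o).
Implicit Types (i j : idx) (M : imx).

Lemma dimNS n : dimN n.+1 = (1 + (dimN n + 1))%N.
Proof. by rewrite /Defs.dimN; lia. Qed.

Definition inside n i := (`|val i|%N <= n)%N.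

Lemma outsideE n i j : outside n i j = ~~ (inside n i && inside n j).
Proof. by rewrite /outside /inside leq_max negb_and -!ltnNge; lia. Qed.

Lemma idx_of_inj n : injective (@idx_of o n).
Proof.
move=> k l /(congr1 val) /= h; apply: val_inj; apply/eqP.
by rewrite eqn_leq -!(idx_val_le o n) h lexx.
Qed.

Lemma idx_of_inside n k : inside n (@idx_of o n k).
Proof.
exact/idx_val_bound/ltn_ord.
Qed.

Lemma insideP n i : inside n i -> exists k, i = @idx_of o n k.
Proof.
case: i => z hz; rewrite /inside /= => zn.
have [k kn kz] := idx_val_surj hz zn.
by exists (Ordinal kn); apply: val_inj.
Qed.

Lemma idx_of_opp n k : idx_opp (@idx_of o n k) = idx_of (rev_ord k).
Proof.
by apply: val_inj; rewrite /= idx_val_rev.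
Qed.

Lemma idx_oppK i : idx_opp (idx_opp i) = i.
Proof. by apply: val_inj => /=; rewrite opprK. Qed.

Lemma inside_opp n i : inside n (idx_opp i) = inside n i.
Proof. by rewrite /inside /= abszN. Qed.

Lemma idx_of_le n k l : (val (@idx_of o n k) <= val (@idx_of o n l)) = (k <= l)%N.
Proof.
exact: idx_val_le.
Qed.

Lemma idx_ofS n (k : 'I_(dimN n)) (k' : 'I_(dimN n.+1)) : k' = k.+1 :> nat ->
  idx_of k' = idx_of k.
Proof.
by move=> e; apply: val_inj; rewrite /= e idx_valS.
Qed.

Lemma inside_le m n i : (m <= n)%N -> inside m i -> inside n i.
Proof. by move=> mn im; exact: leq_trans mn. Qed.

Lemma exists_inside i j : exists n, inside n i && inside n j.
Proof. by exists (maxn `|val i| `|val j|)%N; rewrite /inside leq_maxl leq_maxr. Qed.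

Lemma not_inside_edge n (k : 'I_(dimN n.+1)) :
  ((k == (dimN n).+1 :> nat) || (k == 0%N :> nat)) = ~~ inside n (idx_of k).
Proof.
exact/idx_val_edge/ltn_ord.
Qed.

Lemma imx_eq_ge N M M' : (forall n, (N <= n)%N -> block n M = block n M') -> M = M'.
Proof.
move=> h; apply/funext => i; apply/funext => j.
have [n /andP[ni nj]] := exists_inside i j.
have [k ->] := insideP (inside_le (leq_maxr N n) ni).
have [l ->] := insideP (inside_le (leq_maxr N n) nj).
by have /matrixP/(_ k l) := h (maxn N n) (leq_maxl _ _); rewrite !mxE.
Qed.

Lemma block_le m n M M' : (m <= n)%N -> block n M = block n M' -> block m M = block m M'.
Proof.
move=> mn /matrixP h; apply/matrixP => k l; rewrite !mxE.
have [k' ->] := insideP (inside_le mn (idx_of_inside k)).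
have [l' ->] := insideP (inside_le mn (idx_of_inside l)).
by have := h k' l'; rewrite !mxE.
Qed.

Lemma Llevel_skew n M n' : Llevel n M -> unitary_lie (block n' M).
Proof.
move=> [_ h]; apply/unitary_lie_entries => k l.
by rewrite !mxE -!idx_of_opp h.
Qed.

Lemma Llevel_borders n M : Llevel n M -> borders (block n M) (block n.+1 M).
Proof.
move=> hM; split; last exact: Llevel_skew hM.
  by move=> i j i0 j0 hi hj; rewrite !mxE (idx_ofS hi) (idx_ofS hj).
case: hM => h _ k l; rewrite mxE.
have kl : ((k == (dimN n).+1 :> nat) || (l == 0%N :> nat)) -> val (idx_of l) <= val (idx_of k).
  by rewrite idx_of_le; have := ltn_ord k; have := ltn_ord l; have := dimNS n; lia.
move=> e; apply: h (kl e) _; rewrite outsideE negb_and -!not_inside_edge.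
by case/orP: e => ->; rewrite ?orbT.
Qed.

Lemma borders_Llevel n M (X : 'M_(dimN n)) : Llevel n.+1 M -> borders X (block n.+1 M) ->
  Llevel n M /\ block n M = X.
Proof.
move=> hM [h1 h2 _]; split; last first.
  apply/matrixP => k l; have kl (x : 'I_(dimN n)) : (x.+1 < dimN n.+1)%N.
    by rewrite dimNS; have := ltn_ord x; lia.
  have := h1 (Ordinal (kl k)) (Ordinal (kl l)) k l erefl erefl; rewrite !mxE => <-.
  by rewrite (@idx_ofS n k) // (@idx_ofS n l).
case: hM => h hs; split=> // i j ji; rewrite outsideE => nij.
have [/andP[/insideP[k kE] /insideP[l lE]]|nij'] := boolP (inside n.+1 i && inside n.+1 j); last first.
  by apply: h; rewrite ?outsideE.
move: ji nij; rewrite kE lE idx_of_le => lk; rewrite negb_and -!not_inside_edge => e.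
have := h2 k l; rewrite mxE; apply.
by move: e lk; have := ltn_ord k; have := ltn_ord l; have := dimNS n; lia.
Qed.

(** Once M has level n + 1, level n only asks in addition for a zero first column and a zero last
    row in the next block. *)
Lemma Cyl_step n (X : 'M[K]_(dimN n)) (M : Lspace K o) :
  Cyl X M <-> Llevel n.+1 M /\ borders X (block n.+1 M).
Proof.
split=> [[hM <-]|[hM bM]].
  by split; [exact: Llevel_le hM|exact: Llevel_borders].
exact: borders_Llevel.
Qed.

Definition zext n (Y : 'M[K]_(dimN n)) : imx := fun i j =>
  if [pick k | @idx_of o n k == i] is Some k then
    if [pick l | @idx_of o n l == j] is Some l then Y k l else 0
  else 0.

Lemma pick_idx n k : [pick l | @idx_of o n l == idx_of k] = Some k.
Proof.
case: pickP => [l /eqP/idx_of_inj ->//|/(_ k)]; by rewrite eqxx.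
Qed.

Lemma pick_out n i : ~~ inside n i -> [pick l | @idx_of o n l == i] = None.
Proof.
by move=> ni; case: pickP => // l /eqP E; rewrite -E idx_of_inside in ni.
Qed.

Lemma block_zext n (Y : 'M_(dimN n)) : block n (zext Y) = Y.
Proof. by apply/matrixP => k l; rewrite mxE /zext !pick_idx. Qed.

Lemma zext_out n (Y : 'M_(dimN n)) i j : outside n i j -> zext Y i j = 0.
Proof.
rewrite outsideE negb_and /zext; have [|ni] := boolP (inside n i).
  by case: pickP => // k _ _ /= /pick_out ->.
by rewrite pick_out.
Qed.

Lemma Llevel_zext n (Y : 'M_(dimN n)) : unitary_lie Y -> Llevel n (zext Y).
Proof.
move=> /unitary_lie_entries uY; split; first by move=> i j _; exact: zext_out.
move=> a b; have [/andP[/insideP[k ->] /insideP[l ->]]|nab] := boolP (inside n a && inside n b).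
  by rewrite !idx_of_opp /zext !pick_idx uY.
rewrite !zext_out ?outsideE ?inside_opp // ?bar0 ?oppr0 //.
by rewrite andbC.
Qed.

Lemma zext_Lset n (Y : 'M_(dimN n)) : unitary_lie Y -> zext Y \in @Lpred K o.
Proof. by move=> uY; rewrite inE; exists n => //; exact: Llevel_zext. Qed.

Lemma Cyl_nonempty n (Y : 'M_(dimN n)) : unitary_lie Y -> exists M : Lspace K o, Cyl Y M.
Proof.
move=> uY; exists (MkLspace (zext_Lset uY)); split; first exact: Llevel_zext.
exact: block_zext.
Qed.

Lemma Lspace_level (M : Lspace K o) : exists n, Llevel n M.
Proof. by have := LmxP M; rewrite inE => -[n _ h]; exists n. Qed.

Lemma Lspace_inj (M M' : Lspace K o) : Lmx M = Lmx M' -> M = M'.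
Proof. by move=> e; apply: val_inj. Qed.

End Index.

Section Action.
Variables (K : quadField) (o : bool).
Notation bar := (@bar K).
Notation W := (@Wmx K _).
Notation idx := (idx o).
Notation imx := (imx K o).
Notation iid := (@iid K o).
Notation dimN := (dimN o).
Notation Lspace := (Lspace K o).
Implicit Types (i j : idx) (g h : imx).

Definition diag_out m g := forall i j, outside m i j -> g i j = iid i j.

Lemma diag_out_le m n g : (m <= n)%N -> diag_out m g -> diag_out n g.
Proof.
by move=> mn hg i j ij; apply: hg; apply: leq_ltn_trans ij.
Qed.

Lemma imul_left m g (M : imx) i j : diag_out m g ->
  imul g M i j = if inside m i then \sum_(k < dimN m) g i (idx_of k) * M (idx_of k) j
                 else M i j.
Proof.
move=> hg; rewrite /imul; case: ifPn => mi.
  rewrite (fsbigE [seq idx_of k | k <- enum 'I_(dimN m)]) //.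
  - rewrite big_map big_enum_cond; apply: eq_bigl => k.
    by rewrite /= in_setT.
  - by rewrite map_inj_uniq ?enum_uniq //; exact: idx_of_inj.
  move=> k _ /= nk; rewrite hg; last first.
    rewrite outsideE negb_and; apply/orP; right; apply/negP => /insideP[l lE].
    by case/negP: nk; rewrite lE map_f // mem_enum.
  rewrite /Defs.iid; case: eqP => [ik|_]; last by rewrite mul0r.
  by case/negP: nk; case/insideP: mi => l lE; rewrite -ik lE map_f // mem_enum.
rewrite (fsbigE [:: i]) //=.
  rewrite big_seq_cond; under eq_bigl => k do rewrite in_setT andbT.
  rewrite -big_seq big_seq1 hg ?outsideE ?(negbTE mi) // /Defs.iid eqxx mul1r //.
move=> k _; rewrite inE => ki; rewrite hg ?outsideE ?(negbTE mi) // /Defs.iid.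
by rewrite eq_sym (negbTE ki) mul0r.
Qed.

Lemma imul_right m (M : imx) h i j : diag_out m h ->
  imul M h i j = if inside m j then \sum_(k < dimN m) M i (idx_of k) * h (idx_of k) j
                 else M i j.
Proof.
move=> hh; rewrite /imul; case: ifPn => mj.
  rewrite (fsbigE [seq idx_of k | k <- enum 'I_(dimN m)]) //.
  - rewrite big_map big_enum_cond; apply: eq_bigl => k.
    by rewrite /= in_setT.
  - by rewrite map_inj_uniq ?enum_uniq //; exact: idx_of_inj.
  move=> k _ /= nk; rewrite hh; last first.
    rewrite outsideE negb_and; apply/orP; left; apply/negP => /insideP[l lE].
    by case/negP: nk; rewrite lE map_f // mem_enum.
  rewrite /Defs.iid; case: eqP => [kj|_]; last by rewrite mulr0.
  by case/negP: nk; case/insideP: mj => l lE; rewrite kj lE map_f // mem_enum.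
rewrite (fsbigE [:: j]) //=.
  rewrite big_seq_cond; under eq_bigl => k do rewrite in_setT andbT.
  rewrite -big_seq big_seq1 hh ?outsideE ?(negbTE mj) ?andbF // /Defs.iid eqxx mulr1 //.
move=> k _; rewrite inE => kj; rewrite hh ?outsideE ?(negbTE mj) ?andbF // /Defs.iid.
by rewrite (negbTE kj) mulr0.
Qed.

Lemma block_iid n : block n iid = 1%:M.
Proof.
by apply/matrixP => k l; rewrite !mxE /Defs.iid (inj_eq (@idx_of_inj o n)).
Qed.

Lemma block_imul_left m n g (M : imx) : diag_out m g -> (m <= n)%N ->
  block n (imul g M) = block n g *m block n M.
Proof.
move=> hg mn; apply/matrixP => k l; rewrite !mxE.
rewrite (imul_left _ _ _ (diag_out_le mn hg)) idx_of_inside.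
by apply: eq_bigr => x _; rewrite !mxE.
Qed.

Lemma block_imul_right m n (M : imx) h : diag_out m h -> (m <= n)%N ->
  block n (imul M h) = block n M *m block n h.
Proof.
move=> hh mn; apply/matrixP => k l; rewrite !mxE.
rewrite (imul_right _ _ _ (diag_out_le mn hh)) idx_of_inside.
by apply: eq_bigr => x _; rewrite !mxE.
Qed.

Lemma idx_of_neq m (k : 'I_(dimN m)) i : ~~ inside m i -> (idx_of k == i) = false.
Proof. by move=> mi; apply/negbTE; apply: contra mi => /eqP <-; exact: (@idx_of_inside o m). Qed.

Lemma diag_out_imul m g h : diag_out m g -> diag_out m h -> diag_out m (imul g h).
Proof.
move=> hg hh i j ij; rewrite (imul_left _ _ _ hg); case: ifPn => mi; last exact: hh.
have mj : ~~ inside m j by move: ij; rewrite outsideE mi.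
rewrite big1 => [|k _]; last first.
  by rewrite hh ?outsideE ?(negbTE mj) ?andbF // /Defs.iid idx_of_neq // mulr0.
by case/insideP: mi => k ->; rewrite /Defs.iid idx_of_neq.
Qed.

Lemma block1_out m g : diag_out m g -> block m g = 1%:M -> g = iid.
Proof.
move=> hg bg; apply/funext => i; apply/funext => j.
have [|nij] := boolP (inside m i && inside m j); last by rewrite hg ?outsideE.
case/andP => /insideP[k ->] /insideP[l ->].
have /matrixP/(_ k l) := bg; rewrite !mxE => ->.
by rewrite /Defs.iid (inj_eq (@idx_of_inj o m)).
Qed.

(* The inverse [W g^* W] of a unitary [g], with [W] acting by negation of indices. *)
Definition hadj g : imx := fun i j => bar (g (idx_opp j) (idx_opp i)).

Lemma hadjK : involutive hadj.
Proof.
by move=> g; apply/funext => i; apply/funext => j; rewrite /hadj !idx_oppK barK.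
Qed.

Lemma block_hadj n g : block n (hadj g) = W *m ctrmx (block n g) *m W.
Proof.
by apply/matrixP => k l; rewrite mulmxW mulWmx !mxE -!idx_of_opp.
Qed.

Lemma diag_out_hadj m g : diag_out m g -> diag_out m (hadj g).
Proof.
move=> hg i j ij; rewrite /hadj hg; last first.
  by move: ij; rewrite !outsideE !inside_opp andbC.
rewrite /Defs.iid rmorph_nat; congr (_%:R); congr nat_of_bool.
by apply/eqP/eqP => [/(congr1 (@idx_opp o))|->//]; rewrite !idx_oppK.
Qed.

Lemma Ulevel_diag m g : Ulevel m g -> diag_out m g.
Proof. by case. Qed.

Lemma imul_hadj m g : Ulevel m g -> imul g (hadj g) = iid.
Proof.
move=> [/unitaryP ug hg]; apply: (@block1_out m).
  by apply: diag_out_imul => //; exact: diag_out_hadj.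
by rewrite (block_imul_left _ hg) // block_hadj.
Qed.

Lemma Ulevel_le m n g : (m <= n)%N -> Ulevel m g -> Ulevel n g.
Proof.
move=> mn Ug; split; last exact: diag_out_le (Ulevel_diag Ug).
apply/unitaryP; rewrite -block_hadj -(block_imul_left _ (Ulevel_diag Ug) mn).
by rewrite (imul_hadj Ug) block_iid.
Qed.

Lemma Ulevel_hadj m g : Ulevel m g -> Ulevel m (hadj g).
Proof.
move=> Ug; split; last exact/diag_out_hadj/Ulevel_diag.
apply/unitaryP; rewrite -block_hadj hadjK block_hadj.
by apply: mulmx1C; case: Ug => /unitaryP.
Qed.

Lemma Ulevel_inverse m g : Ulevel m g -> is_inverse g (hadj g).
Proof.
move=> Ug; split; first exact: imul_hadj Ug.
by have := imul_hadj (Ulevel_hadj Ug); rewrite hadjK.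
Qed.

(** Uniqueness of the inverse is checked on large blocks, where the product is the associative
    product of finite matrices. *)
Lemma is_inverse_hadj m g h : Ulevel m g -> is_inverse g h -> h = hadj g.
Proof.
move=> Ug [gh hg]; have dg := Ulevel_diag Ug.
apply: (@imx_eq_ge _ _ m) => n mn.
have := congr1 (block n) gh; rewrite (block_imul_left _ dg mn) block_iid => E.
have := congr1 (block n) (imul_hadj Ug); rewrite (block_imul_left _ dg mn) block_iid => /mulmx1C E'.
by rewrite -[LHS]mul1mx -E' -mulmxA E mulmx1.
Qed.

Lemma Ulevel_imul m g g' : Ulevel m g -> Ulevel m g' -> Ulevel m (imul g g').
Proof.
move=> [ug hg] [ug' hg']; split; last exact: diag_out_imul.
apply/unitaryP; rewrite (block_imul_left _ hg) // ctrmxM.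
have /unitaryP := ug'; have /unitaryP := ug.
set A := block m g; set B := block m g' => uA uB.
have -> : A *m B *m (W *m (ctrmx B *m ctrmx A) *m W) =
  A *m (B *m (W *m ctrmx B *m W)) *m (W *m ctrmx A *m W).
  by rewrite !mulmxA -(mulmxA _ W W) mulWW mulmx1.
by rewrite uB mulmx1.
Qed.

Definition conj_imx g (M : imx) : imx := imul (imul g M) (hadj g).

Lemma block_conj m n g M : Ulevel m g -> (m <= n)%N ->
  block n (conj_imx g M) = block n g *m block n M *m block n (hadj g).
Proof.
move=> /Ulevel_diag dg mn.
by rewrite (block_imul_right _ (diag_out_hadj dg)) // (block_imul_left _ dg).
Qed.

Lemma conj_unitary_lie n (A X : 'M[K]_n) : unitary A -> unitary_lie X ->
  unitary_lie (A *m X *m (W *m ctrmx A *m W)).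
Proof.
move=> _ /unitary_lieP uX; apply/unitary_lieP.
rewrite !ctrmxM !ctrmxW ctrmxK !mulmxA -(mulmxA _ W W) mulWW mulmx1 mul1mx.
by rewrite -(mulmxA A X) uX mulmxN mulNmx !mulmxA.
Qed.

Let out_le n i j (k : 'I_(dimN n)) : inside n i -> ~~ inside n j ->
  val j <= val i -> val j <= val (idx_of k : idx).
Proof.
have := @idx_of_inside o n k; rewrite /inside.
by move: (val i) (val j) (val (idx_of k)) => a b c; lia.
Qed.

Let out_ge n i j (k : 'I_(dimN n)) : ~~ inside n i -> inside n j ->
  val j <= val i -> val (idx_of k : idx) <= val i.
Proof.
have := @idx_of_inside o n k; rewrite /inside.
by move: (val i) (val j) (val (idx_of k)) => a b c; lia.
Qed.

(** Skewness is read on a large block. For the zeros, g mixes only indices inside n, and these all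
    lie on the same side of an index outside n, so the triangular shape survives. *)
Lemma Llevel_conj n g (M : imx) : Ulevel n g -> Llevel n M -> Llevel n (conj_imx g M).
Proof.
move=> Ug hM; have dg := Ulevel_diag Ug; split; last first.
  move=> a b; have [k /andP[ka kb]] := exists_inside a b.
  have na := inside_le (leq_maxr n k) ka; have nb := inside_le (leq_maxr n k) kb.
  have Ug' := Ulevel_le (leq_maxl n k) Ug.
  have : unitary_lie (block (maxn n k) (conj_imx g M)).
    rewrite (block_conj _ Ug) ?leq_maxl // block_hadj; apply: conj_unitary_lie.
      by case: Ug'.
    exact: Llevel_skew hM.
  case/insideP: na => x ->; case/insideP: nb => y ->.
  by move/unitary_lie_entries/(_ x y); rewrite !mxE -!idx_of_opp.
case: hM => hM _ i j ji ij; rewrite /conj_imx (imul_right _ _ _ (diag_out_hadj dg)).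
have out i' j' : val j' <= val i' -> outside n i' j' -> imul g M i' j' = 0.
  move=> ji' ij'; rewrite (imul_left _ _ _ dg); case: ifPn => ni'; last exact: hM.
  have nj' : ~~ inside n j' by move: ij'; rewrite outsideE ni'.
  apply: big1 => k _; rewrite hM ?mulr0 ?outsideE ?(negbTE nj') ?andbF //.
  exact: out_le ni' nj' ji'.
case: ifPn => nj; last exact: out.
have ni : ~~ inside n i by move: ij; rewrite outsideE nj andbT.
apply: big1 => k _; rewrite out ?mul0r ?outsideE ?(negbTE ni) //.
exact: out_ge ni nj ji.
Qed.

(** The default value M makes the action total; it is never taken for g in [Uinf], as [actE]
    shows. *)
Definition act g (M : Lspace) : Lspace := insubd M (conj_imx g M).

Lemma actE g (M : Lspace) : Uinf g -> Lmx (act g M) = conj_imx g M.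
Proof.
move=> [m _ Ug]; rewrite -[Lmx _]/(val (act g M)) val_insubd ifT // inE.
have [n hM] := Lspace_level M.
exists (maxn m n) => //; apply: Llevel_conj; first exact: Ulevel_le (leq_maxl _ _) Ug.
exact: Llevel_le (leq_maxr _ _) _ hM.
Qed.

Lemma Llevel_act n g (M : Lspace) : Ulevel n g -> Llevel n M -> Llevel n (act g M).
Proof.
by move=> Ug hM; rewrite actE; [exact: Llevel_conj|exists n].
Qed.

Lemma block_act m n g (M : Lspace) : Ulevel m g -> (m <= n)%N ->
  block n (act g M) = block n g *m block n M *m block n (hadj g).
Proof. by move=> Ug mn; rewrite actE ?(block_conj _ Ug) //; exists m. Qed.

Lemma Uinf_hadj g : Uinf g -> Uinf (hadj g).
Proof. by move=> [m _ Ug]; exists m => //; exact: Ulevel_hadj. Qed.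

Lemma block_hadjV m n g : Ulevel m g -> (m <= n)%N -> block n (hadj g) *m block n g = 1%:M.
Proof.
by move=> Ug mn; rewrite block_hadj; apply: mulmx1C; have [/unitaryP] := Ulevel_le mn Ug.
Qed.

Lemma actK g : Uinf g -> cancel (act g) (act (hadj g)).
Proof.
move=> [m _ Ug] M; apply: Lspace_inj; apply: (@imx_eq_ge _ _ m) => n mn.
rewrite (block_act _ (Ulevel_hadj Ug)) // (block_act _ Ug) // hadjK !mulmxA.
by rewrite (block_hadjV Ug) // mul1mx -mulmxA (block_hadjV Ug) // mulmx1.
Qed.

Lemma actKV g : Uinf g -> cancel (act (hadj g)) (act g).
Proof. by move=> /Uinf_hadj/actK; rewrite hadjK. Qed.

Lemma Uinf_imul g g' : Uinf g -> Uinf g' -> Uinf (imul g g').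
Proof.
move=> [m _ Ug] [m' _ Ug']; exists (maxn m m') => //.
by apply: Ulevel_imul; [exact: Ulevel_le (leq_maxl _ _) Ug|exact: Ulevel_le (leq_maxr _ _) Ug'].
Qed.

Lemma act_imul g g' (M : Lspace) : Uinf g -> Uinf g' -> act (imul g g') M = act g (act g' M).
Proof.
move=> [m1 _ Ug1] [m2 _ Ug2].
have Ug := Ulevel_le (leq_maxl m1 m2) Ug1; have Ug' := Ulevel_le (leq_maxr m1 m2) Ug2.
apply: Lspace_inj; apply: (@imx_eq_ge _ _ (maxn m1 m2)) => n mn.
rewrite (block_act M (Ulevel_imul Ug Ug') mn) (block_act (act g' M) Ug mn) (block_act M Ug' mn).
rewrite !block_hadj (block_imul_left _ (Ulevel_diag Ug)) // ctrmxM !mulmxA.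
by rewrite -(mulmxA _ W W) mulWW mulmx1.
Qed.

Lemma translateE g h (A : set Lspace) : Uinf g -> is_inverse g h ->
  translate g h A = act g @` A.
Proof.
move=> Ug gh; have [m _ Ugm] := Ug; rewrite (is_inverse_hadj Ugm gh).
apply/seteqP; split=> M.
  by move=> [M' AM' E]; exists M' => //; apply: Lspace_inj; rewrite actE.
by move=> [M' AM' <-]; exists M' => //; rewrite actE.
Qed.

Lemma act_imageE g (A : set Lspace) : Uinf g -> act g @` A = act (hadj g) @^-1` A.
Proof.
move=> Ug; apply/seteqP; split=> M.
  by move=> [M' AM' <-]; rewrite /preimage /= actK.
by move=> AM; exists (act (hadj g) M); rewrite ?actKV.
Qed.

Definition uext n (A : 'M[K]_(dimN n)) : imx := fun i j =>
  if inside n i && inside n j then zext A i j else iid i j.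

Lemma block_uext n (A : 'M_(dimN n)) : block n (uext A) = A.
Proof.
by rewrite -[RHS]block_zext; apply/matrixP => k l; rewrite !mxE /uext !idx_of_inside.
Qed.

Lemma Ulevel_uext n (A : 'M_(dimN n)) : unitary A -> Ulevel n (uext A).
Proof.
move=> uA; split; first by rewrite block_uext.
by move=> i j; rewrite outsideE /uext => /negbTE ->.
Qed.

Lemma uext_block n g : Ulevel n g -> uext (block n g) = g.
Proof.
move=> [_ dg]; apply/funext => i; apply/funext => j; rewrite /uext.
case: ifPn => [/andP[/insideP[k ->] /insideP[l ->]]|nij].
  by rewrite /zext !pick_idx mxE.
by rewrite dg // outsideE.
Qed.

End Action.

(** * Compact open sets and measures *)

Section Cylinders.
Variables (K : quadField) (o : bool).
Notation bar := (@bar K).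
Notation dimN := (dimN o).
Notation Lspace := (Lspace K o).
Implicit Types (M : Lspace) (A B : set Lspace).

Lemma LsubE M M' i j : Lmx (M - M') i j = Lmx M i j - Lmx M' i j.
Proof. by []. Qed.

Lemma LaddE M M' i j : Lmx (M + M') i j = Lmx M i j + Lmx M' i j.
Proof. by []. Qed.

Definition Lbounded n : set Lspace := [set M | Llevel n M].

Lemma Lbounded_le m n : (m <= n)%N -> Lbounded m `<=` Lbounded n.
Proof. by move=> mn M; exact: Llevel_le. Qed.

Lemma bigcup_Lbounded : \bigcup_n Lbounded n = setT.
Proof. by apply/seteqP; split=> // M _; have [n hn] := Lspace_level M; exists n. Qed.

Lemma Lneg_sub n M M' : Llevel n M -> Llevel n M' -> block n M = block n M' -> Lneg n (M - M').
Proof.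
move=> hM hM' E; have z i j : ~~ outside n i j -> Lmx (M - M') i j = 0.
  rewrite outsideE negbK => /andP[/insideP[k ->] /insideP[l ->]].
  by rewrite LsubE; have /matrixP/(_ k l) := E; rewrite !mxE => ->; rewrite subrr.
have [h1 h2] := LlevelB hM hM'.
split=> //; split=> // i j ji _; have [out|/z//] := boolP (outside n i j).
exact: h1.
Qed.

Lemma Llevel_addNeg n M (Z : Lspace) : Llevel n M -> Lneg n Z ->
  Llevel n (M + Z) /\ block n (M + Z) = block n M.
Proof.
move=> [h1 h2] [[h3 h4] h5]; split.
  split=> [i j ji out|a b].
    by rewrite [LHS]LaddE h1 // h3 ?addr0 //; move: out; rewrite /outside; lia.
  by rewrite [LHS]LaddE h2 h4 [in RHS]LaddE barD opprD.
apply/matrixP => k l; rewrite !mxE [LHS]LaddE h5 ?addr0 //.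
by rewrite outsideE negbK !idx_of_inside.
Qed.

(* These are the compact open subsets of level [n]. *)
Definition Lev n : set (set Lspace) := [set A | A `<=` Lbounded n /\
  forall M M', A M -> Llevel n M' -> block n M = block n M' -> A M'].

Lemma Lev_le m n : (m <= n)%N -> Lev m `<=` Lev n.
Proof.
move=> mn A [A1 A2]; split=> [M /A1|M M' AM hM' E]; first exact: Lbounded_le.
have hM := A1 M AM; apply: (A2 M) => //; last exact: block_le E.
have : Lneg n (M' - M) by apply: Lneg_sub => //; exact: Lbounded_le hM.
move=> /(Lneg_ge mn) hZ; have [] := Llevel_addNeg hM hZ.
by rewrite addrC subrK.
Qed.

Lemma Lev0 n : Lev n set0.
Proof. by split=> //. Qed.

Lemma LevU n A B : Lev n A -> Lev n B -> Lev n (A `|` B).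
Proof.
move=> [A1 A2] [B1 B2]; split=> [M [/A1|/B1]//|M M' [AM|BM] h E].
  by left; exact: A2 E.
by right; exact: B2 E.
Qed.

Lemma LevD n A B : Lev n A -> Lev n B -> Lev n (A `\` B).
Proof.
move=> [A1 A2] [B1 B2]; split=> [M [/A1]//|M M' [AM nBM] h E]; split; first exact: A2 E.
by move=> BM'; apply: nBM; apply: (B2 M') => //; exact: A1.
Qed.

Lemma LevI n A B : Lev n A -> Lev n B -> Lev n (A `&` B).
Proof.
move=> [A1 A2] [B1 B2]; split=> [M [/A1]//|M M' [AM BM] h E].
by split; [exact: A2 E|exact: B2 E].
Qed.

Lemma Lev_bounded n : Lev n (Lbounded n).
Proof. by split. Qed.

Lemma Lev_Cyl n (X : 'M_(dimN n)) : Lev n (Cyl X).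
Proof. by split=> [M []//|M M' [_ <-] h ->]. Qed.

Definition LevT : set (set Lspace) := [set A | exists n, Lev n A].

Lemma LevT_max A B : LevT A -> LevT B -> exists n, Lev n A /\ Lev n B.
Proof.
move=> [m hA] [n hB]; exists (maxn m n).
by split; [exact: Lev_le (leq_maxl _ _) _ hA|exact: Lev_le (leq_maxr _ _) _ hB].
Qed.

Lemma Lev_open n A : Lev n A -> open A.
Proof.
move=> hA; suff : Lopen A by [].
move=> M AM; exists (maxn n 1); first by rewrite leq_max orbT.
have [A1 A2] := Lev_le (leq_maxl n 1) hA.
move=> Z hZ; have [h1 h2] := Llevel_addNeg (A1 M AM) hZ.
exact: (A2 M).
Qed.

Lemma Cyl_in_open A M : open A -> A M ->
  exists n, Llevel n M /\ Cyl (block n M) `<=` A.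
Proof.
move=> oA AM; have [m m1 h] : exists2 m, (1 <= m)%N & forall Z : Lspace, Lneg m Z -> A (M + Z).
  by have : Lopen A by []; apply.
have [n hM] := Lspace_level M; exists (maxn m n).
have hM' : Llevel (maxn m n) M by apply: Llevel_le hM; exact: leq_maxr.
split=> // M' [hM'' E]; have := Lneg_sub hM'' hM' E.
by move=> /(Lneg_ge (leq_maxl m n)) /h; rewrite addrC subrK.
Qed.

Lemma open_LevE A : open A ->
  A = \bigcup_n [set M | Llevel n M /\ Cyl (block n M) `<=` A].
Proof.
move=> oA; apply/seteqP; split=> M; first by move=> /(Cyl_in_open oA)[n h]; exists n.
by move=> [n _ [hM]]; apply.
Qed.

Lemma Lev_inner n A : Lev n [set M | Llevel n M /\ Cyl (block n M) `<=` A].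
Proof. by split=> [M []//|M M' [_ h] hM' E]; split=> //; rewrite -E. Qed.

(** An open set is the countable union over n of its largest compact open subset of level n. *)
Lemma Lborel_LevT : @measurable _ (Lborel K o) = <<s LevT >>.
Proof.
apply/seteqP; split; apply: smallest_sub.
- exact: smallest_sigma_algebra.
- move=> A oA; rewrite (open_LevE oA); apply: sigma_algebra_bigcup => n.
  by apply: sub_sigma_algebra; exists n; exact: Lev_inner.
- exact: smallest_sigma_algebra.
- by move=> A [n hA]; apply: sub_sigma_algebra; exact: Lev_open hA.
Qed.

Lemma measurable_Lev n A : Lev n A -> measurable (A : set (Lborel K o)).
Proof. by move=> hA; apply: sub_sigma_algebra; exact: Lev_open hA. Qed.

Lemma ultra_value (F : set_system Lspace) i j : UltraFilter F ->
  exists c, F [set M : Lspace | Lmx M i j = c].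
Proof.
move=> UF; apply: contrapT => /forallNP nF.
have : F [set M : Lspace | forall c : K, Lmx M i j <> c].
  apply: (@filter_forall _ K (fun c => [set M : Lspace | Lmx M i j <> c])) => c.
  have [|//] := in_ultra_setVsetC [set M : Lspace | Lmx M i j = c] UF.
  by move=> /nF.
rewrite (_ : [set M : Lspace | _] = set0); first exact: filter_not_empty.
by apply/seteqP; split=> // M /(_ (Lmx M i j)).
Qed.

(** Along an ultrafilter every entry is constant, the field being finite. The matrix of these
    constants is the limit, because a neighborhood of it within a level tests finitely many
    entries. *)
Lemma Lev_compact n A : Lev n A -> compact A.
Proof.
move=> hA; rewrite compact_ultra => F UF FA.
have [c hc] : exists c : idx o -> idx o -> K, forall i j, F [set M : Lspace | Lmx M i j = c i j].
  have /choice[f hf] : forall p : idx o * idx o, exists c, F [set M : Lspace | Lmx M p.1 p.2 = c].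
    by move=> p; exact: ultra_value.
  by exists (fun i j => f (i, j)) => i j; exact: hf (i, j).
have [A1 A2] := hA.
have hcn : Llevel n (c : imx K o).
  split=> [i j ji out|a b].
    have [M [AM Mc]] := filter_ex (filterI FA (hc i j)).
    by rewrite -Mc; have [h _] := A1 M AM; exact: h.
  have [M [AM [Mc Mc']]] := filter_ex (filterI FA (filterI (hc a b) (hc (idx_opp b) (idx_opp a)))).
  by rewrite -Mc -Mc'; have [_ h] := A1 M AM; exact: h.
have cL : (c : imx K o) \in @Lpred K o by rewrite inE; exists n.
pose p : Lspace := MkLspace cL.
have Fp m : F [set M | A M /\ block m M = block m p].
  apply: filterI => //.
  have : F [set M : Lspace | forall kl : 'I_(dimN m) * 'I_(dimN m),
      Lmx M (idx_of kl.1) (idx_of kl.2) = c (idx_of kl.1) (idx_of kl.2)].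
    by apply: filter_forall => kl; exact: hc.
  by apply: filterS => M h; apply/matrixP => k l; rewrite !mxE; exact: h (k, l).
exists p; split.
  by have [M [AM E]] := filter_ex (Fp n); exact: (A2 M).
move=> U /Lnbhs[m m1 h]; apply: filterS (Fp (maxn m n)) => M [AM E].
have hM : Llevel (maxn m n) M by apply: Llevel_le (A1 M AM); exact: leq_maxr.
have hp : Llevel (maxn m n) p by apply: Llevel_le hcn; exact: leq_maxr.
have := Lneg_sub hM hp E => /(Lneg_ge (leq_maxl m n)) /h.
by rewrite addrC subrK.
Qed.

Lemma compact_Lbounded A : compact A -> exists n, A `<=` Lbounded n.
Proof.
rewrite compact_cover => cA.
have [||D _ hD] := cA nat setT Lbounded.
- by move=> n _; exact/Lev_open/Lev_bounded.
- by move=> M _; rewrite /cover bigcup_Lbounded.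
exists (\max_(i <- finmap.enum_fset D) i)%N => M /hD[i /= iD].
by apply: Lbounded_le; exact: (@leq_bigmax_seq _ _ xpredT id).
Qed.

Lemma Lev_finite_cover n A (F : nat -> set Lspace) : Lev n A -> (forall i, LevT (F i)) ->
  A `<=` \bigcup_i F i -> exists N, A `<=` \bigcup_(i < N) F i.
Proof.
move=> hA hF AF; have := Lev_compact hA; rewrite compact_cover => cA.
have [||D _ hD] := cA nat setT F.
- by move=> i _; have [m hm] := hF i; exact: Lev_open hm.
- exact: AF.
exists (\max_(i <- finmap.enum_fset D) i).+1 => M /hD[i /= iD FM].
by exists i => //=; rewrite ltnS; exact: (@leq_bigmax_seq _ _ xpredT id).
Qed.

End Cylinders.

(* A copy of the space whose measurable sets are the compact open sets only, as the
   extension theorem is stated for a measure on a ring of sets. *)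
Definition Lring (K : quadField) (o : bool) : Type := Lspace K o.

Section RingOfSets.
Variables (K : quadField) (o : bool).

HB.instance Definition _ := Pointed.on (Lring K o).

Let LevT_setU : setU_closed (@LevT K o).
Proof. by move=> A B hA hB; have [n [hA' hB']] := LevT_max hA hB; exists n; exact: LevU. Qed.

Let LevT_setD : setD_closed (@LevT K o).
Proof. by move=> A B hA hB; have [n [hA' hB']] := LevT_max hA hB; exists n; exact: LevD. Qed.

Let LevT0 : @LevT K o set0.
Proof. by exists 0%N; exact: Lev0. Qed.

HB.instance Definition _ :=
  isRingOfSets.Build default_measure_display (Lring K o) LevT0 LevT_setU LevT_setD.

End RingOfSets.

(** * From cylinder values to a Borel measure *)

Section Extension.
Variables (R : realType) (K : quadField) (o : bool).
Notation dimN := (dimN o).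
Notation Lspace := (Lspace K o).
Implicit Types (M : Lspace) (A B : set Lspace).

Definition trace n A (X : 'M[K]_(dimN n)) : Prop := exists2 M, A M & block n M = X.

Variable v : forall n, 'M[K]_(dimN n) -> R.

Definition mass n A : R := \sum_(X : 'M[K]_(dimN n)) if `[< trace A X >] then v X else 0.

Definition inner_ord n (k : 'I_(dimN n)) : 'I_(dimN n.+1) :=
  cast_ord (esym (dimNS o n)) (rshift 1 (lshift 1 k)).

Definition inner_mx n (Y : 'M[K]_(dimN n.+1)) : 'M[K]_(dimN n) :=
  \matrix_(i, j) Y (inner_ord i) (inner_ord j).

Lemma borders_inner n X (Y : 'M[K]_(dimN n.+1)) : borders X Y -> inner_mx Y = X.
Proof. by move=> [h _ _]; apply/matrixP => i j; rewrite mxE; exact: h. Qed.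

Hypothesis v_ge0 : forall n (X : 'M[K]_(dimN n)), 0 <= v X.
Hypothesis v_sum : forall n (X : 'M[K]_(dimN n)), unitary_lie X ->
  v X = \sum_(Y : 'M[K]_(dimN n.+1) | `[< borders X Y >]) v Y.

(** Each matrix Y of the next level is grouped under its inner block; [v_sum] evaluates the
    groups. *)
Lemma mass_step n A : Lev n A -> mass n.+1 A = mass n A.
Proof.
move=> [A1 A2]; rewrite /mass -!big_mkcond /=.
rewrite (partition_big (@inner_mx n) (fun X => `[< trace A X >])) /= => [|Y /asboolP[M AM <-]]; last first.
  by apply/asboolP; exists M => //; rewrite (borders_inner (Llevel_borders (A1 M AM))).
apply: eq_bigr => X /asboolP[M AM XE].
rewrite (v_sum (X := X)); last by rewrite -XE; exact: Llevel_skew (A1 M AM).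
apply: eq_bigl => Y; apply/andP/asboolP => [[/asboolP[M' AM' <-] /eqP <-]|bXY].
  have b := Llevel_borders (A1 M' AM'); by rewrite (borders_inner b).
split; last by rewrite (borders_inner bXY).
apply/asboolP; have [M' hM'] := @Cyl_nonempty K o n.+1 Y (let: And3 _ _ h := bXY in h).
exists M'; last by case: hM'.
have [h1 h2] : Cyl X M' by apply/Cyl_step; case: hM' => h ->.
by apply: (A2 M) => //; rewrite XE h2.
Qed.

Lemma mass_le m n A : (m <= n)%N -> Lev m A -> mass n A = mass m A.
Proof.
move=> mn hA; rewrite -(subnKC mn); elim: (n - m)%N => [|k IH]; first by rewrite addn0.
by rewrite addnS mass_step //; apply: Lev_le hA; exact: leq_addr.
Qed.

Lemma mass_ge0 n A : 0 <= mass n A.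
Proof. by apply: sumr_ge0 => X _; case: ifP. Qed.

Lemma massU n A B : Lev n A -> Lev n B -> A `&` B = set0 ->
  mass n (A `|` B) = mass n A + mass n B.
Proof.
move=> [A1 A2] [B1 B2] AB; rewrite /mass -big_split /=; apply: eq_bigr => X _.
case: (asboolP (trace A X)) => [[M AM E]|nA]; case: (asboolP (trace B X)) => [[M' BM' E']|nB].
- have : (A `&` B) M' by split=> //; apply: (A2 M) => //; [exact: B1|rewrite E E'].
  by rewrite AB.
- by rewrite asboolT ?addr0 //; exists M => //; left.
- by rewrite asboolT ?add0r //; exists M' => //; right.
- by rewrite asboolF ?addr0 // => -[M [AM|BM] E]; [apply: nA|apply: nB]; exists M.
Qed.

(** A level is chosen arbitrarily; [mass_le] makes the value independent of it. *)
Definition premeasure (A : set (Lring K o)) : \bar R :=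
  (if pselect (LevT A) is left h then mass (projT1 (cid h)) A else 0)%:E.

Lemma premeasureE n A : Lev n A -> premeasure A = (mass n A)%:E.
Proof.
move=> hA; rewrite /premeasure; case: pselect => [h|[]]; last by exists n.
case: cid => m hm /=; rewrite -(mass_le (leq_maxl m n) hm).
by rewrite -(mass_le (leq_maxr m n) hA).
Qed.

Let premeasure0 : premeasure set0 = 0%E.
Proof.
rewrite (premeasureE (@Lev0 K o 0)) /mass big1 // => X _.
by rewrite asboolF // => -[].
Qed.

Let premeasure_ge0 A : (0 <= premeasure A)%E.
Proof. by rewrite /premeasure lee_fin; case: pselect => // h; exact: mass_ge0. Qed.

Let premeasureU (A B : set (Lring K o)) : measurable A -> measurable B -> A `&` B = set0 ->
  premeasure (A `|` B) = (premeasure A + premeasure B)%E.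
Proof.
move=> mA mB AB; have [n [hA hB]] := LevT_max mA mB.
by rewrite (premeasureE (LevU hA hB)) (premeasureE hA) (premeasureE hB) massU.
Qed.

(** A compact open set that is a disjoint union of open sets meets only finitely many of them, so
    the partial sums are eventually constant. *)
Let premeasure_sigma_additive : semi_sigma_additive premeasure.
Proof.
move=> F mF tF mUF; have [n hU] := mUF.
have [N hN] := @Lev_finite_cover K o n _ F hU mF (@subset_refl _ _).
have fin m : premeasure (\bigcup_(i < m) F i) = (\sum_(0 <= i < m) premeasure (F i))%E /\
    measurable (\bigcup_(i < m) F i : set (Lring K o)).
  elim: m => [|m [IH1 IH2]]; first by rewrite bigcup_mkord big_ord0 big_geq //; split=> //; exact: measurable0.
  rewrite bigcup_mkord big_ord_recr /= -bigcup_mkord big_nat_recr //= -IH1.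
  split; last exact: measurableU.
  rewrite premeasureU //; apply/seteqP; split=> // M [[i /= im Fi] Fm].
  have := tF i m I I; rewrite /= => h.
  have E : i = m by apply: h; exists M.
  by rewrite E ltnn in im.
apply: cvg_near_cst; exists N => //= m Nm.
rewrite -(fin m).1; congr premeasure; apply/seteqP; split=> M; first by move=> [i _ Fi]; exists i.
by move=> /hN[i iN Fi]; exists i => //=; exact: leq_trans Nm.
Qed.

Lemma exists_extension : exists P : {measure set (Lborel K o) -> \bar R},
  forall n A, Lev n A -> P A = (mass n A)%:E.
Proof.
pose mu : {measure set (Lring K o) -> \bar R} := HB.pack premeasure
  (isMeasure.Build _ _ _ premeasure premeasure0 premeasure_ge0 premeasure_sigma_additive).
pose ext (A : set (Lborel K o)) : \bar R := measure_extension mu A.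
have ext_sa : semi_sigma_additive ext.
  move=> F mF tF mUF; rewrite Lborel_LevT in mF mUF.
  exact: (@measure_semi_sigma_additive _ _ _ (measure_extension mu) F mF tF mUF).
pose P : {measure set (Lborel K o) -> \bar R} := HB.pack ext
  (isMeasure.Build _ _ _ ext (measure0 (measure_extension mu))
     (measure_ge0 (measure_extension mu)) ext_sa).
exists P => n A hA.
by rewrite -(premeasureE hA); apply: measurable_mu_extE; exists n.
Qed.

End Extension.

Section Uniqueness.
Variables (R : realType) (K : quadField) (o : bool).
Notation dimN := (dimN o).
Notation Lspace := (Lspace K o).
Implicit Types (P : {measure set (Lborel K o) -> \bar R}) (A : set Lspace).

Lemma measure_eq_LevT P P' : (forall A, LevT A -> P A = P' A) ->
  (forall n, (P (Lbounded n) < +oo)%E) -> same_measure P P'.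
Proof.
move=> PP' Pfin A mA.
apply: (@measure_unique _ R (Lborel K o) (@LevT K o) (@Lbounded K o)) => //.
- exact: Lborel_LevT.
- by move=> B C hB hC; have [n [hB' hC']] := LevT_max hB hC; exists n; exact: LevI.
- by move=> n; exists n; exact: Lev_bounded.
- exact: bigcup_Lbounded.
Qed.

Lemma measure_Lev P n A : Lev n A ->
  P A = (\sum_(X : 'M[K]_(dimN n) | `[< trace A X >]) P (Cyl X))%E.
Proof.
move=> [A1 A2].
have -> : P A = P (\bigcup_(X in [set X : 'M[K]_(dimN n) | trace A X]) Cyl X).
  congr (P _); apply/seteqP; split=> M.
    by move=> AM; exists (block n M); [exists M|split=> //; exact: A1].
  by move=> [X [M' AM' E] [hM hX]]; apply: (A2 M') => //; rewrite hX.
have fin : finite_set [set X : 'M[K]_(dimN n) | trace A X] by exact: finite_finset.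
rewrite (measure_fin_bigcup _ fin); last 2 first.
- by move=> X Y _ _ [M [[_ <-] [_ <-]]].
- by move=> X _; apply: measurable_Lev; exact: Lev_Cyl.
rewrite [RHS](bigfs _ (index_enum_uniq _)); last by move=> X _; rewrite mem_index_enum.
by apply: eq_fsbigl; apply/seteqP; split=> X /= /asboolP.
Qed.

Lemma measure_Cyl_step P n (X : 'M[K]_(dimN n)) :
  P (Cyl X) = (\sum_(Y : 'M[K]_(dimN n.+1) | `[< borders X Y >]) P (Cyl Y))%E.
Proof.
have hX := Lev_le (leqnSn n) (Lev_Cyl X).
rewrite (measure_Lev P hX); apply: eq_bigl => Y; apply/asboolP/asboolP.
  by move=> [M /Cyl_step[_ b] <-].
move=> b; have [M hM] := Cyl_nonempty (let: And3 _ _ h := b in h).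
by exists M; [apply/Cyl_step; case: hM => h ->|case: hM].
Qed.

End Uniqueness.

Section Invariance.
Variables (R : realType) (K : quadField) (o : bool).
Notation W := (@Wmx K _).
Notation dimN := (dimN o).
Notation Lspace := (Lspace K o).
Notation Lborel := (Lborel K o).
Implicit Types (M : Lspace) (A B : set Lspace) (P : {measure set Lborel -> \bar R}).

Lemma act_block_eq n g M M' : Ulevel n g -> block n M = block n M' ->
  block n (act g M) = block n (act g M').
Proof. by move=> Ug E; rewrite (block_act M Ug (leqnn n)) (block_act M' Ug (leqnn n)) E. Qed.

Lemma Lev_preimage_act n g A : Ulevel n g -> Lev n A -> Lev n (act g @^-1` A).
Proof.
move=> Ug [A1 A2]; split=> [M AM|M M' AM hM' E].
  rewrite /Lbounded /= -[M](actK (g := g)); last by exists n.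
  by apply: Llevel_act; [exact: Ulevel_hadj|exact: A1].
by apply: (A2 (act g M)) => //; [exact: Llevel_act|exact: act_block_eq].
Qed.

Lemma LevT_preimage_act g A : Uinf g -> LevT A -> LevT (act g @^-1` A).
Proof.
move=> [m _ Ug] [n hA]; exists (maxn m n); apply: Lev_preimage_act.
  exact: Ulevel_le (leq_maxl _ _) Ug.
exact: Lev_le (leq_maxr _ _) _ hA.
Qed.

Lemma measurable_act g : Uinf g -> measurable_fun setT (act g : Lborel -> Lborel).
Proof.
move=> Ug; apply: (@measurability _ _ Lborel Lborel setT (act g) (@LevT K o)); first exact: Lborel_LevT.
move=> _ [A hA <-]; rewrite setTI.
by have [n h] := LevT_preimage_act Ug hA; exact: measurable_Lev h.
Qed.

Lemma measurable_act_image g A : Uinf g -> measurable (A : set Lborel) ->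
  measurable (act g @` A : set Lborel).
Proof.
move=> Ug mA; rewrite act_imageE //.
by have := measurable_act (Uinf_hadj Ug) measurableT mA; rewrite setTI.
Qed.

Lemma invariantP P : invariant_measure P <->
  forall g, Uinf g -> forall A, measurable (A : set Lborel) -> P (act g @` A) = P A.
Proof.
split=> [h g Ug A mA|h g g' Ug _ gg A mA]; last by rewrite (translateE _ Ug gg); exact: h.
have [m _ Ugm] := Ug; have gg := Ulevel_inverse Ugm.
by rewrite -(translateE _ Ug gg); apply: h => //; exact: Uinf_hadj.
Qed.

Lemma invariant_setP A : invariant_set A <-> forall g, Uinf g -> act g @` A = A.
Proof.
split=> [h g Ug|h g g' Ug _ gg]; last by rewrite (translateE _ Ug gg); exact: h.
have [m _ Ugm] := Ug; have gg := Ulevel_inverse Ugm.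
by rewrite -(translateE _ Ug gg); apply: h => //; exact: Uinf_hadj.
Qed.

(** The measure transported by g agrees with P on compact open sets, hence on Borel sets by
    [measure_eq_LevT]. *)
Lemma invariant_Lev P : (forall n, (P (Lbounded n) < +oo)%E) ->
  (forall g A, Uinf g -> LevT A -> P (act g @` A) = P A) -> invariant_measure P.
Proof.
move=> Pfin h; apply/invariantP => g Ug A mA.
have mg := measurable_act (Uinf_hadj Ug).
pose P' A : \bar R := P (act (hadj g) @^-1` A).
have P'0 : P' set0 = 0%E by rewrite /P' preimage_set0 measure0.
have P'sa : semi_sigma_additive (P' : set Lborel -> \bar R).
  move=> F mF tF mUF; rewrite /P' preimage_bigcup; apply: measure_semi_sigma_additive.
  - by move=> i; have := mg measurableT _ (mF i); rewrite setTI.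
  - apply/trivIsetP => i j _ _ ij; rewrite -preimage_setI.
    by move/trivIsetP: tF => /(_ i j I I ij) ->; rewrite preimage_set0.
  - by rewrite -preimage_bigcup; have := mg measurableT _ mUF; rewrite setTI.
pose Q : {measure set Lborel -> \bar R} := HB.pack (P' : set Lborel -> \bar R)
  (isMeasure.Build _ Lborel R P' P'0 (fun A => measure_ge0 P (act (hadj g) @^-1` A)) P'sa).
have PQ : same_measure P Q.
  apply: measure_eq_LevT => // B hB; rewrite -[RHS]/(P (act (hadj g) @^-1` B)).
  by rewrite -act_imageE // h.
by rewrite (PQ A mA) act_imageE.
Qed.

Lemma act_Cyl n g (X : 'M[K]_(dimN n)) : Ulevel n g ->
  act g @` Cyl X = Cyl (block n g *m X *m block n (hadj g)).
Proof.
move=> Ug; have Ui : Uinf g by exists n.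
apply/seteqP; split=> [_ [M [hM <-] <-]|M [hM hX]].
  by split; [exact: Llevel_act|rewrite (block_act M Ug (leqnn n))].
exists (act (hadj g) M); last exact: actKV.
split; first by apply: Llevel_act => //; exact: Ulevel_hadj.
rewrite (block_act M (Ulevel_hadj Ug) (leqnn n)) hX hadjK !mulmxA.
rewrite (block_hadjV Ug (leqnn n)) mul1mx -mulmxA.
by rewrite (block_hadjV Ug (leqnn n)) mulmx1.
Qed.

Lemma invariant_Cyl P n (X X' : 'M[K]_(dimN n)) la : invariant_measure P ->
  unitary_lie X -> unitary_lie X' -> jordan_type X la -> jordan_type X' la ->
  P (Cyl X) = P (Cyl X').
Proof.
move=> /invariantP inv uX uX' tX tX'; have [A uA AX] := unitary_conj uX uX' tX tX'.
have Ug := Ulevel_uext uA; rewrite -(inv (uext A)) //; last 2 first.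
- by exists n.
- exact: measurable_Lev (Lev_Cyl X).
rewrite (act_Cyl X Ug) block_hadj block_uext AX -mulmxA.
by have /unitaryP -> := uA; rewrite mulmx1.
Qed.

(** Makes compact sets closed, hence Borel, so that their measure can be bounded by that of a
    level. *)
Lemma Lspace_hausdorff : hausdorff_space Lspace.
Proof.
move=> p q pq; have [a hp] := Lspace_level p; have [b hq] := Lspace_level q.
apply: Lspace_inj; apply: (@imx_eq_ge _ _ (maxn a b)) => n abn.
have hp' : Llevel n p by apply: Llevel_le hp; apply: leq_trans abn; exact: leq_maxl.
have hq' : Llevel n q by apply: Llevel_le hq; apply: leq_trans abn; exact: leq_maxr.
have nb (x : Lspace) : Llevel n x -> nbhs x (Cyl (block n x)).
  by move=> hx; apply: open_nbhs_nbhs; split; [exact: Lev_open (Lev_Cyl _)|].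
by have [M [[_ <-] [_ <-]]] := pq _ _ (nb p hp') (nb q hq').
Qed.

Lemma compact_measurable A : compact A -> measurable (A : set Lborel).
Proof.
move=> /(separation_axioms.compact_closed Lspace_hausdorff) cA; rewrite -[A]setCK; apply: measurableC.
by apply: sub_sigma_algebra; exact: closed_openC.
Qed.

Lemma radon_bounded P : (forall n, (P (Lbounded n) < +oo)%E) -> radon P.
Proof.
move=> h A cA; have [n An] := compact_Lbounded cA; apply: le_lt_trans (h n).
have mA := compact_measurable cA.
have mB : measurable (@Lbounded K o n : set Lborel) := measurable_Lev (@Lev_bounded K o n).
by apply: le_measure; rewrite ?inE.
Qed.

Lemma radon_fin P n A : radon P -> Lev n A -> (P A < +oo)%E.
Proof. by move=> rP hA; apply: rP; exact: Lev_compact hA. Qed.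

End Invariance.

(** * Measures and harmonic functions *)

Section Correspondence.
Variables (R : realType) (K : quadField) (o : bool).
Notation W := (@Wmx K _).
Notation dimN := (dimN o).
Notation Lspace := (Lspace K o).
Notation Lborel := (Lborel K o).
Notation weight := (weight R K).
Implicit Types (M : Lspace) (A B : set Lspace) (P : {measure set Lborel -> \bar R}).
Let t : R := - ((qq K)%:R)^-1.

Lemma odd_dimN n : odd (dimN n) = o.
Proof. by rewrite /Defs.dimN mul2n oddD odd_double oddb. Qed.

Lemma dimN_inj : injective dimN.
Proof. by move=> m n; rewrite /Defs.dimN; lia. Qed.

Lemma vertex_rep (la : vertex o) : exists p : {n & 'M[K]_(dimN n)},
  [/\ sumn (val la) = dimN (projT1 p), unitary_lie (projT2 p),
      nilpotent_mx (projT2 p) & jordan_type (projT2 p) (val la)].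
Proof.
case: la => la /= /andP[pla /eqP ola].
have sla : sumn la = dimN (sumn la)./2.
  by rewrite /Defs.dimN -[LHS]odd_double_half ola addnC mul2n.
have [X [uX nX tX]] := unitary_lie_jordan K pla sla.
by exists (existT _ (sumn la)./2 X).
Qed.

Lemma nilpotent_vertex n (X : 'M[K]_(dimN n)) : unitary_lie X -> nilpotent_mx X ->
  exists2 la : vertex o, val la = jtype X & jordan_type X (val la).
Proof.
move=> uX nX; have tX := jtypeP uX nX.
have h : is_partition (jtype X) && (odd (sumn (jtype X)) == o).
  by case: (tX) => -> _; rewrite (sumn_jordan_type tX) odd_dimN eqxx.
by exists (exist (fun la => is_partition la && (odd (sumn la) == o) : Prop) _ h : vertex o).
Qed.

(** The representative of the orbit is arbitrary; for invariant P [measure_to_funE] removes the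
    dependence on it. *)
Definition measure_to_fun P (la : vertex o) : R :=
  let p := projT1 (cid (vertex_rep la)) in
  fine (P (Cyl (projT2 p))) / weight (dimN (projT1 p)) (val la).

Lemma P0_fin P n (X : 'M[K]_(dimN n)) : P0 P -> P (Cyl X) \is a fin_num.
Proof.
move=> [rP _ _]; rewrite ge0_fin_numE; last exact: measure_ge0.
exact: radon_fin rP (Lev_Cyl X).
Qed.

Lemma measure_to_funE P n (X : 'M[K]_(dimN n)) la : P0 P -> unitary_lie X ->
  jordan_type X (val la) ->
  P (Cyl X) = (weight (dimN n) (val la) * measure_to_fun P la)%:E.
Proof.
move=> P0P uX tX; rewrite /measure_to_fun; case: cid => -[m Y] /= [sY uY _ tY].
have mn : m = n by apply: dimN_inj; rewrite -sY (sumn_jordan_type tX).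
subst m; have [_ inv _] := P0P.
rewrite (invariant_Cyl inv uX uY tX tY) mulrC divfK ?gt_eqF ?weight_gt0 //.
by rewrite fineK // P0_fin.
Qed.

Lemma measure_to_fun_compatible P : P0 P -> compatible P (measure_to_fun P).
Proof. by move=> P0P n la X _ uX _ tX; exact: measure_to_funE. Qed.

Lemma measure_to_fun_seq P n (X : 'M[K]_(dimN n)) : P0 P -> unitary_lie X -> nilpotent_mx X ->
  P (Cyl X) = (weight (dimN n) (jtype X) * on_seq (measure_to_fun P) (jtype X))%:E.
Proof.
move=> P0P uX nX; have [la <- tX] := nilpotent_vertex uX nX.
by rewrite on_seqE; exact: measure_to_funE.
Qed.

Lemma nilpotent_step n M : Llevel n M ->
  nilpotent_mx (block n.+1 M) <-> nilpotent_mx (block n M).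
Proof.
move=> hM; apply: (borders_nilpotent (dimNS o n)) => //; first exact: Llevel_skew hM.
exact: Llevel_borders.
Qed.

Lemma nilpotent_le m n M : (m <= n)%N -> Llevel m M ->
  nilpotent_mx (block n M) <-> nilpotent_mx (block m M).
Proof.
move=> mn hM; rewrite -(subnKC mn); elim: (n - m)%N => [|k IH]; first by rewrite addn0.
by rewrite addnS nilpotent_step ?IH //; apply: Llevel_le hM; exact: leq_addr.
Qed.

(** A border is nilpotent exactly when its interior is, so nilpotency can be tested at any level
    containing M. *)
Lemma NilL_level n M : Llevel n M -> NilL M <-> nilpotent_mx (block n M).
Proof.
move=> hM; split=> [[m hM' nM]|nM]; last by exists n.
have := nilpotent_le (leq_maxl m n) hM'; have := nilpotent_le (leq_maxr m n) hM.
by move=> <- ->.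
Qed.

Definition nonNil n : set Lspace := [set M | Llevel n M /\ ~ nilpotent_mx (block n M)].

Lemma Lev_nonNil n : Lev n (nonNil n).
Proof. by split=> [M []//|M M' [_ h] hM' E]; split=> //; rewrite -E. Qed.

Lemma NilL_setC : ~` @NilL K o = \bigcup_n nonNil n.
Proof.
apply/seteqP; split=> M.
  by move=> nM; have [n hM] := Lspace_level M; exists n => //; split=> // /(NilL_level hM).
by move=> [n _ [hM h]] /(NilL_level hM).
Qed.

Lemma measurable_NilLC : measurable (~` @NilL K o : set Lborel).
Proof.
rewrite NilL_setC; apply: bigcupT_measurable => n.
exact: measurable_Lev (Lev_nonNil n).
Qed.

Lemma P0_nonnil P n (X : 'M[K]_(dimN n)) : P0 P -> ~ nilpotent_mx X -> P (Cyl X) = 0%E.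
Proof.
move=> [_ _ z] nX; apply/eqP; rewrite eq_le measure_ge0 andbT -z.
apply: le_measure; rewrite ?inE.
- exact: measurable_Lev (Lev_Cyl X).
- exact: measurable_NilLC.
by move=> M [hM hX] /(NilL_level hM); rewrite hX.
Qed.

Lemma measure_to_fun_ge0 P la : 0 <= measure_to_fun P la.
Proof.
by apply: divr_ge0; [apply: fine_ge0; exact: measure_ge0|exact/ltW/weight_gt0].
Qed.

Lemma measure_to_fun_harmonic P : P0 P -> Defs.harmonic t (measure_to_fun P).
Proof.
move=> P0P mu; have [[n X] /= [_ uX nX tX]] := vertex_rep mu.
have E := measure_to_funE P0P uX tX.
rewrite measure_Cyl_step in E; have jX := jtypeE tX.
have w0 : weight (dimN n) (val mu) != 0 by rewrite gt_eqF ?weight_gt0.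
have S := sum_borders (measure_to_fun P) (dimNS o n) (odd_dimN n.+1) uX nX.
rewrite jX -/t in S; apply: (mulfI w0); rewrite -S.
apply: EFin_inj; rewrite -E -sumEFin; apply: eq_bigr => Y /asboolP bXY.
rewrite measure_to_fun_seq //; first by case: bXY.
exact/(borders_nilpotent (dimNS o n) uX bXY).
Qed.

Lemma measure_to_fun_Hplus P : P0 P -> Hplus t (measure_to_fun P).
Proof.
by move=> P0P; split=> [|la]; [exact: measure_to_fun_harmonic|exact: measure_to_fun_ge0].
Qed.

Lemma measure_to_fun_eq P P' : same_measure P P' -> measure_to_fun P = measure_to_fun P'.
Proof.
move=> PP'; apply/funext => la; rewrite /measure_to_fun PP' //.
exact: measurable_Lev (Lev_Cyl _).
Qed.

Lemma measure_to_fun_inj P P' : P0 P -> P0 P' ->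
  measure_to_fun P = measure_to_fun P' -> same_measure P P'.
Proof.
move=> P0P P0P' E; apply: measure_eq_LevT; last first.
  by move=> n; case: P0P => rP _ _; exact: radon_fin rP (@Lev_bounded K o n).
move=> A [n hA]; rewrite (measure_Lev P hA) (measure_Lev P' hA).
apply: eq_bigr => X /asboolP[M AM XE].
have uX : unitary_lie X by rewrite -XE; apply: Llevel_skew; case: hA => h _; exact: h AM.
have [nX|nX] := pselect (nilpotent_mx X); last by rewrite !P0_nonnil.
by rewrite !measure_to_fun_seq // E.
Qed.

Section FromHarmonic.
Variable phi : vertex o -> R.
Hypothesis phiH : Hplus t phi.

Definition cyl_mass n (X : 'M[K]_(dimN n)) : R :=
  if `[< unitary_lie X /\ nilpotent_mx X >]
  then weight (dimN n) (jtype X) * on_seq phi (jtype X) else 0.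

Let on_seq_ge0 la : 0 <= on_seq phi la.
Proof. by rewrite /on_seq; case: insub => //= x; case: phiH. Qed.

Lemma cyl_mass_ge0 n (X : 'M[K]_(dimN n)) : 0 <= cyl_mass X.
Proof.
rewrite /cyl_mass; case: ifP => // _; apply: mulr_ge0; last exact: on_seq_ge0.
exact/ltW/weight_gt0.
Qed.

(** For nilpotent X this is harmonicity, through [sum_borders]; otherwise no border is nilpotent and
    both sides are 0. *)
Lemma cyl_mass_sum n (X : 'M[K]_(dimN n)) : unitary_lie X ->
  cyl_mass X = \sum_(Y : 'M[K]_(dimN n.+1) | `[< borders X Y >]) cyl_mass Y.
Proof.
move=> uX; rewrite {1}/cyl_mass; case: asboolP => [[_ nX]|nX].
  have -> : \sum_(Y : 'M[K]_(dimN n.+1) | `[< borders X Y >]) cyl_mass Y =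
      \sum_(Y : 'M[K]_(dimN n.+1) | `[< borders X Y >])
        weight (dimN n.+1) (jtype Y) * on_seq phi (jtype Y).
    apply: eq_bigr => Y /asboolP bXY; rewrite /cyl_mass asboolT //.
    by split; [case: bXY|apply/(borders_nilpotent (dimNS o n) uX bXY)].
  rewrite (sum_borders _ (dimNS o n) (odd_dimN n.+1)) // -/t.
  have [la laE _] := nilpotent_vertex uX nX.
  by rewrite -laE on_seqE; congr (_ * _); case: phiH => h _; exact: h.
rewrite big1 // => Y /asboolP bXY; rewrite /cyl_mass asboolF // => -[_ nY].
by apply: nX; split=> //; apply/(borders_nilpotent (dimNS o n) uX bXY).
Qed.

Lemma mass_Cyl n (X : 'M[K]_(dimN n)) : unitary_lie X -> mass (@cyl_mass) n (Cyl X) = cyl_mass X.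
Proof.
move=> uX; rewrite /mass (bigD1 X) //= big1 ?addr0 => [|Y YX].
  by rewrite asboolT //; have [M hM] := Cyl_nonempty uX; exists M => //; case: hM.
by rewrite asboolF // => -[M [_ E] E']; case/eqP: YX; rewrite -E -E'.
Qed.

Lemma jordan_type_conj n (A X : 'M[K]_n) : unitary A -> unitary_lie X -> nilpotent_mx X ->
  [/\ unitary_lie (A *m X *m (W *m ctrmx A *m W)), nilpotent_mx (A *m X *m (W *m ctrmx A *m W)) &
      jtype (A *m X *m (W *m ctrmx A *m W)) = jtype X].
Proof.
move=> uA uX nX; have /unitaryP AB := uA; have BA := mulmx1C AB.
have tX := jtypeP uX nX.
have tY : jordan_type (A *m X *m (W *m ctrmx A *m W)) (jtype X).
  by apply: (jtype_conj AB BA _ tX); rewrite -mulmxA BA mulmx1.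
split; first exact: conj_unitary_lie.
  by exists n; exact: nilpotent_jordan_type tY.
exact: jtypeE.
Qed.

Lemma cyl_mass_conj n (A X : 'M[K]_(dimN n)) : unitary A ->
  cyl_mass (A *m X *m (W *m ctrmx A *m W)) = cyl_mass X.
Proof.
move=> uA; rewrite /cyl_mass; case: (asboolP (unitary_lie X /\ nilpotent_mx X)) => [[uX nX]|nX].
  by have [h1 h2 h3] := jordan_type_conj uA uX nX; rewrite asboolT // h3.
rewrite asboolF // => -[uY nY]; apply: nX.
set Y := A *m X *m _ in uY nY; set B := W *m ctrmx A *m W in Y uY nY.
have /unitaryP AB := uA; have BA : B *m A = 1%:M := mulmx1C AB.
have WB : W *m ctrmx B *m W = A.
  by rewrite /B !ctrmxM !ctrmxW ctrmxK !mulmxA mulWW mul1mx -mulmxA mulWW mulmx1.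
have uB : unitary B by apply/unitaryP; rewrite WB.
have [h1 h2 _] := jordan_type_conj uB uY nY.
have E : B *m Y *m (W *m ctrmx B *m W) = X.
  rewrite WB (_ : Y = A *m X *m B) // -(mulmxA A) (mulmxA B A) BA mul1mx.
  by rewrite -(mulmxA X) BA mulmx1.
by rewrite E in h1 h2.
Qed.

Lemma exists_measure : exists2 P, P0 P & measure_to_fun P = phi.
Proof.
have [P hP] := exists_extension cyl_mass_ge0 cyl_mass_sum.
have Pfin n : (P (Lbounded n) < +oo)%E by rewrite (hP n) ?ltry //; exact: (@Lev_bounded K o n).
have P0P : P0 P.
  split.
  - exact: radon_bounded.
  - apply: invariant_Lev => // g A Ug0 [b hA0]; have [a _ Ug1] := Ug0.
    pose n := maxn a b; have Ug := Ulevel_le (leq_maxl a b) Ug1.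
    have hA : Lev n A := Lev_le (leq_maxr a b) hA0.
    have hgA : Lev n (act g @` A).
      by rewrite act_imageE //; apply: Lev_preimage_act => //; exact: Ulevel_hadj.
    rewrite (hP n _ hA) (hP n _ hgA); congr _%:E; rewrite /mass -/n.
    have uG : unitary (block n g) by case: Ug.
    set G := block n g in uG *; have hG : block n (hadj g) = W *m ctrmx G *m W by rewrite block_hadj.
    (* The action of g permutes n-th blocks by conjugation and [cyl_mass] is invariant under it, so
       reindexing by [f] identifies the two masses. *)
    pose f (X : 'M[K]_(dimN n)) := G *m X *m (W *m ctrmx G *m W).
    have /unitaryP AB := uG; have BA := mulmx1C AB.
    have fK X : W *m ctrmx G *m W *m f X *m G = X.
      by rewrite /f -(mulmxA G) (mulmxA (_ *m W) G) BA mul1mx -(mulmxA X) BA mulmx1.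
    have finj : injective f by move=> X Y E; rewrite -[X]fK E fK.
    rewrite (reindex_inj finj); apply: eq_bigr => X _; rewrite cyl_mass_conj //.
    have -> : `[< trace (act g @` A) (f X) >] = `[< trace A X >]; last by [].
    apply/asboolP/asboolP => [[_ [M AM <-]]|[M AM <-]].
      by rewrite (block_act M Ug (leqnn n)) hG => /finj E; exists M.
    exists (act g M); first by exists M.
    by rewrite (block_act M Ug (leqnn n)) hG.
  - rewrite NilL_setC; apply/eqP; rewrite eq_le measure_ge0 andbT.
    have m n : measurable (nonNil n : set Lborel) by apply: measurable_Lev (Lev_nonNil n).
    have z n : P (nonNil n) = 0%E.
      rewrite (hP n _ (Lev_nonNil n)) /mass big1 // => X _; case: asboolP => // -[M [hM nM] E].
      by rewrite /cyl_mass asboolF // -E => -[_].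
    apply: le_trans (measure_sigma_subadditive P m (bigcupT_measurable _ m) (@subset_refl _ _)) _.
    by rewrite eseries0.
exists P => //; apply/funext => la.
have [[n X] /= [_ uX nX tX]] := vertex_rep la.
have := measure_to_funE P0P uX tX; rewrite (hP n _ (Lev_Cyl X)) mass_Cyl //.
rewrite /cyl_mass asboolT // (jtypeE tX) on_seqE => -[] /mulfI E.
by apply/esym/E; rewrite gt_eqF ?weight_gt0.
Qed.

End FromHarmonic.

Lemma compatible_unique P phi psi : compatible P phi -> compatible P psi -> phi = psi.
Proof.
move=> hphi hpsi; apply/funext => la; have [[n X] /= [sla uX nX tX]] := vertex_rep la.
have := hphi n la X sla uX nX tX; rewrite (hpsi n la X sla uX nX tX) => -[] /mulfI E.
by apply/esym/E; rewrite gt_eqF // weight_gt0.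
Qed.

End Correspondence.

(** * Ergodicity *)

Section Comparison.
Variables (R : realType) (d : measure_display) (T : measurableType d).
Variables m1 m2 : {measure set T -> \bar R}.

(** Both measures may be infinite, and m1 - m2 is a charge only after restriction to a set of finite
    measure. *)
Lemma Hahn_restr D : measurable D -> (m1 D < +oo)%E -> (m2 D < +oo)%E ->
  exists E, [/\ measurable E,
    forall B, measurable B -> B `<=` E `&` D -> (m2 B <= m1 B)%E &
    forall B, measurable B -> B `<=` D `\` E -> (m1 B <= m2 B)%E].
Proof.
move=> mD f1 f2.
pose nu : {charge set T -> \bar R} := cadd (charge_of_finite_measure (mfrestr mD f1))
  (cscale (-1) (charge_of_finite_measure (mfrestr mD f2))).
have nuE B : measurable B -> B `<=` D -> nu B = (m1 B - m2 B)%E.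
  move=> mB BD; rewrite -[nu B]/(m1 (B `&` D) + (-1)%:E * m2 (B `&` D))%E.
  by rewrite (setIidl BD) mulN1e.
have fin (m : {measure set T -> \bar R}) B : measurable B -> B `<=` D -> (m D < +oo)%E ->
    m B \is a fin_num.
  move=> mB BD fD; rewrite ge0_fin_numE ?measure_ge0 //; apply: le_lt_trans fD.
  by apply: le_measure; rewrite ?inE.
have [E [N [[mE Ep] [mN Nn] EN _]]] := Hahn_decomposition nu.
exists E; split=> // B mB BE.
  have BD : B `<=` D by move=> x /BE[].
  have := Ep B mB (fun x Bx => proj1 (BE x Bx)).
  by rewrite nuE // sube_ge0 // fin.
have BD : B `<=` D by move=> x /BE[].
have BN : B `<=` N.
  move=> x Bx; have [_ nE] := BE x Bx.
  by have [] : (E `|` N) x by rewrite EN.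
by have := Nn B mB BN; rewrite nuE // sube_le0 ?fin.
Qed.

Definition dominated_on (C : set T) := forall B, measurable B -> B `<=` C -> (m2 B <= m1 B)%E.

(** B is cut along the disjointified sequence, and domination is summed over the pieces. *)
Lemma dominated_bigcup (C : nat -> set T) : (forall k, measurable (C k)) ->
  (forall k, dominated_on (C k)) -> dominated_on (\bigcup_k C k).
Proof.
move=> mC domC B mB BC.
have BE : B = \bigcup_k (B `&` seqDU C k).
  by rewrite -setI_bigcupr -seqDU_bigcup_eq; apply/esym/setIidl.
have mU k : measurable (seqDU C k).
  by apply: measurableD => //; rewrite -bigcup_mkord; apply: bigcup_measurable.
have mBU k : measurable (B `&` seqDU C k) by exact: measurableI.
have tBU : trivIset setT (fun k => B `&` seqDU C k).
  by apply: trivIset_setIl; exact: trivIset_seqDU.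
rewrite BE !measure_semi_bigcup //; last 2 first.
- by apply: bigcupT_measurable.
- by apply: bigcupT_measurable.
apply: lee_nneseries => k _; first by move=> _; exact: measure_ge0.
by apply: domC => // x [_]; exact: subset_seqDU.
Qed.

Lemma dominated_count (I : countType) (C : I -> set T) : (forall i, measurable (C i)) ->
  (forall i, dominated_on (C i)) ->
  measurable (\bigcup_i C i) /\ dominated_on (\bigcup_i C i).
Proof.
move=> mC domC; pose C' k := if unpickle k is Some i then C i else set0.
have -> : \bigcup_i C i = \bigcup_k C' k.
  apply/seteqP; split=> x [i _ Ci]; first by exists (pickle i) => //; rewrite /C' pickleK.
  by move: Ci; rewrite /C'; case: unpickle => // j Cj; exists j.
have mC' k : measurable (C' k) by rewrite /C'; case: unpickle.
split; first exact: bigcupT_measurable.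
apply: dominated_bigcup => // k; rewrite /C'; case: unpickle => // B mB.
by rewrite subset0 => ->; rewrite !measure0.
Qed.

End Comparison.

Section Ergodicity.
Variables (R : realType) (K : quadField) (o : bool).
Notation dimN := (dimN o).
Notation Lspace := (Lspace K o).
Notation Lborel := (Lborel K o).
Notation weight := (weight R K).
Implicit Types (M : Lspace) (A B : set Lspace) (P : {measure set Lborel -> \bar R}).
Let t : R := - ((qq K)%:R)^-1.

Lemma measure_to_funD P P' : P0 P -> P0 P' ->
  measure_to_fun (measure_add P P') = (fun la => measure_to_fun P la + measure_to_fun P' la).
Proof.
move=> h h'; apply/funext => la; rewrite /measure_to_fun.
case: cid => -[n X] /= _; rewrite -mulrDl; congr (_ / _).
by rewrite [X in fine X](measure_addE P P' (Cyl X)) fineD ?P0_fin.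
Qed.

Lemma measure_to_funZ (c : {nonneg R}) P : P0 P ->
  measure_to_fun (mscale c P) = (fun la => c%:num * measure_to_fun P la).
Proof.
move=> h; apply/funext => la; rewrite /measure_to_fun.
case: cid => -[n X] /= _; rewrite mulrA; congr (_ / _).
by rewrite /mscale /= fineM ?P0_fin.
Qed.

Lemma P0_mrestr P A (mA : measurable (A : set Lborel)) : P0 P -> invariant_set A ->
  P0 (mrestr P mA : {measure set Lborel -> \bar R}).
Proof.
move=> [rP iP zP] /invariant_setP iA; split.
- move=> C cC; apply: le_lt_trans (rP C cC); rewrite /= /mrestr.
  have mC := compact_measurable cC.
  by apply: le_measure; rewrite ?inE //; exact: measurableI.
- apply/invariantP => g Ug B mB; rewrite /= /mrestr.
  have /invariantP/(_ g Ug (B `&` A) (measurableI _ _ mB mA)) <- := iP.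
  congr (P _); rewrite -{1}(iA g Ug) !act_imageE // -preimage_setI //.
- apply/eqP; rewrite eq_le measure_ge0 andbT -zP /= /mrestr.
  have mN := @measurable_NilLC K o.
  by apply: le_measure; rewrite ?inE //; exact: measurableI.
Qed.

Lemma extreme_ergodic P : P0 P -> extreme t (measure_to_fun P) -> ergodic P.
Proof.
move=> P0P [_ [la0 nz] ext]; have [rP iP zP] := P0P; split=> //.
  apply: contraNN nz => /eqP z; rewrite /measure_to_fun; case: cid => -[n X] /= _.
  rewrite (_ : P (Cyl X) = 0%E) ?mul0r //; apply/eqP; rewrite eq_le measure_ge0 andbT -z.
  by apply: le_measure; rewrite ?inE //; exact: measurable_Lev (Lev_Cyl X).
move=> A mA iA; have mAc : measurable (~` A : set Lborel) := measurableC mA.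
have iAc : invariant_set (~` A).
  apply/invariant_setP => g Ug; move/invariant_setP: iA => /(_ g Ug).
  by rewrite !act_imageE // -preimage_setC => ->.
pose P1 : {measure set Lborel -> \bar R} := mrestr P mA.
pose P2 : {measure set Lborel -> \bar R} := mrestr P mAc.
have h1 : P0 P1 by exact: P0_mrestr.
have h2 : P0 P2 by exact: P0_mrestr.
have sumP : same_measure P (measure_add P1 P2).
  move=> B mB; rewrite [RHS](measure_addE P1 P2 B) addeC.
  by rewrite (measureDI P mB mA).
have [|[c c0 cE] _] := ext _ _ (measure_to_fun_Hplus h1) (measure_to_fun_Hplus h2).
  by exists 1 => // la; rewrite mul1r (measure_to_fun_eq sumP) measure_to_funD.
have E : same_measure P1 (mscale (NngNum c0) P).
  apply: measure_to_fun_inj => //; first exact: P0_mscale.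
  by rewrite measure_to_funZ //; apply/funext.
(* P1 lives on A, so P1 = c P at the complement of A reads 0 = c P(~A). Either c = 0, and then P(A)
   = P1(A) = 0, or the complement is null. *)
have := E (~` A) mAc; rewrite /= /mrestr /mscale /= setICl measure0 => /esym/eqP.
rewrite mule_eq0 => /orP[/eqP[c00]|/eqP]; last by right.
left; have := E A mA; rewrite /= /mrestr /mscale /= setIid => ->.
by rewrite c00 mul0e.
Qed.

Lemma act_image_imul g g' A : Uinf g -> Uinf g' ->
  act g @` (act g' @` A) = act (imul g g') @` A.
Proof.
move=> Ug Ug'; rewrite image_comp; apply: eq_imagel => M _ /=.
by rewrite act_imul.
Qed.

(** Every element of the group is [uext] of a finite unitary block, so this countable type
    enumerates all translates of all [E n], and their union remains measurable. *)
Definition orbit_index := (nat * {m : nat & 'M[K]_(dimN m)})%type.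

Definition orbit_part (E : nat -> set Lspace) (i : orbit_index) : set Lspace :=
  if `[< unitary (projT2 i.2) >] then act (uext (projT2 i.2)) @` E i.1 else set0.

Lemma orbit_part_invariant (E : nat -> set Lspace) : invariant_set (\bigcup_i orbit_part E i).
Proof.
have sub g : Uinf g -> act g @` (\bigcup_i orbit_part E i) `<=` \bigcup_i orbit_part E i.
  move=> Ug _ [M [[n [m A]] _ +] <-]; rewrite /orbit_part /=; case: asboolP => // uA hM.
  have Ug' : Uinf (uext A) by exists m => //; exact: Ulevel_uext.
  have [k _ Uk] := Uinf_imul Ug Ug'.
  have uk : unitary (block k (imul g (uext A))) by case: Uk.
  have hgM : (act (imul g (uext A)) @` E n) (act g M).
    by rewrite -act_image_imul //; exists M.
  by exists (n, existT _ k (block k (imul g (uext A)))) => //; rewrite /orbit_part /= asboolT // (uext_block Uk).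
apply/invariant_setP => g Ug; apply/seteqP; split; first exact: sub.
move=> M hM; rewrite act_imageE // /preimage /mkset.
by apply: (sub _ (Uinf_hadj Ug)); exists M.
Qed.

Lemma orbit_part_sub (E : nat -> set Lspace) n : E n `<=` \bigcup_i orbit_part E i.
Proof.
move=> M EM; have u1 : unitary (1%:M : 'M[K]_(dimN 0)).
  by apply/unitaryP; rewrite mul1mx ctrmx1 mulmx1 mulWW.
have U1 := Ulevel_uext u1.
exists (n, existT (fun m => 'M[K]_(dimN m)) 0%N 1%:M) => //; rewrite /orbit_part /= asboolT //.
exists M => //; apply: Lspace_inj; apply: (@imx_eq_ge _ _ 0) => k _.
have e1 : uext (1%:M : 'M[K]_(dimN 0)) = @iid K o.
  by apply: (@block1_out _ _ 0); [exact: Ulevel_diag U1|exact: block_uext].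
rewrite (block_act M U1 (leq0n k)) block_hadj e1 block_iid.
by rewrite ctrmx1 mulmx1 mulWW mulmx1 mul1mx.
Qed.

(* A set of Hahn positivity for P1 - P2 stays one when translated, so the union
   of all its translates is an invariant set to which ergodicity applies. *)
Lemma ergodic_dichotomy P P1 P2 : ergodic P -> P0 P1 -> P0 P2 ->
  (forall A, measurable (A : set Lborel) -> P A = 0%E -> P1 A = 0%E /\ P2 A = 0%E) ->
  (forall n A, measurable (A : set Lborel) -> A `<=` Lbounded n -> (P1 A <= P2 A)%E) \/
  (forall A, measurable (A : set Lborel) -> (P2 A <= P1 A)%E).
Proof.
move=> [_ _ erg] h1 h2 dom; have [r1 /invariantP i1 _] := h1; have [r2 /invariantP i2 _] := h2.
have mL n : measurable (@Lbounded K o n : set Lborel) := measurable_Lev (@Lev_bounded K o n).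
have H n := Hahn_restr (mL n) (radon_fin r1 (@Lev_bounded K o n)) (radon_fin r2 (@Lev_bounded K o n)).
have [F hF] := choice H.
pose E n := F n `&` @Lbounded K o n.
have mE n : measurable (E n : set Lborel) by have [mF _ _] := hF n; exact: measurableI.
have [mU dU] : measurable (\bigcup_i orbit_part E i : set Lborel) /\
    dominated_on P1 P2 (\bigcup_i orbit_part E i).
  apply: dominated_count => -[n [m A]]; rewrite /orbit_part /=.
    case: asboolP => [uA|_]; last exact: measurable0.
    by apply: measurable_act_image => //; exists m => //; exact: Ulevel_uext.
  case: asboolP => [uA|_] B mB; last by rewrite subset0 => ->; rewrite !measure0.
  have Ug : Uinf (uext A) by exists m => //; exact: Ulevel_uext.
  have Ug' := Uinf_hadj Ug; rewrite -(i1 _ Ug' B mB) -(i2 _ Ug' B mB) => BE.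
  have [_ pos _] := hF n; apply: pos; first exact: measurable_act_image.
  rewrite act_imageE // hadjK => M /= /BE[M' EM'] /(congr1 (act (hadj (uext A)))).
  by rewrite !actK // => <-.
set U := \bigcup_i _ in mU dU.
have [U0|U0] := erg U mU (orbit_part_invariant E); [left=> n A mA AL|right=> A mA].
  have [U1 U2] := dom U mU U0.
  rewrite (measureDI P1 mA mU) (measureDI P2 mA mU).
  have z (Q : {measure set Lborel -> \bar R}) : Q U = 0%E -> Q (A `&` U) = 0%E.
    move=> QU; apply/eqP; rewrite eq_le measure_ge0 andbT -QU.
    by apply: le_measure; rewrite ?inE //; exact: measurableI.
  rewrite [X in (_ + X <= _)%E](z _ U1) [X in (_ <= _ + X)%E](z _ U2) !adde0; have [_ _ neg] := hF n; apply: neg; first exact: measurableD.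
  move=> M [AM nUM]; split; first exact: AL.
  by move=> FM; apply: nUM; apply: (@orbit_part_sub E n); split=> //; exact: AL.
have mUc : measurable (~` U : set Lborel) := measurableC mU.
have [_ U2] := dom _ mUc U0.
rewrite (measureDI P2 mA mU) [X in (X + _ <= _)%E](_ : _ = 0%E) ?add0e; last first.
  apply/eqP; rewrite eq_le measure_ge0 andbT -U2.
  by apply: le_measure; rewrite ?inE //; exact: measurableD.
have mAU : measurable (A `&` U : set Lborel) by exact: measurableI.
apply: le_trans (dU _ mAU (@subIsetr _ _ _)) _.
by apply: le_measure; rewrite ?inE.
Qed.

(** Otherwise P and 0 P have the same function, and injectivity makes P null. *)
Lemma ergodic_neq0 P : P0 P -> ergodic P -> exists la, measure_to_fun P la != 0.
Proof.
move=> hP [/eqP nP _ _]; apply: contrapT => /forallNP nz; apply: nP.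
have z : same_measure P (mscale (NngNum (lexx 0)) P).
  apply: measure_to_fun_inj => //; first exact: P0_mscale.
  apply/funext => la; rewrite measure_to_funZ //= mul0r; apply/eqP/negPn/negP.
  exact: nz.
by rewrite z //= /mscale /= mul0e.
Qed.

(** The dichotomy applied to P1 and a P, for every a >= 0, compares the two functions at all
    vertices at once, which leaves room for a single ratio. *)
Lemma ergodic_proportional P P1 : P0 P -> ergodic P -> P0 P1 ->
  (forall A, measurable (A : set Lborel) -> P A = 0%E -> P1 A = 0%E) ->
  ray (measure_to_fun P) (measure_to_fun P1).
Proof.
move=> hP erg hP1 dom.
set x := measure_to_fun P1; set y := measure_to_fun P.
have x0 la : 0 <= x la := measure_to_fun_ge0 P1 la.
have y0 la : 0 <= y la := measure_to_fun_ge0 P la.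
have dich a : 0 <= a -> (forall la, x la <= a * y la) \/ (forall la, a * y la <= x la).
  move=> a0; pose Pa : {measure set Lborel -> \bar R} := mscale (NngNum a0) P.
  have hPa : P0 Pa by exact: P0_mscale.
  have key (Q Q' : {measure set Lborel -> \bar R}) la : P0 Q -> P0 Q' ->
      (forall n (X : 'M[K]_(dimN n)), Q (Cyl X) <= Q' (Cyl X))%E ->
      measure_to_fun Q la <= measure_to_fun Q' la.
    move=> hQ hQ' le; have [[n X] /= [_ uX nX tX]] := vertex_rep K la.
    have := le n X; rewrite (measure_to_funE hQ uX tX) (measure_to_funE hQ' uX tX) lee_fin.
    by rewrite ler_pM2l ?weight_gt0.
  have yE la : a * y la = measure_to_fun Pa la by rewrite measure_to_funZ.
  have [|h|h] := @ergodic_dichotomy P P1 Pa erg hP1 hPa.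
  - by move=> A mA z; split; [exact: dom|rewrite -[LHS]/(a%:E * P A)%E z mule0].
  - left=> la; rewrite yE; apply: key => // n X.
    by apply: (h n); [exact: measurable_Lev (Lev_Cyl X)|move=> M []].
  - right=> la; rewrite yE; apply: key => // n X; apply: h.
    exact: measurable_Lev (Lev_Cyl X).
have [la0 yla0] : exists la, y la != 0 by exact: ergodic_neq0.
have yp : 0 < y la0 by rewrite lt_neqAle eq_sym yla0 y0.
pose c := x la0 / y la0; have c0 : 0 <= c by rewrite divr_ge0.
have cE : c * y la0 = x la0 by rewrite /c divfK.
exists c => // la; apply/eqP; rewrite eq_le; apply/andP; split; rewrite leNgt; apply/negP => lt.
  have [y1|y1] := eqVneq (y la) 0.
    (* Any a > c would do: a * 0 does not bound x la > 0 from above, and a * y la0 exceeds x la0. *)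
    have [|h|h] := dich (c + 1); first by lra.
      by have := h la; rewrite y1 in lt *; lra.
    by have := h la0; rewrite mulrDl cE mul1r; lra.
  have yp1 : 0 < y la by rewrite lt_neqAle eq_sym y1 y0.
  have lt' : c < x la / y la by rewrite ltr_pdivlMr.
  (* For a strictly between the ratios at [la0] and [la], one vertex refutes each alternative. *)
  pose a := (c + x la / y la) / 2; have ca : c < a by rewrite /a; lra.
  have ax : a * y la < x la by rewrite -ltr_pdivlMr // /a; lra.
  have [|h|h] := dich a; first by lra.
    by have := h la; rewrite leNgt ax.
  by have := h la0; rewrite leNgt -cE ltr_pM2r ?ca.
have yp1 : 0 < y la.
  rewrite lt_neqAle y0 andbT; apply/negP => /eqP y1.
  by have := x0 la; rewrite leNgt; rewrite -y1 mulr0 in lt; rewrite lt.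
have lt' : x la / y la < c by rewrite ltr_pdivrMr.
have xy0 : 0 <= x la / y la by rewrite divr_ge0.
pose a := (c + x la / y la) / 2; have ca : a < c by rewrite /a; lra.
have ax : x la < a * y la by rewrite -ltr_pdivrMr // /a; lra.
have [|h|h] := dich a; first by rewrite /a; lra.
  by have := h la0; rewrite leNgt -cE ltr_pM2r ?ca.
by have := h la; rewrite leNgt ax.
Qed.

(** The summands come from measures with P1 + P2 = c P, which makes both absolutely continuous with
    respect to P, hence proportional to it. *)
Lemma ergodic_extreme P : P0 P -> ergodic P -> extreme t (measure_to_fun P).
Proof.
move=> hP erg; split; first exact: measure_to_fun_Hplus.
  exact: ergodic_neq0.
move=> phi1 phi2 h1 h2 [c c0 cE].
have [P1 hP1 E1] := exists_measure h1; have [P2 hP2 E2] := exists_measure h2.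
have S : same_measure (measure_add P1 P2) (mscale (NngNum c0) P).
  apply: measure_to_fun_inj => //; [exact: P0_measure_add|exact: P0_mscale|].
  by rewrite measure_to_funD // measure_to_funZ // E1 E2; apply/funext.
have dom A : measurable (A : set Lborel) -> P A = 0%E -> (P1 A + P2 A = 0)%E.
  move=> mA z; apply: etrans (esym (measure_addE P1 P2 A)) _.
  by apply: etrans (S A mA) _; rewrite -[LHS]/(c%:E * P A)%E z mule0.
rewrite -E1 -E2; split; apply: ergodic_proportional => // A mA /(dom A mA) /eqP.
  by rewrite padde_eq0 ?measure_ge0 // => /andP[/eqP].
by rewrite padde_eq0 ?measure_ge0 // => /andP[_ /eqP].
Qed.

End Ergodicity.

Theorem theorem8p9 (R : realType) (K : quadField) (o : bool) :
  let t : R := - ((qq K)%:R)^-1 in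
  exists Phi : {measure set (Lborel K o) -> \bar R} -> (vertex o -> R),
    (* (i) *)
    [/\ forall P, P0 P -> Hplus t (Phi P),
        forall P P', P0 P -> P0 P' -> (Phi P = Phi P' <-> same_measure P P'),
        forall phi, Hplus t phi -> exists2 P, P0 P & Phi P = phi,
        forall P, P0 P -> compatible P (Phi P) &
        forall Psi : {measure set (Lborel K o) -> \bar R} -> (vertex o -> R),
          (forall P, P0 P -> compatible P (Psi P)) ->
          forall P, P0 P -> Psi P = Phi P] /\
    (* (ii) *)
    [/\ forall P P', P0 P -> P0 P' ->
          Phi (measure_add P P') = (fun la => Phi P la + Phi P' la),
        forall (c : {nonneg R}) P, P0 P ->
          Phi (mscale c P) = (fun la => c%:num * Phi P la) &
        forall P, P0 P -> (ergodic P <-> extreme t (Phi P))].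
Proof.
move=> t; exists (@measure_to_fun R K o); split; split.
- by move=> P; exact: measure_to_fun_Hplus.
- by move=> P P' hP hP'; split; [exact: measure_to_fun_inj|exact: measure_to_fun_eq].
- by move=> phi; exact: exists_measure.
- by move=> P; exact: measure_to_fun_compatible.
- move=> Psi hPsi P hP; apply: compatible_unique (hPsi P hP) _.
  exact: measure_to_fun_compatible.
- by move=> P P'; exact: measure_to_funD.
- by move=> c P; exact: measure_to_funZ.
- by move=> P hP; split; [exact: ergodic_extreme|exact: extreme_ergodic].
Qed.
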